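(* Let $a<b$ be real numbers and let $r\ge 3$ be an integer. Let $g$ be the Green's function of the Dirichlet problem $(-1)^r\phi^{(2r)}=f$ on $(a,b)$, $\phi^{(k)}(a)=\phi^{(k)}(b)=0$ for $k=0,\dots,r-1$. For $k\ge 1$ let $(\lambda_k,\phi_k)$ be the $k$-th eigenpair of $\int_a^b g(x,y)\phi(y)\,dy=\lambda\phi(x)$. For $m\ge 1$ let $h=(b-a)/(m+1)$, and for $1\le k\le m$ let $(\lambda_{k,h},\phi_{k,h})$ be the $k$-th eigenpair of its trapezoidal rule discretization on the uniform partition of $[a,b]$ into $m+1$ segments. All eigenfunctions are normalized by $\max_{[a,b]}|\phi_k|=\max_{[a,b]}|\phi_{k,h}|=1$, and the sign of $\phi_{k,h}$ is suitably chosen. Put $f_k(x,y)=g(x,y)\phi_k(y)$. (i) For every $k\ge1$ there is a constant $C>0$, independent of $h$, such that for all $m\ge k$ with $h<(k+1)^{-1}$, $$|\lambda_k-\lambda_{k,h}|+\max_{x\in[a,b]}|\phi_k(x)-\phi_{k,h}(x)|\le C\,h^{2r-2}\max_{x,y\in[a,b]}\bigl|\partial_y^{2r-2}f_k(x,y)\bigr|.$$ (ii) For every $n\ge r$, let $d_n$ be the smallest constant for which there exists an $n$-dimensional subspace $X_n\subset L^2(a,b)$ with $\min_{v\in X_n}\|u-v\|\le d_n\|u^{(r)}\|$ for all $u\in H^r(a,b)$. Then there is a constant $C>0$, depending (for the fixed interval $(a,b)$) only on $r$ and $n$, such that for all $m\ge n+1-r$ with $h<(n+2-r)^{-1}$,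 $$\bigl|d_n-\lambda_{n+1-r,h}^{1/2}\bigr|\le C\,h^{2r-2}.$$
   Context: $\|\cdot\|$ is the $L^2(a,b)$ norm and $H^r(a,b)$ is the Sobolev space of order $r$. Green's function: for each $y\in(a,b)$, $g(\cdot,y)$ is the distributional solution of $\partial_x^{2r}g(x,y)=(-1)^r\delta_y$ on $(a,b)$ with $\partial_x^k g(x,y)|_{x=a}=\partial_x^k g(x,y)|_{x=b}=0$ for $k=0,\dots,r-1$, where $\delta_y$ is the Dirac delta at $y$; $g$ is symmetric and extended by continuity (by $0$) to $y\in\{a,b\}$. Continuous eigenproblem: eigenvalues are ordered decreasingly, $\lambda_1\ge\lambda_2\ge\dots>0$; equivalently $1/\lambda_k$ is the $k$-th smallest eigenvalue $\mu$ of $(-1)^r\phi^{(2r)}=\mu\phi$ on $(a,b)$, $\phi^{(j)}(a)=\phi^{(j)}(b)=0$, $j=0,\dots,r-1$. Discrete eigenproblem: with nodes $\xi_\ell=a+\ell h$, $\ell=0,\dots,m+1$, the integral is replaced by the composite trapezoidal rule, which (since $g(x,a)=g(x,b)=0$) gives $$h\sum_{\ell=1}^m g(x,\xi_\ell)\phi(\xi_\ell)=\lambda\phi(x).$$ Collocating at $x=\xi_1,\dots,\xi_m$ gives the matrix eigenvalue problem $h\,[g(\xi_i,\xi_\ell)]_{i,\ell=1}^m\,\mathbf v=\lambda\mathbf v$ with eigenvalues $\lambda_{1,h}\ge\dots\ge\lambda_{m,h}$. The function $\phi_{k,h}$ on $[a,b]$ associated with an eigenvector $\mathbf v=(v_1,\dots,v_m)$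 for $\lambda_{k,h}$ is $\phi_{k,h}(x)=\frac{h}{\lambda_{k,h}}\sum_{\ell=1}^m g(x,\xi_\ell)v_\ell$, with $\mathbf v$ scaled so that $\max_{[a,b]}|\phi_{k,h}|=1$. *)

(* Defs.v *)
From HB Require Import structures.
From mathcomp Require Import all_boot all_order all_algebra.
From mathcomp Require Import all_classical all_reals all_analysis.
Set Implicit Arguments.
Unset Strict Implicit.
Unset Printing Implicit Defensive.
Import Order.TTheory GRing.Theory Num.Theory.
Import numFieldNormedType.Exports.
Local Open Scope classical_set_scope.
Local Open Scope ring_scope.

(* Functions on [a, b] are represented by functions R -> R of which only the
   values on [a, b] matter. *)

(* The derivative on the closed interval: two-sided in ]a, b[, one-sided at
   the end points, blind to the values outside [a, b]. *)
Definition derive_itv (R : realType) (a b : R) (f : R -> R) (x : R) : R :=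
  lim ((f y - f x) / (y - x) @[y --> within `[a, b] x^']).

Definition derive_itvn (R : realType) (a b : R) (k : nat) (f : R -> R) :
  R -> R := iter k (derive_itv a b) f.

(* A maximum wherever it is used below, the functions being continuous on the
   compact interval [a, b]. *)
Definition max_abs (R : realType) (a b : R) (f : R -> R) : R :=
  sup [set `|f x| | x in `[a, b]].

Definition max_abs2 (R : realType) (a b : R) (f : R -> R -> R) : R :=
  sup [set `|f x y| | x in `[a, b] & y in `[a, b]].

(* psi \in C_c^oo(a, b) *)
Definition test_function (R : realType) (a b : R) (psi : R -> R) : Prop :=
  (forall (k : nat) (x : R), derivable (derive1n k psi) x 1) /\
  (exists c d : R, [/\ a < c, d < b & forall x, x \notin `[c, d] -> psi x = 0]).

Definition weak_derivative (R : realType) (a b : R) (k : nat)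
    (u w : R -> R) : Prop :=
  forall psi, test_function a b psi ->
    \int[lebesgue_measure]_(x in `]a, b[) (u x * derive1n k psi x) =
    (-1) ^+ k * \int[lebesgue_measure]_(x in `]a, b[) (w x * psi x).

(* The sign (-1)^(2r) produced by moving the 2r derivatives onto the test
   function is 1. The distribution g(., y) is represented by its continuous
   version, so that its boundary derivatives make sense. *)
Definition is_green (R : realType) (a b : R) (r : nat)
    (g : R -> R -> R) : Prop :=
  [/\ forall y, y \in `]a, b[ ->
        [/\ {within `[a, b], continuous (g^~ y)},
            forall psi, test_function a b psi ->
              \int[lebesgue_measure]_(x in `]a, b[)
                (g x y * derive1n (2 * r) psi x) =
              (-1) ^+ r * psi y &
            forall k, (k < r)%N ->
              derive_itvn a b k (g^~ y) a = 0 /\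
              derive_itvn a b k (g^~ y) b = 0] &
      forall x, x \in `[a, b] -> g x a = 0 /\ g x b = 0].

Definition eigenpair (R : realType) (a b : R) (g : R -> R -> R)
    (mu : R) (psi : R -> R) : Prop :=
  {within `[a, b], continuous psi} /\
  forall x, x \in `[a, b] ->
    \int[lebesgue_measure]_(y in `[a, b]) (g x y * psi y) = mu * psi x.

(* (lam k, phi k), k >= 1, is the k-th eigenpair; the index 0 is not used.
   The last two conditions say that the phi k with lam k = mu form a basis of
   the eigenspace of mu, i.e. that eigenvalues are listed with multiplicity
   and that none is missing. *)
Definition eigensystem (R : realType) (a b : R) (g : R -> R -> R)
    (lam : nat -> R) (phi : nat -> R -> R) : Prop :=
  [/\ forall k, (0 < k)%N ->
        [/\ 0 < lam k, eigenpair a b g (lam k) (phi k) &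
            max_abs a b (phi k) = 1],
      forall j k, (0 < j)%N -> (j <= k)%N -> lam k <= lam j,
      forall (N : nat) (c : nat -> R),
        (forall x, x \in `[a, b] -> \sum_(1 <= k < N) c k * phi k x = 0) ->
        forall k, (0 < k < N)%N -> c k = 0 &
      forall (mu : R) (psi : R -> R), mu != 0 -> eigenpair a b g mu psi ->
        exists (N : nat) (c : nat -> R), forall x, x \in `[a, b] ->
          psi x = \sum_(1 <= k < N | lam k == mu) c k * phi k x].

Definition mesh (R : realType) (a b : R) (m : nat) : R := (b - a) / m.+1%:R.

Definition node (R : realType) (a b : R) (m l : nat) : R :=
  a + l%:R * mesh a b m.

(* The index i : 'I_m stands for the interior node number i + 1. *)
Definition discrete_matrix (R : realType) (a b : R) (g : R -> R -> R)
    (m : nat) : 'M[R]_m :=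
  \matrix_(i, l) (mesh a b m * g (node a b m i.+1) (node a b m l.+1)).

(* mu 1 >= ... >= mu m are the eigenvalues, with multiplicity. *)
Definition discrete_eigenvalues (R : realType) (a b : R) (g : R -> R -> R)
    (m : nat) (mu : nat -> R) : Prop :=
  char_poly (discrete_matrix a b g m) =
    \prod_(1 <= k < m.+1) ('X - (mu k)%:P) /\
  (forall j k, (0 < j)%N -> (j <= k)%N -> (k <= m)%N -> mu k <= mu j).

Definition discrete_eigenfunction (R : realType) (a b : R) (g : R -> R -> R)
    (m : nat) (mu : R) (psi : R -> R) : Prop :=
  exists v : 'cV[R]_m,
    [/\ discrete_matrix a b g m *m v = mu *: v,
        forall x, x \in `[a, b] ->
          psi x = mesh a b m / mu *
                  \sum_(l < m) g x (node a b m l.+1) * v l ord0 &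
        max_abs a b psi = 1].

Definition lebesgue_itv (R : realType) (a b : R) :
    {measure set (measurableTypeR R) -> \bar R} :=
  mrestr lebesgue_measure (measurable_itv `]a, b[).

Definition L2 (R : realType) (a b : R) : set (R -> R) :=
  [set u | u \in Lfun (lebesgue_itv a b) 2%:E].

Definition L2norm (R : realType) (a b : R) (u : R -> R) : \bar R :=
  ('N[lebesgue_itv a b]_2%:E[EFin \o u])%E.

Definition L2dist (R : realType) (a b : R) (u v : R -> R) : \bar R :=
  L2norm a b (fun x => u x - v x).

(* H^r(a, b) *)
Definition sobolev (R : realType) (a b : R) (r : nat) (u : R -> R) : Prop :=
  L2 a b u /\
  forall k, (k <= r)%N -> exists2 w, L2 a b w & weak_derivative a b k u w.

Definition lincomb (R : realType) (n : nat) (e : 'I_n -> R -> R)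
    (c : 'I_n -> R) : R -> R := fun x => \sum_(i < n) c i * e i x.

(* e is a basis of an n-dimensional subspace of L^2(a, b); a vanishing norm
   is equality to 0 in L^2. *)
Definition L2_basis (R : realType) (a b : R) (n : nat)
    (e : 'I_n -> R -> R) : Prop :=
  (forall i, L2 a b (e i)) /\
  (forall c : 'I_n -> R, L2norm a b (lincomb e c) = 0%E -> forall i, c i = 0).

(* Some n-dimensional X_n, spanned by e, satisfies
   min_(v in X_n) ||u - v|| <= C ||u^(r)|| for all u in H^r(a, b); here c are
   the coordinates of a minimizer v, and w is u^(r). *)
Definition approximation_constant (R : realType) (a b : R) (r n : nat)
    (C : R) : Prop :=
  exists2 e : 'I_n -> R -> R, L2_basis a b e &
    forall u w, sobolev a b r u -> L2 a b w -> weak_derivative a b r u w ->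
      exists2 c : 'I_n -> R,
        forall c' : 'I_n -> R, (L2dist a b u (lincomb e c) <=
                    L2dist a b u (lincomb e c'))%E &
        (L2dist a b u (lincomb e c) <= C%:E * L2norm a b w)%E.

Definition smallest_approximation_constant (R : realType) (a b : R)
    (r n : nat) (d : R) : Prop :=
  approximation_constant a b r n d /\
  forall C, approximation_constant a b r n C -> d <= C.

(* Main.v *)
Require Import Defs.
From HB Require Import structures.
From mathcomp Require Import all_boot all_order all_algebra.
From mathcomp Require Import all_classical all_reals all_analysis.
From mathcomp Require Import measurable_realfun.
From mathcomp Require Import zify ring lra.
From mathcomp.real_closed Require complex.
Set Implicit Arguments.
Unset Strict Implicit.
Unset Printing Implicit Defensive.
Import Order.TTheory GRing.Theory Num.Theory.
Import numFieldNormedType.Exports.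
Local Open Scope classical_set_scope.
Local Open Scope ring_scope.

(** For an eigenfunction [phi], the product of Green's function and [phi], as a function of y,
    vanishes to order 2r at both ends and has 2r-2 continuous derivatives, the truncated power in
    the kernel limiting its smoothness. On such integrands the trapezoidal rule has no boundary
    corrections and its error is O(h^(2r-2)), uniformly in x ([trapezoid_error],
    [quad_green_error]). The samples of [phi] at the nodes are therefore an approximate eigenvector
    of a symmetric matrix, with residual O(h^(2r-2)). Expanding in an orthonormal eigenbasis, a
    spectral gap turns this residual into errors of the same order for the eigenvalue and the
    eigenfunction ([eigenvalue_bound], [eigenfunction_bound]).

    The gap ([spectral_gap]) rests on two facts. First, nonzero eigenvalues of the continuous
    problem are simple ([eigfun_simple]): two eigenfunctions for the same eigenvalue have a
    combination whose r-th derivative also vanishes at a, and a nonzero solution of this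
    overdetermined problem would have unboundedly many sign alternations ([overdetermined_eq0]).
    Second, each discrete eigenvalue converges to the continuous one of the same rank ([cfs_limit]):
    along an ultrafilter the discrete eigenvalues and the Nystrom extensions of the discrete
    eigenvectors converge to a system [cfs] that satisfies a maximum principle, and Courant-Fischer
    shows that its eigenvalues do not depend on the ultrafilter. [es_cfs] identifies them with the
    eigenvalues of the given eigensystem. The finitely many coarse meshes only enlarge the constant
    ([bound_of_near]), and the maximum in the estimate is a positive number independent of the mesh
    ([max_abs2_gt0]).

    All of this is carried out for an explicit kernel [green], a truncated power plus a Hermite
    polynomial. It coincides with any kernel defined distributionally ([green_unique]), because the
    difference is a polynomial of degree below 2r with zero clamped data.

    For the widths, d_n is exactly the square root of the eigenvalue of rank n+1-r
    ([smallest_approximation_constantE]). An optimal space is spanned by the polynomials of degree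
    below r and the r-th derivatives of the first n-r eigenfunctions. The lower bound is a dimension
    count on n+1 such functions ([approximation_constant_ge]). The upper bound is a duality argument
    ([orthogonal_width_le]): pairing u with the projection residual f amounts to pairing the r-th
    derivative of u with an r-fold primitive of f, which is orthogonal to the first n-r
    eigenfunctions. The rate for d_n is then that of the eigenvalue. *)

(** * Continuity, integration and differentiation on a segment *)

Section Segment.
Variable R : realType.
Implicit Types (a b x y c : R) (f g u v : R -> R).

(* A wrapper rather than a definition, so that the arguments of the lemmas below
   are not all inferred as implicit through the unfolded continuity. *)
Variant cont_on a b f : Prop :=
  ContOn of {within `[a, b], continuous f}.

Lemma cont_on_within a b f : cont_on a b f -> {within `[a, b], continuous f}.
Proof. by case. Qed.

Definition ider a b u v := forall x, a < x < b -> is_derive x 1 u (v x).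

Definition INT a b f : R := \int[lebesgue_measure]_(x in `[a, b]) f x.

Lemma cont_onP a b f : cont_on a b f <->
  (forall x, a <= x <= b -> f y @[y --> within `[a, b] (nbhs x)] --> f x).
Proof.
split=> [[/subspace_continuousP cf] x axb|cf].
  by apply: cf; rewrite /= in_itv.
by split; apply/subspace_continuousP => x /=; rewrite in_itv/=; exact: cf.
Qed.

Lemma eq_cont_on a b f g : cont_on a b f ->
  (forall x, a <= x <= b -> f x = g x) -> cont_on a b g.
Proof.
move=> [cf] fg; split; apply: subspace_eq_continuous cf => x; rewrite inE/= in_itv/= => axb.
exact: fg.
Qed.

Lemma cont_onD a b f g : cont_on a b f -> cont_on a b g ->
  cont_on a b (fun x => f x + g x).
Proof. by move=> [cf] [cg]; split=> x; apply: cvgD; [exact: cf|exact: cg]. Qed.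

Lemma cont_onM a b f g : cont_on a b f -> cont_on a b g ->
  cont_on a b (fun x => f x * g x).
Proof. by move=> [cf] [cg]; split=> x; apply: cvgM; [exact: cf|exact: cg]. Qed.

Lemma cont_on_cst a b c : cont_on a b (fun=> c).
Proof. by split=> x; apply: cvg_cst. Qed.

Lemma cont_onZ a b f c : cont_on a b f -> cont_on a b (fun x => c * f x).
Proof. by move=> cf; apply: cont_onM => //; exact: cont_on_cst. Qed.

Lemma cont_onN a b f : cont_on a b f -> cont_on a b (fun x => - f x).
Proof. by move=> [cf]; split=> x; apply: cvgN; exact: cf. Qed.

Lemma cont_onB a b f g : cont_on a b f -> cont_on a b g ->
  cont_on a b (fun x => f x - g x).
Proof. by move=> cf cg; apply: cont_onD => //; exact: cont_onN. Qed.

Lemma cont_on_sum a b (I : Type) (s : seq I) (P : pred I) (F : I -> R -> R) :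
  (forall i, P i -> cont_on a b (F i)) ->
  cont_on a b (fun x => \sum_(i <- s | P i) F i x).
Proof.
move=> cF; elim: s => [|i s ih].
  by apply: (eq_cont_on (cont_on_cst a b 0)) => x _; rewrite big_nil.
have [Pi|Pi] := boolP (P i); last first.
  by apply: (eq_cont_on ih) => x _; rewrite big_cons (negbTE Pi).
by apply: (eq_cont_on (cont_onD (cF i Pi) ih)) => x _; rewrite big_cons Pi.
Qed.

Lemma cont_on_continuous a b f : continuous f -> cont_on a b f.
Proof. by move=> cf; split; exact: continuous_subspaceT. Qed.

Lemma cont_on_abs a b f : cont_on a b f -> cont_on a b (fun x => `|f x|).
Proof. by move=> [cf]; split=> x; apply: cvg_norm; exact: cf. Qed.

Lemma cont_on_sub a b c d f : a <= c -> d <= b -> cont_on a b f ->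
  cont_on c d f.
Proof.
move=> ac db [cf]; split; apply: continuous_subspaceW cf => x /=; rewrite !in_itv/=.
by case/andP => cx xd; rewrite (le_trans ac)// (le_trans xd).
Qed.

Lemma cont_on_at a b f x : cont_on a b f -> a < x < b -> {for x, continuous f}.
Proof.
move=> cf axb; have ab : a < b by case/andP: axb; exact: lt_trans.
exact: (within_continuous_continuous ab (cont_on_within cf)).
Qed.

Lemma cont_on_bounded a b f : a <= b -> cont_on a b f ->
  exists2 M, 0 <= M & forall x, a <= x <= b -> `|f x| <= M.
Proof.
move=> ab /cont_on_abs[cf]; have [c _ Hc] := EVT_max ab cf.
exists `|f c|; first exact: normr_ge0.
by move=> x axb; apply: Hc; rewrite in_itv.
Qed.

Lemma lipschitz_cont_on a b f L :
  (forall x y, a <= x <= b -> a <= y <= b -> `|f x - f y| <= L * `|x - y|) ->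
  cont_on a b f.
Proof.
move=> Lf; apply/cont_onP => x axb; apply/cvgrPdist_le => e e0.
have L1 : 0 < `|L| + 1 by rewrite ltr_wpDl.
rewrite near_withinE; near=> y => /=; rewrite in_itv/= => ayb.
apply: (le_trans (Lf x y axb ayb)).
rewrite (@le_trans _ _ ((`|L| + 1) * `|x - y|))//.
  by rewrite ler_wpM2r// (le_trans (ler_norm _))// lerDl.
rewrite -ler_pdivlMl//; near: y.
by apply: (@cvgr_dist_le _ _ _ (nbhs x) _ idfun x) => //; rewrite mulr_gt0// invr_gt0.
Unshelve. all: by end_near. Qed.

Lemma cont_on_integrable a b f : cont_on a b f ->
  (@lebesgue_measure R).-integrable `[a, b] (EFin \o f).
Proof.
by move=> [cf]; apply: continuous_compact_integrable => //; exact: segment_compact.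
Qed.

Lemma eq_INT a b f g : (forall x, a <= x <= b -> f x = g x) ->
  INT a b f = INT a b g.
Proof.
by move=> fg; apply: eq_Rintegral => x; rewrite inE/= in_itv/=; exact: fg.
Qed.

Lemma INTD a b f g : cont_on a b f -> cont_on a b g ->
  INT a b (fun x => f x + g x) = INT a b f + INT a b g.
Proof. by move=> cf cg; apply: RintegralD => //; exact: cont_on_integrable. Qed.

Lemma INTB a b f g : cont_on a b f -> cont_on a b g ->
  INT a b (fun x => f x - g x) = INT a b f - INT a b g.
Proof. by move=> cf cg; apply: RintegralB => //; exact: cont_on_integrable. Qed.

Lemma INTZ a b f c : cont_on a b f ->
  INT a b (fun x => c * f x) = c * INT a b f.
Proof. by move=> cf; apply: RintegralZl => //; exact: cont_on_integrable. Qed.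

Lemma INTZr a b f c : cont_on a b f ->
  INT a b (fun x => f x * c) = INT a b f * c.
Proof. by move=> cf; apply: RintegralZr => //; exact: cont_on_integrable. Qed.

Lemma INT_cst a b c : a <= b -> INT a b (fun=> c) = c * (b - a).
Proof.
move=> ab; rewrite /INT Rintegral_cst//; congr (_ * _).
transitivity (fine (lebesgue_measure `[a, b])); first by [].
by rewrite lebesgue_measure_itv/= lte_fin; case: ltgtP ab => // ->; rewrite subrr.
Qed.

Lemma INT0 a b : INT a b (fun=> 0) = 0.
Proof. by rewrite /INT Rintegral_cst// mul0r. Qed.

Lemma INTN a b f : cont_on a b f -> INT a b (fun x => - f x) = - INT a b f.
Proof.
move=> cf; rewrite -mulN1r -INTZ//; apply: eq_INT => x _; by rewrite mulN1r.
Qed.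

Lemma INT_sum a b (I : Type) (s : seq I) (P : pred I) (F : I -> R -> R) :
  (forall i, P i -> cont_on a b (F i)) ->
  INT a b (fun x => \sum_(i <- s | P i) F i x) =
  \sum_(i <- s | P i) INT a b (F i).
Proof.
move=> cF; elim: s => [|i s ih].
  by rewrite big_nil -[RHS](INT0 a b); apply: eq_INT => x _; rewrite big_nil.
rewrite big_cons; case: ifPn => [Pi|Pi]; rewrite -ih.
  rewrite -INTD; [|exact: cF|exact: cont_on_sum].
  by apply: eq_INT => x _; rewrite big_cons Pi.
by apply: eq_INT => x _; rewrite big_cons (negbTE Pi).
Qed.

Lemma le_INT a b f g : cont_on a b f -> cont_on a b g ->
  (forall x, a <= x <= b -> f x <= g x) -> INT a b f <= INT a b g.
Proof.
by move=> cf cg fg; apply: le_Rintegral => //; exact: cont_on_integrable.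
Qed.

Lemma INT_ge0 a b f : (forall x, a <= x <= b -> 0 <= f x) -> 0 <= INT a b f.
Proof. by move=> f0; apply: Rintegral_ge0 => x /=; rewrite in_itv/=; exact: f0. Qed.

Lemma ler_abs_INT a b f M : a <= b -> cont_on a b f ->
  (forall x, a <= x <= b -> `|f x| <= M) -> `|INT a b f| <= M * (b - a).
Proof.
move=> ab cf fM; rewrite (le_trans (le_normr_Rintegral _ (cont_on_integrable cf)))//.
by rewrite -INT_cst//; apply: le_INT => //; [exact: cont_on_abs|exact: cont_on_cst].
Qed.

Lemma segment_MVT a b u v x y : a <= x -> x < y -> y <= b -> cont_on a b u ->
  ider a b u v -> exists2 c, x < c < y & u y - u x = v c * (y - x).
Proof.
move=> ax xy yb cu du; have [c|c cxy e] := @MVT R u v x y xy _ (cont_on_within (cont_on_sub ax yb cu)).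
  by rewrite in_itv/= => /andP[xc cy]; apply: du; rewrite (le_lt_trans ax)// (lt_le_trans cy).
by exists c.
Qed.

Lemma ider_LR a b u v : a < b -> cont_on a b u -> ider a b u v ->
  derivable_oo_LRcontinuous u a b /\ {in `]a, b[, u^`()%classic =1 v}.
Proof.
move=> ab cu du; have [c1 c2 c3] := (continuous_within_itvP _ ab).1 (cont_on_within cu).
split; first split=> //.
  by move=> x; rewrite in_itv/= => axb; have := du _ axb; case.
by move=> x; rewrite in_itv/= => axb; rewrite derive1E; have := du _ axb => ?; rewrite derive_val.
Qed.

Lemma INT_FTC2 a b u v : a <= b -> cont_on a b u -> cont_on a b v ->
  ider a b u v -> INT a b v = u b - u a.
Proof.
rewrite le_eqVlt => /predU1P[<- _ _ _|ab cu cv du].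
  by rewrite subrr /INT set_itv1 Rintegral_set1.
have [du1 du2] := ider_LR ab cu du.
by rewrite /INT /Rintegral (continuous_FTC2 ab (cont_on_within cv) du1 du2).
Qed.

Lemma INT_by_parts a b u u' v v' : a <= b ->
  cont_on a b u -> cont_on a b u' -> ider a b u u' ->
  cont_on a b v -> cont_on a b v' -> ider a b v v' ->
  INT a b (fun x => u x * v' x) =
  u b * v b - u a * v a - INT a b (fun x => u' x * v x).
Proof.
move=> ab cu cu' du cv cv' dv.
rewrite -(@INT_FTC2 a b (fun x => u x * v x) (fun x => u x * v' x + u' x * v x))//.
- by rewrite INTD ?addrK//; exact: cont_onM.
- exact: cont_onM.
- by apply: cont_onD; exact: cont_onM.
- move=> x axb; have := du _ axb; have := dv _ axb => d1 d2.
  apply: is_derive_eq; rewrite /GRing.scale/= mulrC [X in _ + X = _]mulrC.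
  by rewrite mulrC [in LHS]addrC addrC mulrC; congr (_ + _); exact: mulrC.
Qed.

End Segment.

(** * Functions carried together with their derivatives *)

Section Chain.
Variable R : realType.
Implicit Types (a b x y c : R) (f g : R -> R) (u v : nat -> R -> R).

Lemma eq_ider a b f g f' g' : ider a b f f' ->
  (forall x, a < x < b -> f x = g x) -> (forall x, a < x < b -> f' x = g' x) ->
  ider a b g g'.
Proof.
move=> df fg fg' x axb; have := df x axb; rewrite fg'//.
apply: near_eq_is_derive.
have xab : x \in `]a, b[ by rewrite in_itv.
near=> y; apply: fg.
suff : y \in `]a, b[ by rewrite in_itv.
by near: y; exact: near_in_itvoo.
Unshelve. all: by end_near. Qed.

Lemma iderD a b f g f' g' : ider a b f f' -> ider a b g g' ->
  ider a b (fun x => f x + g x) (fun x => f' x + g' x).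
Proof. by move=> df dg x axb; apply: is_deriveD; [exact: df|exact: dg]. Qed.

Lemma iderZ a b f f' c : ider a b f f' ->
  ider a b (fun x => c * f x) (fun x => c * f' x).
Proof. by move=> df x axb; apply: is_deriveZ; exact: df. Qed.

Lemma iderM a b f g f' g' : ider a b f f' -> ider a b g g' ->
  ider a b (fun x => f x * g x) (fun x => f' x * g x + f x * g' x).
Proof.
move=> df dg x axb; have d1 := df x axb; have d2 := dg x axb.
by apply: is_derive_eq; rewrite /GRing.scale/= addrC mulrC.
Qed.

Lemma ider_cst a b c : ider a b (fun=> c) (fun=> 0).
Proof. by move=> x axb; apply: is_derive_cst. Qed.

Lemma ider_sum a b (I : Type) (s : seq I) (P : pred I) (F F' : I -> R -> R) :
  (forall i, P i -> ider a b (F i) (F' i)) ->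
  ider a b (fun x => \sum_(i <- s | P i) F i x)
           (fun x => \sum_(i <- s | P i) F' i x).
Proof.
move=> dF; elim: s => [|i s ih].
  by apply: (eq_ider (@ider_cst a b 0)) => x _; rewrite big_nil.
have [Pi|Pi] := boolP (P i); last first.
  by apply: (eq_ider ih) => x _; rewrite big_cons (negbTE Pi).
by apply: (eq_ider (iderD (dF i Pi) ih)) => x _; rewrite big_cons Pi.
Qed.

Lemma ider_sub a b c d f f' : a <= c -> d <= b -> ider a b f f' ->
  ider c d f f'.
Proof.
move=> ac db df x /andP[cx xd]; apply: df.
by rewrite (le_lt_trans ac)// (lt_le_trans xd).
Qed.

Lemma ider_shift a b c f f' : ider a b f f' ->
  ider (a - c) (b - c) (fun x => f (c + x)) (fun x => f' (c + x)).
Proof.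
move=> df x axb; have d1 : is_derive (c + x) 1 f (f' (c + x)) by apply: df; lra.
have d2 : is_derive x 1 (fun x => c + x) (0 + 1) by apply: is_deriveD.
have := is_derive1_comp d1 d2.
by rewrite add0r /GRing.scale/= mulr1.
Qed.

Lemma cont_on_shift a b c f : cont_on a b f ->
  cont_on (a - c) (b - c) (fun x => f (c + x)).
Proof.
move=> /cont_onP cf; apply/cont_onP => x axb.
have := cf (c + x) ltac:(lra) => cfx.
apply/cvgrPdist_le => e e0; move/cvgrPdist_le : cfx => /(_ e e0).
rewrite !near_withinE => -[d /= d0 H]; exists d => //= y xy yab.
apply: (H (c + y)) => /=; last by move: yab; rewrite !in_itv/=; lra.
by rewrite opprD addrACA subrr add0r.
Qed.

Lemma INT_primitive a b f : a <= b -> cont_on a b f ->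
  cont_on a b (fun x => INT a x f) /\ ider a b (fun x => INT a x f) f.
Proof.
move=> ab cf; split.
  by split; apply: parameterized_integral_continuous => //; exact: cont_on_integrable.
move=> x axb; have [ax xb] := andP axb.
have [d1 d2] := @continuous_FTC1_closed R f a x b xb (cont_on_integrable cf) ax
  (cont_on_at cf axb).
by rewrite /INT -d2 derive1E; exact: derivableP.
Qed.

Lemma INT_set1 a f : INT a a f = 0.
Proof. by rewrite /INT set_itv1 Rintegral_set1. Qed.

Lemma INT_shift a b c f : a <= b -> cont_on a b f ->
  INT (a - c) (b - c) (fun x => f (c + x)) = INT a b f.
Proof.
move=> ab cf; have [cF dF] := INT_primitive ab cf.
rewrite (INT_FTC2 _ (cont_on_shift c cF) (cont_on_shift c cf) (@ider_shift a b c _ _ dF)).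
  by rewrite !(addrC c) !subrK INT_set1 subr0.
by rewrite lerD2r.
Qed.

(** The primitive from a is squeezed between 0 and the total integral 0, so its derivative f
    vanishes inside; the end points follow by continuity. *)
Lemma INT_eq0 a b f : a < b -> cont_on a b f ->
  (forall x, a <= x <= b -> 0 <= f x) -> INT a b f = 0 ->
  forall x, a <= x <= b -> f x = 0.
Proof.
move=> ab cf f0 If.
have [cF dF] := INT_primitive (ltW ab) cf.
have F0 x : a <= x <= b -> INT a x f = 0.
  move=> /andP[ax xb]; apply/eqP; rewrite eq_le; apply/andP; split; last first.
    by apply: INT_ge0 => y /andP[ay yx]; rewrite f0// ay (le_trans yx).
  rewrite -If; case: (ltgtP x b) xb => // [xb _|-> _]; last exact: lexx.
  have [c xcb e] := segment_MVT ax xb (lexx _) cF dF.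
  rewrite -subr_ge0 e mulr_ge0//; last by rewrite subr_ge0 ltW.
  by apply: f0; rewrite (le_trans ax) ?ltW//; case/andP: xcb => // _ ->.
have fo x : a < x < b -> f x = 0.
  move=> axb; have d1 := dF x axb.
  have d2 : is_derive x 1 (fun x : R => INT a x f) 0.
    apply: (eq_ider (@ider_cst a b 0) _ _ axb) => // y /andP[ay yb].
    by rewrite F0// !ltW.
  by rewrite -(@derive_val _ _ _ _ _ _ _ d1) (@derive_val _ _ _ _ _ _ _ d2).
have [c1 c2 c3] := (continuous_within_itvP _ ab).1 (cont_on_within cf).
move=> x /andP[]; rewrite le_eqVlt => /predU1P[<- _|ax].
  apply/esym/(cvg_unique _ _ c2) => //.
  apply: (@cvg_trans _ (0 @[_ --> a^'+])); last exact: cvg_cst.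
  apply: near_eq_cvg; near=> y; apply/esym/fo.
  by apply/andP; split; near: y; [exact: nbhs_right_gt|exact: nbhs_right_lt].
rewrite le_eqVlt => /predU1P[->|xb]; last by rewrite fo// ax.
apply/esym/(cvg_unique _ _ c3) => //.
apply: (@cvg_trans _ (0 @[_ --> b^'-])); last exact: cvg_cst.
apply: near_eq_cvg; near=> y; apply/esym/fo.
by apply/andP; split; near: y; [exact: nbhs_left_gt|exact: nbhs_left_lt].
Unshelve. all: by end_near. Qed.

(** A C^n function on the closed segment given as the list of its derivatives. Differentiability is
    asked inside only, while continuity of every entry reaches the end points, so that no one-sided
    derivative has to be handled. *)
Definition chain a b n u :=
  (forall j, (j <= n)%N -> cont_on a b (u j)) /\
  (forall j, (j < n)%N -> ider a b (u j) (u j.+1)).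

Lemma chainW a b n m u : (m <= n)%N -> chain a b n u -> chain a b m u.
Proof.
move=> mn [cu du]; split=> j jm; first by apply: cu; exact: leq_trans mn.
by apply: du; exact: leq_trans mn.
Qed.

Lemma chain_sub a b c d n u : a <= c -> d <= b -> chain a b n u -> chain c d n u.
Proof.
move=> ac db [cu du]; split=> j jn; first exact/(cont_on_sub ac db)/cu.
exact/(ider_sub ac db)/du.
Qed.

Lemma chain_drop a b n k u : chain a b (k + n) u ->
  chain a b n (fun j => u (k + j)%N).
Proof.
move=> [cu du]; split=> j jn; first by apply: cu; rewrite leq_add2l.
by rewrite addnS; apply: du; rewrite ltn_add2l.
Qed.

Lemma eq_chain a b n u v : chain a b n u ->
  (forall j x, (j <= n)%N -> a <= x <= b -> u j x = v j x) -> chain a b n v.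
Proof.
move=> [cu du] uv; split=> j jn.
  by apply: (eq_cont_on (cu j jn)) => x; exact: uv.
by apply: (eq_ider (du j jn)) => x /andP[ax xb]; apply: uv; rewrite ?(ltnW jn) ?(ltW ax) ?(ltW xb).
Qed.

Lemma chainD a b n u v : chain a b n u -> chain a b n v ->
  chain a b n (fun j x => u j x + v j x).
Proof.
move=> [cu du] [cv dv]; split=> j jn.
  by apply: cont_onD; [exact: cu|exact: cv].
by apply: iderD; [exact: du|exact: dv].
Qed.

Lemma chainZ a b n u c : chain a b n u -> chain a b n (fun j x => c * u j x).
Proof.
move=> [cu du]; split=> j jn; first by apply: cont_onZ; exact: cu.
by apply: iderZ; exact: du.
Qed.

Lemma chain_sum a b n (I : Type) (s : seq I) (P : pred I) (F : I -> nat -> R -> R) :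
  (forall i, P i -> chain a b n (F i)) ->
  chain a b n (fun j x => \sum_(i <- s | P i) F i j x).
Proof.
move=> cF; split=> j jn; first by apply: cont_on_sum => i /cF[+ _]; exact.
by apply: ider_sum => i /cF[_]; exact.
Qed.

Lemma is_derive_horner (p : {poly R}) x : is_derive x 1 (horner p) p^`().[x].
Proof.
elim/poly_ind: p => [|p c ih].
  rewrite deriv0 horner0 (_ : horner 0 = fun=> 0) ?funeqE; last by move=> y; rewrite horner0.
  exact: is_derive_cst.
rewrite derivD derivM derivX derivC addr0 mulr1 hornerD hornerM hornerX.
rewrite (_ : horner _ = fun y => p.[y] * y + c); last first.
  by apply/funext => y; rewrite hornerD hornerM hornerX hornerC.
by apply: is_derive_eq; rewrite /GRing.scale/= addr0 mulr1 addrC mulrC.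
Qed.

Lemma chain_poly a b n (p : {poly R}) : chain a b n (fun j x => p^`(j).[x]).
Proof.
have dp j x : is_derive x 1 (horner p^`(j)) p^`(j.+1).[x].
  by rewrite derivnS; exact: is_derive_horner.
split=> j jn; last by move=> x _; exact: dp.
apply: cont_on_continuous => x.
by apply: differentiable_continuous; apply/derivable1_diffP; case: (dp j x).
Qed.

(** The j-th derivative of the product of two chains, by recursion instead of a binomial sum:
    regularity, order of vanishing and bounds then all follow by induction on j. *)
Fixpoint leibniz j u v x : R :=
  if j is j'.+1 then
    leibniz j' (fun i => u i.+1) v x + leibniz j' u (fun i => v i.+1) x
  else u 0%N x * v 0%N x.

Lemma chainM a b n u v : chain a b n u -> chain a b n v ->
  chain a b n (fun j => leibniz j u v).
Proof.
move=> [cu du] [cv dv]; split.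
- move=> j; elim: j n u v cu du cv dv => [|j ih] [|n]//= u v cu du cv dv jn.
  + by apply: cont_onM; [exact: cu|exact: cv].
  + by apply: cont_onM; [exact: cu|exact: cv].
  + apply: cont_onD.
      apply: (ih n) => // i ni; first exact: cu.
      * exact: du.
      * by apply: cv; exact: leqW.
      * by apply: dv; exact: leqW.
    apply: (ih n) => // i ni; first by apply: cu; exact: leqW.
    * by apply: du; exact: leqW.
    * exact: cv.
    * exact: dv.
- move=> j; elim: j n u v cu du cv dv => [|j ih] [|n]//= u v cu du cv dv jn.
  + by apply: iderM; [exact: du|exact: dv].
  + apply: iderD.
      apply: (ih n) => // i ni; first exact: cu.
      * exact: du.
      * by apply: cv; exact: leqW.
      * by apply: dv; exact: leqW.
    apply: (ih n) => // i ni; first by apply: cu; exact: leqW.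
    * by apply: du; exact: leqW.
    * exact: cv.
    * exact: dv.
Qed.

Lemma leibniz_eq0 j u v x r s :
  (forall i, (i < r)%N -> u i x = 0) -> (forall i, (i < s)%N -> v i x = 0) ->
  (j < r + s)%N -> leibniz j u v x = 0.
Proof.
elim: j u v r s => [|j ih] u v r s u0 v0 jrs /=.
  case: r u0 jrs => [|r] u0 jrs; last by rewrite u0// mul0r.
  by rewrite v0 ?mulr0.
rewrite (ih _ _ r.-1 s)//.
- rewrite (ih _ _ r s.-1)// ?addr0//; first by move=> i si; rewrite v0//; lia.
  by lia.
- by move=> i ri; rewrite u0//; lia.
- by lia.
Qed.

Lemma leibniz_le j u v x A B : 0 <= A -> 0 <= B ->
  (forall i, (i <= j)%N -> `|u i x| <= A) ->
  (forall i, (i <= j)%N -> `|v i x| <= B) -> `|leibniz j u v x| <= 2 ^+ j * (A * B).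
Proof.
move=> A0 B0; elim: j u v => [|j ih] u v uA vB /=.
  by rewrite mul1r normrM ler_pM// ?uA ?vB.
rewrite (le_trans (ler_normD _ _))// exprS -mulrA mulr_natl mulr2n lerD//.
  by apply: ih => i ij; [exact: uA|apply: vB; exact: leqW].
by apply: ih => i ij; [apply: uA; exact: leqW|exact: vB].
Qed.

(** Each derivative of order below n has a zero, so the mean value theorem bounds it by the next one
    times [b - a]. *)
Lemma chain_le a b n u M : a <= b -> 0 <= M -> chain a b n u ->
  (forall j, (j < n)%N -> exists2 z, a <= z <= b & u j z = 0) ->
  (forall x, a <= x <= b -> `|u n x| <= M) ->
  forall x, a <= x <= b -> `|u 0%N x| <= M * (b - a) ^+ n.
Proof.
move=> ab M0; elim: n u => [|n ih] u cu zu uM x axb.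
  by rewrite mulr1; exact: uM.
have u1M : forall y, a <= y <= b -> `|u 1%N y| <= M * (b - a) ^+ n.
  apply: (ih (fun j => u (1 + j)%N)) => //.
    exact: (@chain_drop a b n 1 u).
  by move=> j jn; apply: zu.
have [z azb uz] := zu 0%N isT.
have [cu1 du1] := cu; have cu0 := cu1 0%N isT; have du0 := du1 0%N isT.
have K0 : 0 <= M * (b - a) ^+ n by rewrite mulr_ge0// exprn_ge0// subr_ge0.
have H s t : a <= s -> s < t -> t <= b -> `|u 0%N t - u 0%N s| <= M * (b - a) ^+ n.+1.
  move=> as_ st tb; have [c cst ->] := segment_MVT as_ st tb cu0 du0.
  rewrite exprSr mulrA normrM ler_pM//; first by apply: u1M; apply/andP; split; lra.
  by rewrite gtr0_norm; lra.
case: (ltgtP x z) => [xz|zx|->].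
- by rewrite -normrN -sub0r -uz H//; lra.
- by rewrite -[u _ _]subr0 -uz H//; lra.
- by rewrite uz normr0 exprS !mulr_ge0// ?exprn_ge0// subr_ge0.
Qed.

Lemma chain_by_parts a b n u v : a <= b -> chain a b n u -> chain a b n v ->
  (forall j, (j < n)%N -> v j a = 0 /\ v j b = 0) ->
  INT a b (fun x => u 0%N x * v n x) = (-1) ^+ n * INT a b (fun x => u n x * v 0%N x).
Proof.
move=> ab; elim: n u => [|n ih] u cu cv v0.
  by rewrite mul1r.
have [cu1 du1] := cu; have [cv1 dv1] := cv.
rewrite (@INT_by_parts R a b (u 0%N) (u 1%N) (v n) (v n.+1))//; last 6 first.
- exact: cu1.
- exact: cu1.
- exact: du1.
- exact: cv1.
- exact: cv1.
- exact: dv1.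
have [-> ->] := v0 n (ltnSn _).
rewrite !mulr0 subrr sub0r (ih (fun j => u (1 + j)%N)).
- by rewrite add1n exprS mulN1r mulNr.
- exact: (@chain_drop a b n 1 u).
- exact: chainW cv.
- by move=> j jn; apply: v0; exact: leqW.
Qed.

End Chain.

(** * The derivative on the closed interval, computed along chains *)

Section DeriveItv.
Variable R : realType.
Implicit Types (a b x y c : R) (f g : R -> R) (u v : nat -> R -> R).

Lemma within_dnbhs_proper a b x : a < b -> a <= x <= b ->
  ProperFilter (within `[a, b] x^').
Proof.
move=> ab axb; apply: Build_ProperFilter_ex => [P].
rewrite /within /dnbhs /= => -[d /= d0 H].
pose e := Num.min (d / 2) ((b - a) / 2).
have e0 : 0 < e by rewrite lt_min; apply/andP; split; lra.
have ed : e < d by rewrite gt_min; apply/orP; left; lra.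
have eb : e <= (b - a) / 2 by rewrite ge_min lexx orbT.
have [xm|xm] := leP x ((a + b) / 2).
  exists (x + e); apply: H => /=.
  - by rewrite opprD addrA subrr sub0r normrN gtr0_norm.
  - by rewrite gt_eqF// ltrDl.
  - by rewrite in_itv/=; lra.
exists (x - e); apply: H => /=.
- by rewrite opprB addrC subrK gtr0_norm.
- by rewrite lt_eqF// ltrBlDr ltrDl.
- by rewrite in_itv/=; lra.
Qed.

(** The difference quotient is a value of [f'] at an intermediate point, and [f'] is continuous up
    to the ends. *)
Lemma derive_itv_ider a b f f' x : a < b -> cont_on a b f -> cont_on a b f' ->
  ider a b f f' -> a <= x <= b -> derive_itv a b f x = f' x.
Proof.
move=> ab cf cf' df axb; rewrite /derive_itv.
have pf := within_dnbhs_proper ab axb.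
apply/cvg_lim; first exact: Rhausdorff.
apply/cvgrPdist_le => e e0.
have /cont_onP/(_ x axb)/cvgrPdist_le/(_ e e0) := cf'.
rewrite !near_withinE /dnbhs => -[d /= d0 H].
exists d => //= y xyd yx; rewrite in_itv/= => ayb.
case: (ltgtP y x) yx => // [yx|xy] _.
  have [c cyx e1] : exists2 c, y < c < x & f x - f y = f' c * (x - y).
    by apply: segment_MVT df => //; lra.
  rewrite -(opprB (f x)) e1 -(opprB x y) invrN mulrNN mulfK; last by rewrite subr_eq0; apply/eqP; lra.
  apply: H => /=; last by rewrite in_itv/=; lra.
  by move: xyd; rewrite /= !gtr0_norm ?subr_gt0//; lra.
have [c cyx e1] : exists2 c, x < c < y & f y - f x = f' c * (y - x).
  by apply: segment_MVT df => //; lra.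
rewrite e1 mulfK; last by rewrite subr_eq0; apply/eqP; lra.
apply: H => /=; last by rewrite in_itv/=; lra.
by move: xyd; rewrite /= !ltr0_norm ?subr_lt0//; lra.
Qed.

Lemma eq_derive_itv a b f g x : a <= x <= b ->
  (forall x, a <= x <= b -> f x = g x) -> derive_itv a b f x = derive_itv a b g x.
Proof.
move=> axb fg; rewrite /derive_itv.
congr lim; apply/funext => P; apply/propeqP; split; rewrite /nbhs/= /fmap/= /within/= /dnbhs /within/=.
  apply: (@filterS _ (nbhs x)) => y /= H yx ayb; move: (H yx ayb); rewrite ?fg//.
apply: (@filterS _ (nbhs x)) => y /= H yx ayb; move: (H yx ayb); rewrite ?fg//.
Qed.

Lemma derive_itvn_chain a b n u f : a < b -> chain a b n u ->
  (forall x, a <= x <= b -> f x = u 0%N x) ->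
  forall j, (j <= n)%N -> forall x, a <= x <= b -> derive_itvn a b j f x = u j x.
Proof.
move=> ab [cu du] fu; elim=> [|j ih] jn x axb; first exact: fu.
rewrite /derive_itvn iterS -/(derive_itvn a b j f).
rewrite (@eq_derive_itv a b _ (u j))//; last by apply: ih; exact: ltnW.
by apply: derive_itv_ider => //; [apply: cu; exact: ltnW|exact: cu|exact: du].
Qed.

End DeriveItv.

(** * Smooth functions, bumps and steps *)

Section Smooth.
Variable R : realType.
Implicit Types (a b x y c d : R) (f g : R -> R) (p q : {poly R}).

Variant smooth f : Prop := Smooth of forall k x, derivable (derive1n k f) x 1.

Lemma smooth_derivable f k x : smooth f -> derivable (derive1n k f) x 1.
Proof. by case. Qed.

(** Coinduction principle for smoothness, applied to parametrised families closed under
    differentiation such as the functions [flat p]. *)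
Lemma smooth_family (S : set (R -> R)) :
  (forall f, S f -> (forall x, derivable f x 1) /\ S (f^`()%classic)) ->
  forall f, S f -> smooth f.
Proof.
move=> HS f Sf; split=> k; suff : S (derive1n k f) by move/HS => -[].
by elim: k => [//|k ih]; rewrite derive1nS; case: (HS _ ih).
Qed.

Lemma smooth_derive f : smooth f -> smooth (f^`()%classic).
Proof. by move=> [sf]; split=> k x; rewrite -derive1Sn; exact: sf. Qed.

Lemma smooth_is_derive f x : smooth f -> is_derive x 1 f (f^`()%classic x).
Proof. by move=> sf; rewrite derive1E; apply: derivableP; exact: (@smooth_derivable f 0 x sf). Qed.

Lemma derivable1_continuous f : (forall x, derivable f x 1) -> continuous f.
Proof. by move=> df x; apply: differentiable_continuous; apply/derivable1_diffP. Qed.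

Lemma smooth_continuous f k : smooth f -> continuous (derive1n k f).
Proof. by move=> sf; apply: derivable1_continuous => x; exact: smooth_derivable. Qed.

Lemma smooth_chain a b n f : smooth f -> chain a b n (fun j => derive1n j f).
Proof.
move=> sf; split=> j jn; first exact/cont_on_continuous/smooth_continuous.
by move=> x _; rewrite derive1nS derive1E; apply: derivableP; exact: smooth_derivable.
Qed.

Lemma smooth_antiderivative f g : (forall x, is_derive x 1 f (g x)) -> smooth g ->
  smooth f.
Proof.
move=> df sg; split=> -[|k] x; first by case: (df x).
have -> : derive1n k.+1 f = derive1n k g; last exact: smooth_derivable.
rewrite derive1Sn (_ : f^`()%classic = g)//; apply/funext => y; rewrite derive1E.
by have := df y => ?; rewrite derive_val.
Qed.

(* [n] derivatives of a product involve only [n] derivatives of the factors, so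
   this finite-order version is what an induction can prove. *)
Fixpoint ndiff n f : Prop :=
  if n is n'.+1 then (forall x, derivable f x 1) /\ ndiff n' (f^`()%classic)
  else True.

Lemma smoothP f : smooth f <-> (forall n, ndiff n f).
Proof.
split=> [sf n|nf].
  elim: n f sf => [//|n ih] f sf; split; first by case: sf => /(_ 0%N).
  exact/ih/smooth_derive.
split=> k; move: (nf k.+1); elim: k f {nf} => [|k ih] f [df nf]; first exact: df.
by rewrite derive1Sn; exact: ih.
Qed.

Lemma ndiffS n f : ndiff n.+1 f -> ndiff n f.
Proof. by elim: n f => [//|n ih] f [df nf]; split=> //; exact: ih. Qed.

Lemma derive1D f g : (forall x, derivable f x 1) -> (forall x, derivable g x 1) ->
  (fun x => f x + g x)^`()%classic = (fun x => f^`()%classic x + g^`()%classic x).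
Proof. by move=> df dg; apply/funext => x; rewrite !derive1E deriveD. Qed.

Lemma ndiffD n f g : ndiff n f -> ndiff n g -> ndiff n (fun x => f x + g x).
Proof.
elim: n f g => [//|n ih] f g [df nf] [dg ng]; split.
  by move=> x; exact: derivableD.
by rewrite derive1D//; exact: ih.
Qed.

Lemma ndiffM n f g : ndiff n f -> ndiff n g -> ndiff n (fun x => f x * g x).
Proof.
elim: n f g => [//|n ih] f g nf ng; have [df nf'] := nf; have [dg ng'] := ng; split.
  by move=> x; exact: derivableM.
have -> : (fun x => f x * g x)^`()%classic =
    (fun x => f x * g^`()%classic x + g x * f^`()%classic x).
  by apply/funext => x; rewrite !derive1E deriveM.
by apply: ndiffD; apply: ih => //; exact: ndiffS.
Qed.

Lemma smoothD f g : smooth f -> smooth g -> smooth (fun x => f x + g x).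
Proof.
by move=> /smoothP sf /smoothP sg; apply/smoothP => n; apply: ndiffD.
Qed.

Lemma smoothM f g : smooth f -> smooth g -> smooth (fun x => f x * g x).
Proof.
by move=> /smoothP sf /smoothP sg; apply/smoothP => n; apply: ndiffM.
Qed.

Lemma smooth_cst c : smooth (fun=> c).
Proof.
apply: (@smooth_family [set f | exists c, f = fun=> c]); last by exists c.
move=> _ [e ->]; split; first by move=> x; exact: derivable_cst.
by exists 0; apply/funext => x; rewrite derive1_cst.
Qed.

Lemma smoothZ f c : smooth f -> smooth (fun x => c * f x).
Proof. by move=> sf; apply: smoothM => //; exact: smooth_cst. Qed.

Lemma is_derive_affine f c d x (f' : R) : is_derive (c * x + d) 1 f f' ->
  is_derive x 1 (fun x => f (c * x + d)) (c * f').
Proof.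
move=> df; have d2 : is_derive x 1 (fun x => c * x + d) (c * 1 + 0).
  by apply: is_deriveD; apply: is_deriveZ.
by have := @is_derive1_comp R f (fun x => c * x + d) x _ _ df d2; rewrite addr0 mulr1 mulrC.
Qed.

Lemma smooth_affine f c d : smooth f -> smooth (fun x => f (c * x + d)).
Proof.
move=> sf.
apply: (@smooth_family [set f | exists e g,
    smooth g /\ f = fun x => e * g (c * x + d)]); last first.
  by exists 1, f; split=> //; apply/funext => x; rewrite mul1r.
move=> _ [e [g [sg ->]]].
have dg x : is_derive x 1 (fun x => e * g (c * x + d))
    (e * (c * g^`()%classic (c * x + d))).
  by apply: is_deriveZ; apply: is_derive_affine; exact: smooth_is_derive.
split; first by move=> x; case: (dg x).
exists (e * c), g^`()%classic; split; first exact: smooth_derive.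
apply/funext => x; rewrite derive1E; have := dg x => ?; rewrite derive_val.
by rewrite mulrA.
Qed.

(** Serves at points where a function is glued from two formulas: the origin for [flat] and for
    truncated powers. *)
Lemma is_derive_quad f x C :
  (forall y, `|y - x| <= 1 -> `|f y - f x| <= C * (y - x) ^+ 2) ->
  is_derive x 1 f 0.
Proof.
move=> fC.
have cv : h^-1 *: ((f \o shift x) (h *: 1) - f x) @[h --> 0^'] --> (0 : R).
  apply/cvgrPdist_le => e e0.
  have C1 : 0 < `|C| + 1 by rewrite ltr_wpDl.
  near=> h.
  have h0 : h != 0 by near: h; exact: nbhs_dnbhs_neq.
  rewrite sub0r normrN normrM normfV.
  rewrite ler_pdivrMl ?normr_gt0//.
  apply: (le_trans (fC _ _)); rewrite /= /GRing.scale/= mulr1.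
    by rewrite addrK; near: h; exact: dnbhs0_le.
  rewrite addrK -[h ^+ 2]ger0_norm ?sqr_ge0// normrX.
  rewrite (@le_trans _ _ ((`|C| + 1) * `|h| ^+ 2))//.
    by rewrite ler_wpM2r ?exprn_ge0// (le_trans (ler_norm _))// lerDl.
  rewrite expr2 mulrCA ler_wpM2l// mulrC -ler_pdivlMr//.
  near: h; apply: dnbhs0_le; by rewrite divr_gt0.
split; first by apply/cvg_ex; exists 0.
by rewrite /derive; apply/cvg_lim => //; exact: Rhausdorff.
Unshelve. all: by end_near. Qed.

Definition flat p x : R := if 0 < x then p.[x^-1] * expR (- x^-1) else 0.

Lemma horner_expRN_bounded p :
  exists2 C : R, 0 <= C & forall s : R, 0 <= s -> `|p.[s] * expR (- s)| <= C.
Proof.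
elim/poly_ind: p => [|p c _].
  by exists 0 => // s _; rewrite horner0 mul0r normr0.
have X n s : 0 <= s -> s ^+ n * expR (- s) <= n`!%:R.
  move=> s0; rewrite expRN ler_pdivrMr ?expR_gt0//.
  case: n => [|n]; first by rewrite fact0 expr0 mul1r -[leLHS]expR0 ler_expR.
  rewrite mulrC -ler_pdivrMr ?ltr0n ?fact_gt0//.
  by rewrite (le_trans _ (expR_ge1Dxn n s0))// lerDr.
set q := _ + _; exists (\sum_(i < size q) `|q`_i| * i`!%:R).
  by apply: sumr_ge0 => i _; rewrite mulr_ge0.
move=> s s0; rewrite horner_coef mulr_suml (le_trans (ler_norm_sum _ _ _))//.
apply: ler_sum => i _; rewrite -mulrA normrM ler_wpM2l//.
by rewrite ger0_norm ?X// mulr_ge0 ?expR_ge0// exprn_ge0.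
Qed.

Lemma is_derive_flat p x : is_derive x 1 (flat p) (flat ('X^2 * (p - p^`())) x).
Proof.
have [x0|x0|<-] := ltgtP 0 x.
- rewrite /flat x0.
  have xn0 : x != 0 by rewrite gt_eqF.
  have d1 : is_derive x 1 (fun y : R => y^-1) (- x ^- 2 * 1).
    exact: (@is_deriveV R id x 1 1 xn0).
  have d2 : is_derive x 1 (fun y => p.[y^-1]) (p^`().[x^-1] * (- x ^- 2 * 1)).
    by apply: (is_derive1_comp _ d1); exact: is_derive_horner.
  have d3 : is_derive x 1 (fun y => expR (- y^-1)) (expR (- x^-1) * (- (- x ^- 2 * 1))).
    apply: (@is_derive1_comp R expR (fun y => - y^-1)); exact: is_deriveN.
  apply: (@near_eq_is_derive _ _ _ (fun y => p.[y^-1] * expR (- y^-1))).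
    by near=> y; rewrite ifT//; near: y; exact: lt_nbhsr.
  apply: is_derive_eq; rewrite /GRing.scale/= hornerM hornerXn hornerD hornerN.
  by rewrite exprVn; ring.
- rewrite {2}/flat ltNge (ltW x0)/=.
  apply: (@near_eq_is_derive _ _ _ (fun=> 0)).
  by near=> y; rewrite /flat ltNge (_ : y <= 0)//; near: y; exact: lt_le_nbhsl.
- rewrite {2}/flat ltxx.
  have [C C0 HC] := horner_expRN_bounded ('X^2 * p).
  apply: (@is_derive_quad _ _ C) => y _.
  rewrite {2}/flat ltxx !subr0 /flat; case: ifPn => y0; last first.
    by rewrite normr0 mulr_ge0// sqr_ge0.
  have := HC y^-1; rewrite invr_ge0 ltW// => /(_ isT).
  rewrite hornerM hornerXn -mulrA normrM exprVn normfV (ger0_norm (sqr_ge0 y)).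
  by rewrite ler_pdivrMl ?exprn_gt0// (mulrC C).
Unshelve. all: by end_near. Qed.

Lemma smooth_flat p : smooth (flat p).
Proof.
apply: (@smooth_family [set f | exists p, f = flat p]); last by exists p.
move=> _ [q ->]; split; first by move=> x; case: (is_derive_flat q x).
exists ('X^2 * (q - q^`())); apply/funext => x; rewrite derive1E.
by have := is_derive_flat q x => ?; rewrite derive_val.
Qed.

(* positive on ]0, 1[ and zero elsewhere *)
Definition bump x : R := flat 1 x * flat 1 (1 - x).

Lemma smooth_bump : smooth bump.
Proof.
apply: smoothM; first exact: smooth_flat.
have := @smooth_affine (flat 1) (-1) 1 (smooth_flat 1).
by congr smooth; apply/funext => x; rewrite mulN1r addrC.
Qed.

Lemma bump_ge0 x : 0 <= bump x.
Proof.
by rewrite /bump /flat; case: ifP; case: ifP => _ _; rewrite ?mulr0 ?mul0r// !hornerC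
  !mul1r mulr_ge0// expR_ge0.
Qed.

Lemma bump_eq0 x : x <= 0 \/ 1 <= x -> bump x = 0.
Proof.
rewrite /bump /flat => -[x0|x1]; first by rewrite ltNge x0 mul0r.
by rewrite [0 < 1 - x]ltNge subr_le0 x1 mulr0.
Qed.

Lemma INT_bump_gt0 : 0 < INT 0 1 bump.
Proof.
have cb : cont_on 0 1 bump by apply/cont_on_continuous/(@smooth_continuous _ 0%N)/smooth_bump.
rewrite lt_neqAle INT_ge0 ?andbT; last by move=> x _; exact: bump_ge0.
apply/eqP => /esym /(INT_eq0 ltr01 cb (fun x _ => bump_ge0 x)) /(_ 2^-1).
have h1 : 0 < 2^-1 :> R by rewrite invr_gt0.
have h2 : 0 < 1 - 2^-1 :> R by lra.
move=> /(_ ltac:(lra)); rewrite /bump /flat h1 h2 !hornerC !mul1r => /eqP.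
by apply/negP; rewrite mulf_neq0// gt_eqF// expR_gt0.
Qed.

(** Smooth transition from 0 on the left of 0 to 1 on the right of 1. The base point -1 lies
    strictly to the left of the support of [bump], so that the fundamental theorem applies around
    every point where the integrand matters. *)
Definition step x : R := INT (-1) x bump / INT 0 1 bump.

Lemma cont_on_bump a b : cont_on a b bump.
Proof. exact/cont_on_continuous/(@smooth_continuous _ 0%N)/smooth_bump. Qed.

Lemma step_left x : x <= 0 -> step x = 0.
Proof.
move=> x0; rewrite /step (@eq_INT _ _ _ _ (fun=> 0)) ?INT0 ?mul0r// => y /andP[_ yx].
by apply: bump_eq0; left; exact: le_trans x0.
Qed.

Lemma is_derive_step x : is_derive x 1 step (bump x / INT 0 1 bump).
Proof.
have [x0|x0] := ltP (-1) x.
  have [_ d] := INT_primitive (ltac:(lra) : -1 <= x + 1) (cont_on_bump _ _).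
  rewrite mulrC (_ : step = fun x => (INT 0 1 bump)^-1 * INT (-1) x bump); last first.
    by apply/funext => y; rewrite mulrC.
  by apply: is_deriveZ; apply: d; lra.
rewrite bump_eq0 ?mul0r; last by left; lra.
apply: (@near_eq_is_derive _ _ _ (fun=> 0)).
near=> y; rewrite step_left//; near: y; apply: lt_le_nbhsl; lra.
Unshelve. all: by end_near. Qed.

Lemma smooth_step : smooth step.
Proof.
apply: (smooth_antiderivative is_derive_step).
have := smoothZ (INT 0 1 bump)^-1 smooth_bump.
by congr smooth; apply/funext => x; rewrite mulrC.
Qed.

Lemma step_homo x y : x <= y -> step x <= step y.
Proof.
rewrite le_eqVlt => /predU1P[->//|xy].
have cs : cont_on x y step by exact/cont_on_continuous/(@smooth_continuous _ 0%N)/smooth_step.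
have [c _ e] := segment_MVT (lexx _) xy (lexx _) cs (fun z _ => is_derive_step z).
rewrite -subr_ge0 e mulr_ge0//; last by rewrite subr_ge0 ltW.
by rewrite divr_ge0 ?bump_ge0// ltW// INT_bump_gt0.
Qed.

Lemma step1 : step 1 = 1.
Proof.
have cs c d : cont_on c d step.
  exact/cont_on_continuous/(@smooth_continuous _ 0%N)/smooth_step.
have cv : cont_on 0 1 (fun x => bump x / INT 0 1 bump).
  by apply: cont_onM; [exact: cont_on_bump|exact: cont_on_cst].
have := INT_FTC2 ler01 (cs _ _) cv (fun z _ => is_derive_step z).
rewrite (step_left (lexx 0)) subr0 => <-.
by rewrite INTZr ?mulfV ?gt_eqF ?INT_bump_gt0//; exact: cont_on_bump.
Qed.

Lemma step_right x : 1 <= x -> step x = 1.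
Proof.
rewrite le_eqVlt => /predU1P[<-|x1]; first exact: step1.
have cs : cont_on 1 x step by exact/cont_on_continuous/(@smooth_continuous _ 0%N)/smooth_step.
have [c /andP[c1 _] e] := segment_MVT (lexx _) x1 (lexx _) cs (fun z _ => is_derive_step z).
apply/subr0_eq; rewrite -[X in _ - X]step1 e bump_eq0 ?mul0r//.
by right; exact: ltW.
Qed.

Lemma step_bounded x : 0 <= step x <= 1.
Proof.
apply/andP; split.
  have [x0|x0] := leP x 0; first by rewrite step_left.
  by rewrite -(step_left (lexx 0)) step_homo// ltW.
have [x1|x1] := leP x 1; first by rewrite -step1 step_homo.
by rewrite step_right// ltW.
Qed.

End Smooth.

(** * Test functions and the lemma of du Bois-Reymond *)

Section TestFunctions.
Variable R : realType.
Variables a b : R.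
Hypothesis ab : a < b.
Implicit Types (x y c d : R) (f g u v psi : R -> R).
Local Notation test := (test_function a b).
Local Notation mu := (@lebesgue_measure R).
Local Notation IO f := (\int[mu]_(x in `]a, b[) f x).
Local Notation itg f := (mu.-integrable `]a, b[ (EFin \o f)).

Lemma test_smooth psi : test psi -> smooth psi.
Proof. by case. Qed.

Lemma test_support psi : test psi -> exists c d,
  [/\ a < c, d < b & forall x, (x < c) || (d < x) -> psi x = 0].
Proof.
move=> [_ [c [d [ac db s]]]]; exists c, d; split=> // x xcd.
by apply: s; rewrite in_itv/= negb_and -!ltNge.
Qed.

Lemma mk_test psi c d : smooth psi -> a < c -> d < b ->
  (forall x, (x < c) || (d < x) -> psi x = 0) -> test psi.
Proof.
move=> [sp] ac db s; split=> //; exists c, d; split=> // x.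
by rewrite in_itv/= negb_and -!ltNge; exact: s.
Qed.

Lemma test_derive psi : test psi -> test (psi^`()%classic).
Proof.
move=> tp; have [c [d [ac db s]]] := test_support tp.
apply: (mk_test (smooth_derive (test_smooth tp)) ac db) => x xcd.
rewrite derive1E; suff H : is_derive x 1 psi 0 by rewrite derive_val.
apply: (@near_eq_is_derive _ _ _ (fun=> 0)).
case/orP : xcd => xcd; near=> y; apply/esym/s/orP.
  by left; near: y; exact: lt_nbhsl.
by right; near: y; exact: lt_nbhsr.
Unshelve. all: by end_near. Qed.

Lemma test_derive1n n psi : test psi -> test (derive1n n psi).
Proof. by move=> tp; elim: n => // n ih; rewrite derive1nS; exact: test_derive. Qed.

Lemma testDZ f g c : test f -> test g -> test (fun x => f x + c * g x).
Proof.
move=> tf tg; have [c1 [d1 [ac1 db1 s1]]] := test_support tf.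
have [c2 [d2 [ac2 db2 s2]]] := test_support tg.
have sm : smooth (fun x => f x + c * g x).
  by apply: smoothD; [|apply: smoothZ]; apply: test_smooth.
apply: (@mk_test _ (Num.min c1 c2) (Num.max d1 d2)) => //.
- by rewrite lt_min ac1.
- by rewrite gt_max db1.
- move=> x; rewrite lt_min gt_max => /orP[/andP[h1 h2]|/andP[h1 h2]];
  by rewrite s1 ?h1 ?orbT// s2 ?h2 ?orbT// mulr0 addr0.
Qed.

Lemma derive1n_DZ n f g c : smooth f -> smooth g ->
  derive1n n (fun x => f x + c * g x) =
  (fun x => derive1n n f x + c * derive1n n g x).
Proof.
move=> sf sg; elim: n => // n ih; rewrite !derive1nS ih; apply/funext => x.
have df := @smooth_derivable _ f n x sf; have dg := @smooth_derivable _ g n x sg.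
rewrite !derive1E deriveD//; last exact: derivableZ.
by congr (_ + _); rewrite (@deriveZ _ _ _ (derive1n n g) c).
Qed.

Lemma test_end psi : test psi -> psi a = 0 /\ psi b = 0.
Proof.
by move=> /test_support[c [d [ac db s]]]; rewrite !s ?ac ?db ?orbT.
Qed.

Lemma cont_on_test psi : test psi -> cont_on a b psi.
Proof.
by move=> /test_smooth sp; exact/cont_on_continuous/(@smooth_continuous _ _ 0).
Qed.

Lemma test_exists : exists2 psi, test psi & INT a b psi = 1.
Proof.
have ab_ := ab; pose L := (b - a) / 3; pose c := a + L.
have L0 : 0 < L by rewrite /L; lra.
pose f x := bump (L^-1 * x + - (L^-1 * c)).
have sf : smooth f by apply: smooth_affine; exact: smooth_bump.
have tf : test f.
  apply: (@mk_test _ c (c + L)) => //; [by rewrite /c; lra|by rewrite /c /L; lra|].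
  move=> x /orP[xc|xc]; apply: bump_eq0; rewrite -mulrBr.
    by left; rewrite pmulr_rle0 ?invr_gt0// subr_le0 ltW.
  by right; rewrite mulrC ler_pdivlMr//; lra.
have If : 0 < INT a b f.
  rewrite lt_neqAle INT_ge0 ?andbT; last by move=> x _; exact: bump_ge0.
  apply/eqP => /esym.
  move=> /(INT_eq0 ab (cont_on_test tf) (fun x _ => bump_ge0 _)) /(_ (c + L / 2)).
  move=> /(_ ltac:(rewrite /c /L; lra)).
  rewrite /f -mulrBr (_ : L^-1 * _ = 2^-1); last by field; lra.
  have h1 : 0 < 2^-1 :> R by rewrite invr_gt0.
  have h2 : 0 < 1 - 2^-1 :> R by lra.
  rewrite /bump /flat h1 h2 !hornerC !mul1r => /eqP.
  by apply/negP; rewrite mulf_neq0// gt_eqF// expR_gt0.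
exists (fun x => 0 * f x + (INT a b f)^-1 * f x).
  have -> : (fun x => 0 * f x + (INT a b f)^-1 * f x) =
            (fun x => f x + ((INT a b f)^-1 - 1) * f x).
    by apply/funext => x; ring.
  exact: testDZ.
have cf := cont_on_test tf.
by rewrite INTD ?INTZ ?mul0r ?add0r ?mulVf ?gt_eqF//; exact: cont_onZ.
Qed.

(** The primitive from a vanishes to the left of the support, and to the right of it because the
    total integral is 0. *)
Lemma test_antiderivative psi : test psi -> INT a b psi = 0 ->
  exists2 chi, test chi & chi^`()%classic = psi.
Proof.
move=> tp Ip; have [c [d [ac db s]]] := test_support tp.
have sp := test_smooth tp.
pose F x := INT a x psi.
have F0 x : x < c -> F x = 0.
  move=> xc; rewrite /F (@eq_INT _ _ _ _ (fun=> 0)) ?INT0// => y /andP[_ yx].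
  by apply: s; rewrite (le_lt_trans yx).
have dF x : is_derive x 1 F (psi x).
  have [xc|cx] := ltP x c.
    rewrite s ?xc//; apply: (@near_eq_is_derive _ _ _ (fun=> 0)).
    by near=> y; rewrite F0//; near: y; exact: lt_nbhsl.
  have cp : cont_on a (x + 1) psi.
    exact/cont_on_continuous/(@smooth_continuous _ _ 0).
  have [_ d1] := INT_primitive (ltac:(lra) : a <= x + 1) cp.
  by apply: d1; lra.
have sF := smooth_antiderivative dF sp.
have FE : F^`()%classic = psi.
  by apply/funext => x; rewrite derive1E; have := dF x => ?; rewrite derive_val.
exists F => //; apply: (mk_test sF ac db) => x /orP[/F0//|dx].
have cF y z : cont_on y z F by exact/cont_on_continuous/(@smooth_continuous _ _ 0).
have H y z : d < y -> y <= z -> F y = F z.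
  move=> dy; rewrite le_eqVlt => /predU1P[->//|yz].
  have [e /andP[ye _]] := segment_MVT (lexx _) yz (lexx _) (cF _ _) (fun t _ => dF t).
  by rewrite s ?mul0r; [move/subr0_eq|rewrite (lt_trans dy)// orbT].
by have [xb|bx] := leP x b; [rewrite (H _ b)|rewrite -(H b)// ltW].
Unshelve. all: by end_near. Qed.

Lemma cont_on_itg f : cont_on a b f -> itg f.
Proof.
move=> /cont_on_integrable; apply: integrableS => //.
exact: subset_itv_oo_cc.
Qed.

Lemma IO_INT f : cont_on a b f -> IO f = INT a b f.
Proof.
move=> cf; rewrite Rintegral_itv_obnd_cbnd; last exact: cont_on_itg.
rewrite Rintegral_itv_bndo_bndc//; apply: integrableS (cont_on_integrable cf) => //.
exact: subset_itv_co_cc.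
Qed.

Lemma itgM f g : itg f -> continuous g -> itg (fun x => f x * g x).
Proof.
move=> itf cg; have [M M0 gM] := cont_on_bounded (ltW ab) (@cont_on_continuous _ a b _ cg).
have /= := @integrableMl _ _ _ mu `]a, b[%classic _ (EFin \o f) g itf.
apply => //.
  by apply: (@measurable_funS _ _ _ _ setT) => //; exact: continuous_measurable_fun.
exists M; split=> [|N MN x /=]; first exact: num_real.
rewrite in_itv/= => /andP[ax xb].
by apply: (le_trans _ (ltW MN)); apply: gM; rewrite !ltW.
Qed.

Lemma itgD f g : itg f -> itg g -> itg (fun x => f x + g x).
Proof. by move=> itf itg_; exact: (@integrableD _ _ _ mu _ (measurable_itv `]a, b[) _ _ itf itg_). Qed.

Lemma itgZ f c : itg f -> itg (fun x => c * f x).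
Proof.
by move=> itf; exact: (@integrableZl _ _ _ mu _ (measurable_itv `]a, b[) c (EFin \o f) itf).
Qed.

(** Subtracting from [psi] its integral times a fixed test function [th] of integral 1 leaves the
    derivative of a test function. Hence u pairs with the n-th derivative of [psi] to give a
    constant times the integral of [psi]. A monomial of degree n has the same pairing, and the
    induction hypothesis applies to the difference. *)
Lemma du_bois_reymond n u : itg u ->
  (forall psi, test psi -> IO (fun x => u x * derive1n n psi x) = 0) ->
  exists2 p : {poly R}, (size p <= n)%N &
    forall psi, test psi -> IO (fun x => (u x - p.[x]) * psi x) = 0.
Proof.
elim: n u => [|n ih] u itu u0.
  exists 0; first by rewrite size_poly0.
  by move=> psi /u0; congr (_ = _); apply: eq_Rintegral => x _; rewrite horner0 subr0.
have [th tth Ith] := test_exists.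
have cn k psi : test psi -> continuous (derive1n k psi).
  by move=> /test_smooth; exact: smooth_continuous.
pose c := IO (fun x => u x * derive1n n th x).
have H psi : test psi -> IO (fun x => u x * derive1n n psi x) = INT a b psi * c.
  move=> tp; pose k := - INT a b psi.
  have tc := testDZ k tp tth.
  have Ic : INT a b (fun x => psi x + k * th x) = 0.
    have [c1 c2] := (cont_on_test tp, cont_on_test tth).
    by rewrite INTD ?INTZ// ?Ith ?mulr1 ?subrr//; exact: cont_onZ.
  have [chi tchi chiE] := test_antiderivative tc Ic.
  have := u0 chi tchi; rewrite derive1Sn chiE.
  rewrite derive1n_DZ; [|exact: test_smooth..].
  have -> : IO (fun x => u x * (derive1n n psi x + k * derive1n n th x)) =
      IO (fun x => u x * derive1n n psi x + k * (u x * derive1n n th x)).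
    by apply: eq_Rintegral => x _; ring.
  have i1 : itg (fun x => u x * derive1n n psi x) by apply: itgM => //; exact: cn.
  have i2 : itg (fun x => u x * derive1n n th x) by apply: itgM => //; exact: cn.
  rewrite RintegralD//; last exact: itgZ.
  by rewrite RintegralZl// /k mulNr => /subr0_eq.
(* The coefficient makes the n-th derivative of [q] equal to [(-1) ^+ n * c]; the sign compensates n
   integrations by parts. *)
pose q : {poly R} := ((-1) ^+ n * c / n`!%:R) *: 'X^n.
have qE psi : test psi -> IO (fun x => q.[x] * derive1n n psi x) = INT a b psi * c.
  move=> tp.
  have cq := @chain_poly _ a b n q.
  have cp := @smooth_chain _ a b n _ (test_smooth tp).
  rewrite IO_INT; last by apply: cont_onM; [exact: (cq.1 0%N)|exact: (cp.1 n)].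
  rewrite (@chain_by_parts _ a b n (fun j x => q^`(j).[x]) (fun j => derive1n j psi))//.
  - rewrite (@eq_INT _ _ _ _ (fun x => (-1) ^+ n * c * psi x)); last first.
      move=> x _; rewrite derivnZ derivnXn subnn ffactnn hornerZ hornerMn hornerXn expr0.
      by congr (_ * _); rewrite divfK.
    rewrite INTZ; last exact: cont_on_test.
    by rewrite !mulrA -exprD addnn -mul2n exprM sqrrN expr1n expr1n mul1r mulrC.
  - exact: ltW.
  - by move=> j _; apply: test_end; exact: test_derive1n.
have cq : continuous (horner q) by exact: continuous_horner.
have itq : itg (horner q) by apply: cont_on_itg; exact: cont_on_continuous.
have itN : itg (fun x => u x + -1 * q.[x]) by apply: itgD => //; exact: itgZ.
have [p sp pE] : exists2 p : {poly R}, (size p <= n)%N &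
    forall psi, test psi -> IO (fun x => (u x + -1 * q.[x] - p.[x]) * psi x) = 0.
  apply: ih => // psi tp.
  have -> : IO (fun x => (u x + -1 * q.[x]) * derive1n n psi x) =
     IO (fun x => u x * derive1n n psi x + -1 * (q.[x] * derive1n n psi x)).
    by apply: eq_Rintegral => x _; ring.
  have i1 : itg (fun x => u x * derive1n n psi x) by apply: itgM => //; exact: cn.
  have i2 : itg (fun x => q.[x] * derive1n n psi x) by apply: itgM => //; exact: cn.
  rewrite RintegralD//; last exact: itgZ.
  by rewrite RintegralZl// H// qE// mulN1r subrr.
exists (p + q).
  rewrite (leq_trans (size_polyD _ _))// geq_max (leq_trans sp)//=.
  by rewrite (leq_trans (size_scale_leq _ _))// size_polyXn.
move=> psi tp; rewrite -[RHS](pE psi tp); apply: eq_Rintegral => x _.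
by rewrite hornerD; ring.
Qed.

End TestFunctions.

(** * The fundamental lemma of the calculus of variations *)

Section Fundamental.
Variable R : realType.
Variables a b : R.
Hypothesis ab : a < b.
Implicit Types (x y c d t : R) (f g u v psi : R -> R).
Local Notation test := (test_function a b).
Local Notation mu := (@lebesgue_measure R).
Local Notation IO f := (\int[mu]_(x in `]a, b[) f x).
Local Notation itg f := (mu.-integrable `]a, b[ (EFin \o f)).

(* Smooth cutoffs tending pointwise to the indicator of ]a, t] on ]a, b[. *)
Lemma cutoff_exists t : a < t < b -> exists psi : nat -> R -> R,
  [/\ forall n, test (psi n),
      forall n x, 0 <= psi n x <= 1 &
      forall x, a < x < b -> \forall n \near \oo, psi n x = (x <= t)%R%:R].
Proof.
(* Adding [K] to the slope keeps the right end [t + (k n)^-1] of the support strictly below b. *)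
move=> /andP[at_ tb]; pose K := (b - t)^-1; pose k n : R := n.+1%:R + K.
have K0 : 0 < K by rewrite invr_gt0 subr_gt0.
have k0 n : 0 < k n by rewrite addr_gt0.
pose f n x := step (k n * x + (- (k n * a) - 1)) * step (- k n * x + (k n * t + 1)).
have kinf c : \forall n \near \oo, c <= k n.
  near=> n; rewrite (@le_trans _ _ n%:R)//; last by rewrite /k -natr1; lra.
  by near: n; exact: nbhs_infty_ger.
exists f; split.
- move=> n; have kn0 := k0 n.
  apply: (@mk_test _ _ _ _ (a + (k n)^-1) (t + (k n)^-1)).
  + by apply: smoothM; apply: smooth_affine; exact: smooth_step.
  + by rewrite ltrDl invr_gt0.
  + rewrite -ltrBrDl -[b - t]invrK ltf_pV2 ?posrE ?invr_gt0 ?subr_gt0//.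
    by rewrite /k ltrDr.
  + move=> x; rewrite /f; move: (k n) kn0 => q q0 /orP[xa|xt].
      rewrite step_left ?mul0r//.
      have : q * (x - a) <= q * q^-1 by rewrite ler_pM2l//; lra.
      by rewrite mulfV ?gt_eqF//; lra.
    rewrite mulrC step_left ?mul0r//.
    have : q * q^-1 <= q * (x - t) by rewrite ler_pM2l//; lra.
    by rewrite mulfV ?gt_eqF//; lra.
- move=> n x; have /andP[h1 h2] := step_bounded (k n * x + (- (k n * a) - 1)).
  have /andP[h3 h4] := step_bounded (- k n * x + (k n * t + 1)).
  by rewrite /f mulr_ge0// mulr_ile1.
- move=> x /andP[ax xb]; have [xt|tx] := leP x t.
    near=> n; have : 2 / (x - a) <= k n by near: n.
    rewrite /f; move: (k n) (k0 n) => q q0; rewrite ler_pdivrMr ?subr_gt0// => H.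
    by rewrite !step_right ?mulr1//; nra.
  near=> n; have : 1 / (x - t) <= k n by near: n.
  rewrite /f; move: (k n) (k0 n) => q q0; rewrite ler_pdivrMr ?subr_gt0// => H.
  by rewrite mulrC step_left ?mul0r//; lra.
Unshelve. all: by end_near. Qed.

(** The cutoffs are bounded by 1 and tend to the indicator of ]a, t], so dominated convergence with
    majorant [|v|] carries the orthogonality over to that indicator. *)
Lemma test_orthogonal_INT0 v : itg v ->
  (forall psi, test psi -> IO (fun x => v x * psi x) = 0) ->
  forall t, a < t < b -> \int[mu]_(x in `]a, t]) v x = 0.
Proof.
move=> itv v0 t atb; have [psi [tpsi bpsi cpsi]] := cutoff_exists atb.
have mv : measurable_fun `]a, b[ v by apply/measurable_EFinP; exact: measurable_int itv.
have mpsi n : measurable_fun `]a, b[ (psi n).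
  apply: (@measurable_funS _ _ _ _ setT) => //; apply: continuous_measurable_fun.
  by apply: (@smooth_continuous _ _ 0); exact: test_smooth (tpsi n).
pose fl x := v x * (x <= t)%R%:R.
have mfl : measurable_fun `]a, b[ fl.
  apply: measurable_funM => //.
  rewrite (_ : (fun x => _) = \1_(`]-oo, t]%classic : set R)).
    exact: measurable_indic.
  by apply/funext => x; rewrite indicE mem_setE in_itv.
have H := @dominated_convergence _ _ _ mu `]a, b[%classic (measurable_itv _)
  (fun n x => (v x * psi n x)%:E) (EFin \o fl) (fun x => `|v x|%:E).
have {H} [] := H.
- by move=> n; apply/measurable_EFinP; exact: (measurable_funM mv (mpsi n)).
- exact/measurable_EFinP.
- apply: aeW => x /=; rewrite in_itv/= => axb.
  apply: cvg_near_cst; have := cpsi x axb; apply: filterS => n.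
  by rewrite /fl => ->.
- exact: integrable_norm.
- apply: aeW => x n _; rewrite lee_fin normrM ler_piMr//.
  by have /andP[h1 h2] := bpsi n x; rewrite ger0_norm.
move=> ifl _ H.
have E : \int[mu]_(x in `]a, b[) fl x = 0.
  suff : (0 = \int[mu]_(x in `]a, b[) (fl x)%:E)%E by rewrite /Rintegral => <-.
  apply: (cvg_unique _ _ H) => //.
  apply: cvg_near_cst; near=> n => /=.
  have i1 : itg (fun x => v x * psi n x).
    apply: itgM => //; apply: (@smooth_continuous _ _ 0); exact: test_smooth (tpsi n).
  have fn : (\int[mu]_(x in `]a, b[) (v x * psi n x)%:E \is a fin_num)%E.
    exact: integrable_fin_num.
  by have := v0 _ (tpsi n); rewrite /Rintegral -{2}(fineK fn) => ->.
rewrite -[RHS]E.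
have -> : `]a, t]%classic = `]a, b[%classic `&` `]-oo, t]%classic :> set R.
  apply/seteqP; split=> x /=; rewrite !in_itv/=.
    by move=> /andP[ax xt]; rewrite ax xt (le_lt_trans xt)//; case/andP: atb.
  by move=> [/andP[-> _] ->].
rewrite Rintegral_mkcondr; apply: eq_Rintegral => x _; rewrite /fl patchE mem_setE in_itv/=.
by case: (x <= t); rewrite ?mulr1 ?mulr0.
Unshelve. all: by end_near. Qed.

Lemma cont_on_eq0 v : cont_on a b v -> (forall x, a < x < b -> v x = 0) ->
  forall x, a <= x <= b -> v x = 0.
Proof.
move=> cv vo x axb; apply/eqP; rewrite -sqrf_eq0; apply/eqP.
have c2 : cont_on a b (fun x => v x ^+ 2) by apply: cont_onM.
apply: (INT_eq0 ab c2 _ _ axb); first by move=> y _; exact: sqr_ge0.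
rewrite -IO_INT// (@eq_Rintegral _ _ _ _ _ (fun=> 0)).
  by rewrite Rintegral_cst// mul0r.
by move=> y; rewrite inE/= in_itv/= => ayb; rewrite vo// expr0n.
Qed.

Lemma cont_test_orthogonal v : cont_on a b v ->
  (forall psi, test psi -> IO (fun x => v x * psi x) = 0) ->
  forall x, a <= x <= b -> v x = 0.
Proof.
move=> cv v0.
have itv := cont_on_itg cv.
have H := test_orthogonal_INT0 itv v0.
apply: cont_on_eq0 => // x axb; have [_ /(_ x axb) d1] := INT_primitive (ltW ab) cv.
have d2 : is_derive x 1 (fun x : R => INT a x v) 0.
  apply: (eq_ider (@ider_cst _ a b 0) _ _ axb) => // y ayb.
  rewrite -(H y ayb) /INT -Rintegral_itv_obnd_cbnd//.
  apply: integrableS (cont_on_integrable cv) => //.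
  by move=> z /=; rewrite !in_itv/=; lra.
by rewrite -(@derive_val _ _ _ _ _ _ _ d1) (@derive_val _ _ _ _ _ _ _ d2).
Qed.

(** All integrals from a vanish, and by Lebesgue differentiation an integrable function is almost
    everywhere the derivative of its primitive. *)
Lemma ae_test_orthogonal v : itg v ->
  (forall psi, test psi -> IO (fun x => v x * psi x) = 0) ->
  {ae mu, forall x, a < x < b -> v x = 0}.
Proof.
move=> itv v0; have H := test_orthogonal_INT0 itv v0.
pose f := v \_ `]a, b[.
have itf : mu.-integrable setT (EFin \o f).
  rewrite /f -restrict_EFin; apply/integrable_restrict => //=.
  by rewrite setTI.
have lf : locally_integrable setT f by exact: integrable_locally.
have := @FTC1 R f (BRight a) _ lf.
have ity y : mu.-integrable [set` Interval (BRight a) (BRight y)] (EFin \o f).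
  exact: integrableS itf.
move=> /(_ ity); apply: filterS; first exact: (ae_filter_ringOfSetsType mu).
move=> x F axb.
have [ax xb] := andP axb.
have /F[d1] : (BRight a < BRight x)%O by [].
have fx : f x = v x by rewrite /f patchE mem_setE in_itv/= axb.
rewrite fx => <-; rewrite derive1E.
suff d2 : is_derive x 1 (fun y => \int[mu]_(t in [set` Interval (BRight a) (BRight y)]) f t) 0.
  by rewrite derive_val.
apply: (eq_ider (@ider_cst _ a b 0) _ _ axb) => // y ayb.
rewrite -[LHS](H y ayb); apply: eq_Rintegral => z; rewrite inE/= in_itv/= => azy.
by rewrite /f patchE mem_setE in_itv/= ifT//; lra.
Qed.

End Fundamental.

(** * Truncated powers and Taylor's formula *)

Section Powers.
Variable R : realType.
Implicit Types (a b c x y z M : R) (f : R -> R) (v : nat -> R -> R).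

Definition pw n z : R := z ^+ n / n`!%:R.

Lemma pw0 z : pw 0 z = 1.
Proof. by rewrite /pw fact0 divr1. Qed.

Lemma pwS0 n : pw n.+1 0 = 0 :> R.
Proof. by rewrite /pw expr0n mul0r. Qed.

Lemma is_derive_pw n z : is_derive z 1 (pw n.+1) (pw n z).
Proof.
have E : pw n.+1 = horner ((n.+1`!%:R^-1 : R) *: 'X^(n.+1) : {poly R})%R.
  by apply/funext => x; rewrite hornerZ hornerXn /pw mulrC.
rewrite E; have d := is_derive_horner ((n.+1`!%:R^-1 : R) *: 'X^(n.+1)) z.
apply: (is_derive_eq d).
rewrite derivZ derivXn hornerZ hornerMn hornerXn /pw factS natrM -[z ^+ n *+ _]mulr_natl.
by field; rewrite pnatr_eq0 -lt0n fact_gt0 nat1r pnatr_eq0.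
Qed.

Lemma continuous_pw n : continuous (pw n).
Proof.
case: n => [|n].
  by rewrite (_ : pw 0 = fun=> 1); [move=> x; exact: cvg_cst|apply/funext => x; exact: pw0].
by apply: derivable1_continuous => x; case: (is_derive_pw n x).
Qed.

(** The truncated power, whose derivative of order n+1 is the Dirac mass at 0: the raw material of
    Green's function. *)
Definition tpw n z : R := if 0 < z then pw n z else 0.

Lemma tpw_le0 n z : z <= 0 -> tpw n z = 0.
Proof. by rewrite /tpw ltNge => ->. Qed.

Lemma tpw_ge0 n z : 0 <= z -> tpw n.+1 z = pw n.+1 z.
Proof.
rewrite /tpw le_eqVlt => /predU1P[<-|->//].
by rewrite ltxx pwS0.
Qed.

Lemma is_derive_tpw n z : is_derive z 1 (tpw n.+2) (tpw n.+1 z).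
Proof.
have [z0|z0|<-] := ltgtP 0 z.
- rewrite /tpw z0; apply: near_eq_is_derive (is_derive_pw _ _).
  by near=> y; rewrite ifT//; near: y; exact: lt_nbhsr.
- rewrite tpw_le0 ?ltW//; apply: (@near_eq_is_derive _ _ _ (fun=> 0)).
  by near=> y; rewrite tpw_le0//; near: y; exact: lt_le_nbhsl.
- rewrite tpw_le0//; apply: (@is_derive_quad _ _ _ 1) => y.
  rewrite (tpw_le0 _ (lexx 0)) !subr0 mul1r => y1; rewrite /tpw; case: ifPn => [y0|_]; last first.
    by rewrite normr0 sqr_ge0.
  rewrite /pw ger0_norm ?divr_ge0 ?exprn_ge0// ?(ltW y0)//.
  rewrite -addn2 exprD mulrAC ler_piMl ?sqr_ge0// ler_pdivrMr ?ltr0n ?fact_gt0// mul1r.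
  rewrite (@le_trans _ _ 1)//; last by rewrite ler1n fact_gt0.
  by rewrite exprn_ile1// ?(ltW y0)// (le_trans (ler_norm _)).
Unshelve. all: by end_near. Qed.

Lemma continuous_tpw n : continuous (tpw n.+1).
Proof.
case: n => [|n]; last by apply: derivable1_continuous => x; case: (is_derive_tpw n x).
rewrite (_ : tpw 1 = fun z => Num.max z 0).
  by move=> z; apply: continuous_max; [exact: cvg_id|exact: cvg_cst].
by apply/funext => z; rewrite /tpw /pw expr1 (_ : 1`! = 1%N)// divr1; case: ltgtP.
Qed.

Lemma ler_tpw n z M : 0 <= M -> z <= M -> `|tpw n z| <= M ^+ n.
Proof.
move=> M0 zM; rewrite /tpw; case: ifPn => [z0|_]; last by rewrite normr0 exprn_ge0.
rewrite /pw ger0_norm ?divr_ge0 ?exprn_ge0// ?(ltW z0)//.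
rewrite ler_pdivrMr ?ltr0n ?fact_gt0// (@le_trans _ _ (M ^+ n))//.
  by rewrite lerXn2r// nnegrE// ltW.
by rewrite ler_peMr ?exprn_ge0// ler1n fact_gt0.
Qed.

Lemma INT_split a b c f : a <= c <= b -> cont_on a b f ->
  INT a b f = INT a c f + INT c b f.
Proof.
move=> /andP[ac cb] cf; have ab := le_trans ac cb.
have [cF dF] := INT_primitive ab cf.
rewrite (@INT_FTC2 _ c b (fun x => INT a x f) f)//.
- by rewrite addrC subrK.
- exact: cont_on_sub cF.
- exact: cont_on_sub cf.
- exact: ider_sub dF.
Qed.

Lemma continuous_sub f y : continuous f -> continuous (fun t => f (t - y)).
Proof.
move=> cf x; apply: (@continuous_comp _ _ _ (fun t => t - y) f x); last exact: cf.
by apply: cvgB; [exact: cvg_id|exact: cvg_cst].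
Qed.

(** Taylor's formula with integral remainder, expanded at b where all the data vanish; only the
    remainder is left. *)
Lemma taylor_end y b n v : y <= b -> chain y b n.+1 v ->
  (forall j, (j <= n)%N -> v j b = 0) ->
  INT y b (fun t => v n.+1 t * pw n (t - y)) = (-1) ^+ n.+1 * v 0%N y.
Proof.
move=> yb; elim: n => [|n ih] cv v0.
  rewrite (@eq_INT _ _ _ _ (v 1%N)); last by move=> x _; rewrite pw0 mulr1.
  rewrite (INT_FTC2 yb (cv.1 0%N _) (cv.1 1%N _) (cv.2 0%N _))// v0// sub0r.
  by rewrite expr1 mulN1r.
have dp k : ider y b (fun t => pw k.+1 (t - y)) (fun t => pw k (t - y)).
  move=> x _; have := @is_derive_affine R (pw k.+1) 1 (- y) x (pw k (x - y)).
  rewrite !mul1r => /(_ (is_derive_pw _ _)).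
  by congr is_derive; apply/funext => t; rewrite mul1r.
have cp k : cont_on y b (fun t => pw k (t - y)).
  by apply: cont_on_continuous; apply: continuous_sub; exact: continuous_pw.
rewrite (@eq_INT _ _ _ _ (fun t => pw n.+1 (t - y) * v n.+2 t)); last first.
  by move=> x _; rewrite mulrC.
rewrite (INT_by_parts yb (cp n.+1) (cp n) (dp n) (cv.1 n.+1 _) (cv.1 n.+2 _) (cv.2 n.+1 _))//.
rewrite v0// subrr pwS0 mulr0 mul0r subrr sub0r.
rewrite (@eq_INT _ _ _ _ (fun t => v n.+1 t * pw n (t - y))); last first.
  by move=> x _; rewrite mulrC.
rewrite ih; first by rewrite [in RHS]exprS mulN1r mulNr.
  exact: chainW cv.
by move=> j jn; apply: v0; exact: leqW.
Qed.

Lemma taylor_tpw a b y n v : a <= y <= b -> chain a b n.+2 v ->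
  (forall j, (j <= n.+1)%N -> v j b = 0) ->
  INT a b (fun t => v n.+2 t * tpw n.+1 (t - y)) = (-1) ^+ n.+2 * v 0%N y.
Proof.
move=> ayb cv v0; have [ay yb] := andP ayb.
have ct : cont_on a b (fun t => tpw n.+1 (t - y)).
  by apply: cont_on_continuous; apply: continuous_sub; exact: continuous_tpw.
rewrite (INT_split ayb); last by apply: cont_onM => //; exact: (cv.1 n.+2).
rewrite (@eq_INT _ _ _ _ (fun=> 0)); last first.
  by move=> x /andP[_ xy]; rewrite tpw_le0 ?mulr0// subr_le0.
rewrite INT0 add0r -(@taylor_end y b)//; last exact: chain_sub cv.
by apply: eq_INT => x /andP[yx _]; rewrite tpw_ge0// subr_ge0.
Qed.

Lemma poly_eq0_itv a b (p : {poly R}) : a < b ->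
  (forall x, a <= x <= b -> p.[x] = 0) -> p = 0.
Proof.
move=> ab p0; apply/eqP/negPn/negP => pn0.
pose s := [seq a + (b - a) / i.+1%:R | i <- iota 0 (size p)].
have us : uniq s.
  rewrite map_inj_uniq ?iota_uniq// => i j /addrI/(mulfI _).
  rewrite subr_eq0 gt_eqF// => /(_ isT)/invr_inj/eqP.
  by rewrite eqr_nat => /eqP[].
have rs : all (root p) s.
  apply/allP => x /mapP[i _ ->]; apply/eqP/p0.
  have i0 : 0 < i.+1%:R^-1 :> R by rewrite invr_gt0.
  have i1 : i.+1%:R^-1 <= 1 :> R by rewrite invf_le1// ler1n.
  have ba : 0 < b - a by rewrite subr_gt0.
  apply/andP; split; first by rewrite lerDl mulr_ge0// ltW.
  by rewrite -lerBrDl ler_piMr// ltW.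
by have := max_poly_roots pn0 rs us; rewrite size_map size_iota ltnn.
Qed.

End Powers.

(** * The explicit Green's function: reproducing property, symmetry, uniqueness *)

Section Green.
Variable R : realType.
Variables (a b : R) (r : nat).
Hypothesis ab : a < b.
Hypothesis r2 : (2 <= r)%N.
Implicit Types (x y z : R) (p q : {poly R}) (u v U : nat -> R -> R) (phi psi : R -> R).
Local Notation test := (test_function a b).

(** Since the derivative of order 2r is zero, r integrations by parts show that the r-th derivative
    has zero square integral. The clamped data at a then propagate 0 down to [p]. *)
Lemma poly_eq0_bc p : (size p <= 2 * r)%N ->
  (forall j, (j < r)%N -> p^`(j).[a] = 0 /\ p^`(j).[b] = 0) -> p = 0.
Proof.
move=> sp p0; apply: (poly_eq0_itv ab).
have cp n : chain a b n (fun j x => p^`(j).[x]) by exact: chain_poly.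
have cpr : chain a b r (fun j x => p^`(r + j).[x]) by exact: (chain_drop (cp (r + r)%N)).
have I0 : INT a b (fun x => p^`(r).[x] * p^`(r).[x]) = 0.
  have := chain_by_parts (ltW ab) cpr (cp r) p0; rewrite addn0 => ->.
  rewrite (@eq_INT _ _ _ _ (fun=> 0)) ?INT0 ?mulr0// => x _.
  by rewrite addnn -mul2n derivn_poly0// horner0 mul0r.
have pr0 x : a <= x <= b -> p^`(r).[x] = 0.
  move=> axb; apply/eqP; rewrite -sqrf_eq0 expr2; apply/eqP.
  apply: (INT_eq0 ab _ _ I0 axb); last by move=> y _; rewrite -expr2 sqr_ge0.
  by apply: cont_onM; exact: ((cp r).1 r (leqnn _)).
move=> x axb; apply/eqP; rewrite -normr_le0 -[leRHS](mul0r ((b - a) ^+ r)).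
apply: (chain_le (ltW ab) (lexx 0) (cp r)) => //.
  by move=> j /p0[pa _]; exists a => //; rewrite lexx ltW.
by move=> y /pr0 ->; rewrite normr0.
Qed.

Definition bc_val p (i : 'I_(r + r)) : R :=
  match fintype.split i with inl j => p^`(j).[a] | inr j => p^`(j).[b] end.

Lemma derivn_lin_horner j (I : finType) (c : I -> R) (P : I -> {poly R}) x :
  (\sum_i c i *: P i)^`(j).[x] = \sum_i c i * (P i)^`(j).[x].
Proof.
rewrite linear_sum horner_sum; apply: eq_bigr => i _.
by rewrite linearZ hornerZ.
Qed.

(** The 2r boundary functionals on the 2r coefficients form a square matrix, which is injective by
    [poly_eq0_bc]. *)
Lemma hermite_exists (d : 'rV[R]_(r + r)) :
  exists2 p : {poly R}, (size p <= 2 * r)%N & forall i, bc_val p i = d 0 i.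
Proof.
pose M := \matrix_(i < r + r, l < r + r) bc_val ('X^i : {poly R}) l.
pose pol (c : 'rV[R]_(r + r)) := \sum_(i < r + r) c 0 i *: ('X^i : {poly R}).
have spol c : (size (pol c) <= 2 * r)%N.
  rewrite /pol (leq_trans (size_sum _ _ _))//; apply/bigmax_leqP => i _.
  rewrite (leq_trans (size_scale_leq _ _))// size_polyXn mul2n -addnn; exact: ltn_ord.
have bcE c l : (c *m M) 0 l = bc_val (pol c) l.
  rewrite mxE /bc_val /pol; under eq_bigr do rewrite mxE /bc_val.
  by case: fintype.splitP => j _; rewrite derivn_lin_horner.
have fM : row_free M.
  apply: inj_row_free => c cM.
  have p0 : pol c = 0.
    apply: poly_eq0_bc (spol c) _ => j jr.
    have H l : bc_val (pol c) l = 0 by rewrite -bcE cM mxE.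
    split; [have := H (lshift r (Ordinal jr))|have := H (rshift r (Ordinal jr))];
    by rewrite /bc_val (unsplitK (inl _)) || rewrite /bc_val (unsplitK (inr _)).
  apply/rowP => i; rewrite mxE; have : (pol c)`_i = 0 by rewrite p0 coef0.
  rewrite coef_sum (bigD1 i)//= big1 => [|j ji].
    by rewrite addr0 coefZ coefXn eqxx mulr1.
  by rewrite coefZ coefXn eq_sym (inj_eq val_inj) (negbTE ji) mulr0.
exists (pol (d *m invmx M)) => [//|i].
by rewrite -bcE mulmxKV// -row_free_unit.
Qed.

Definition hermite_spec (k : nat) p := (size p <= 2 * r)%N /\
  forall j, (j < r)%N -> p^`(j).[a] = 0 /\ p^`(j).[b] = (j == k)%:R.

Definition hermite k : {poly R} := xget 0 (hermite_spec k).

Lemma hermiteP k : hermite_spec k (hermite k).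
Proof.
apply: xgetPex.
pose d : 'rV[R]_(r + r) := \row_i (match fintype.split i with inl _ => 0 | inr j => (val j == k)%:R end).
have [p sp H] := hermite_exists d; exists p; split=> // j jr; split.
  have := H (lshift r (Ordinal jr)).
  by rewrite /bc_val mxE (unsplitK (inl _)).
have := H (rshift r (Ordinal jr)).
by rewrite /bc_val mxE (unsplitK (inr _)).
Qed.

(* [green] is the truncated power solving the equation on the whole line,
   corrected by the polynomial [green_poly y] for the boundary conditions at b;
   those at a hold for both parts. [dgreen j] is its j-th derivative in x. *)
Definition green_coef (k : nat) y : R := - ((-1) ^+ r * tpw (2 * r - 1 - k) (b - y)).

Definition green_poly y : {poly R} := \sum_(k < r) green_coef k y *: hermite k.

Definition dgreen j y x : R :=
  (-1) ^+ r * tpw (2 * r - 1 - j) (x - y) + (green_poly y)^`(j).[x].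

Definition green x y : R := dgreen 0 y x.

Lemma size_green_poly y : (size (green_poly y) <= 2 * r)%N.
Proof.
rewrite (leq_trans (size_sum _ _ _))//; apply/bigmax_leqP => k _.
by rewrite (leq_trans (size_scale_leq _ _))//; case: (hermiteP k).
Qed.

Lemma dgreen_chain y : chain a b (2 * r - 2) (fun j => dgreen j y).
Proof.
apply: chainD; last exact: chain_poly.
apply: chainZ; split=> j jr.
  have -> : (2 * r - 1 - j = (2 * r - 2 - j).+1)%N by lia.
  by apply: cont_on_continuous; apply: continuous_sub; exact: continuous_tpw.
have -> : (2 * r - 1 - j = (2 * r - 3 - j).+2)%N by lia.
have -> : (2 * r - 1 - j.+1 = (2 * r - 3 - j).+1)%N by lia.
move=> x _; have := @is_derive_affine R (tpw (2 * r - 3 - j).+2) 1 (- y) x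
  (tpw (2 * r - 3 - j).+1 (x - y)).
rewrite !mul1r => /(_ (is_derive_tpw _ _)).
by congr is_derive; apply/funext => t; rewrite mul1r.
Qed.

Lemma dgreen_bc y j : a <= y <= b -> (j < r)%N -> dgreen j y a = 0 /\ dgreen j y b = 0.
Proof.
move=> /andP[ay yb] jr; rewrite /dgreen /green_poly !derivn_lin_horner; split.
  rewrite tpw_le0 ?subr_le0// mulr0 add0r big1// => k _.
  by have [_ /(_ j jr)[-> _]] := hermiteP k; rewrite mulr0.
rewrite (bigD1 (Ordinal jr))//= big1 ?addr0 => [|k kj].
  by have [_ /(_ j jr)[_ ->]] := hermiteP j; rewrite eqxx mulr1 /green_coef subrr.
have [_ /(_ j jr)[_ ->]] := hermiteP k.
rewrite (_ : (j == k) = false) ?mulr0//.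
by apply/negbTE; move: kj; rewrite -(inj_eq val_inj) eq_sym.
Qed.

Lemma dgreen_bounded : exists2 K, 0 <= K & forall j x y, (j <= 2 * r - 2)%N ->
  a <= x <= b -> a <= y <= b -> `|dgreen j y x| <= K.
Proof.
(* As [L] is at least 1, a single power of it dominates all truncated powers of degree at most
   2r. *)
pose L := Num.max 1 (b - a).
have L1 : 1 <= L by rewrite le_max lexx.
have L0 : 0 <= L by rewrite (le_trans _ L1).
have tL n x y : (n <= 2 * r)%N -> a <= x <= b -> a <= y <= b ->
    `|tpw n (x - y)| <= L ^+ (2 * r).
  move=> nr axb ayb; rewrite (@le_trans _ _ (L ^+ n))//; last exact: ler_weXn2l.
  by apply: ler_tpw => //; rewrite le_max; apply/orP; right; lra.
have [H H0 HH] : exists2 H, 0 <= H & forall k j x, (k < r)%N -> (j <= 2 * r - 2)%N ->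
    a <= x <= b -> `|(hermite k)^`(j).[x]| <= H.
  have : forall kj : 'I_r * 'I_(2 * r), exists M, 0 <= M /\ forall x, a <= x <= b ->
      `|(hermite kj.1)^`(kj.2).[x]| <= M.
    move=> kj; have [M M0 HM] := cont_on_bounded (ltW ab)
       ((@chain_poly R a b kj.2 (hermite kj.1)).1 kj.2 (leqnn _)).
    by exists M.
  move=> /choice[M HM]; exists (\sum_kj M kj).
    by apply: sumr_ge0 => kj _; case: (HM kj).
  move=> k j x kr jr axb; have jr' : (j < 2 * r)%N by lia.
  rewrite (bigD1 (Ordinal kr, Ordinal jr'))//= (le_trans ((HM (Ordinal kr, Ordinal jr')).2 x axb))//.
  by rewrite lerDl sumr_ge0// => kj _; case: (HM kj).
exists (L ^+ (2 * r) + \sum_(k < r) L ^+ (2 * r) * H).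
  by rewrite addr_ge0 ?exprn_ge0// sumr_ge0// => k _; rewrite mulr_ge0 ?exprn_ge0.
move=> j x y jr axb ayb; rewrite /dgreen (le_trans (ler_normD _ _))// lerD//.
  by rewrite normrM normrX normrN1 expr1n mul1r tL//; lia.
rewrite /green_poly derivn_lin_horner (le_trans (ler_norm_sum _ _ _))//.
apply: ler_sum => k _; rewrite normrM ler_pM//; last exact: HH.
rewrite /green_coef normrN normrM normrX normrN1 expr1n mul1r tL//; first by lia.
by rewrite lexx ltW.
Qed.

(** [green] is the reproducing kernel of the product of r-th derivatives on clamped functions. The
    polynomial part is killed by r integrations by parts, and the truncated power gives back [v 0 y]
    by Taylor's formula. *)
Lemma green_identity v y : a <= y <= b -> chain a b r v ->
  (forall j, (j < r)%N -> v j a = 0 /\ v j b = 0) ->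
  INT a b (fun t => v r t * dgreen r y t) = v 0%N y.
Proof.
move=> ayb cv v0; have cG := dgreen_chain y.
have cp n : chain a b n (fun j x => (green_poly y)^`(j).[x]) by exact: chain_poly.
have cpr : chain a b r (fun j x => (green_poly y)^`(r + j).[x]).
  exact: (chain_drop (cp (r + r)%N)).
have I0 : INT a b (fun x => (green_poly y)^`(r).[x] * v r x) = 0.
  have := chain_by_parts (ltW ab) cpr cv v0; rewrite addn0 => ->.
  rewrite (@eq_INT _ _ _ _ (fun=> 0)) ?INT0 ?mulr0// => x _.
  by rewrite addnn -mul2n derivn_poly0 ?size_green_poly// horner0 mul0r.
have [n rn] : exists n, r = n.+2 by exists (r - 2)%N; lia.
have ct : cont_on a b (fun t => tpw (2 * r - 1 - r) (t - y)).
  have -> : (2 * r - 1 - r = n.+1)%N by lia.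
  by apply: cont_on_continuous; apply: continuous_sub; exact: continuous_tpw.
have cvr := cv.1 r (leqnn _).
rewrite (@eq_INT _ _ _ _ (fun t => (-1) ^+ r * (v r t * tpw (2 * r - 1 - r) (t - y)) +
   (green_poly y)^`(r).[t] * v r t)); last by move=> t _; rewrite /dgreen; ring.
rewrite INTD; last 2 first.
- by apply: cont_onZ; exact: cont_onM.
- by apply: cont_onM => //; exact: ((cp r).1 r (leqnn _)).
rewrite I0 addr0 INTZ; last exact: cont_onM.
have -> : (2 * r - 1 - r = n.+1)%N by lia.
move: (cv) (v0); rewrite rn => cv' v0'.
rewrite taylor_tpw// => [|j jn]; last by case: (v0' j).
by rewrite mulrA -exprD addnn -mul2n exprM sqrrN expr1n expr1n mul1r.
Qed.

(** By the reproducing property both values are the same product of the r-th derivatives of two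
    kernel sections. *)
Lemma green_sym x y : a <= x <= b -> a <= y <= b -> green x y = green y x.
Proof.
have H z w : a <= z <= b -> a <= w <= b ->
    INT a b (fun t => dgreen r w t * dgreen r z t) = green z w.
  move=> azb awb; rewrite (@green_identity (fun j => dgreen j w))//.
    by apply: chainW (dgreen_chain w); lia.
  by move=> j jr; exact: dgreen_bc.
move=> axb ayb; rewrite -H// -[RHS]H//; apply: eq_INT => t _; exact: mulrC.
Qed.

Lemma green_represents U x : a <= x <= b -> chain a b (2 * r) U ->
  (forall j, (j < r)%N -> U j a = 0 /\ U j b = 0) ->
  INT a b (fun t => green t x * U (2 * r)%N t) = (-1) ^+ r * U 0%N x.
Proof.
move=> axb cU U0.
have cUr : chain a b r (fun j => U (r + j)%N).
  by apply: chain_drop; rewrite addnn -mul2n.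
have cG : chain a b r (fun j => dgreen j x) by apply: chainW (dgreen_chain x); lia.
have := chain_by_parts (ltW ab) cUr cG (fun j jr => dgreen_bc axb jr).
rewrite addn0 addnn -mul2n (green_identity axb (chainW _ cU) U0); last by lia.
move=> ->; rewrite mulrA -exprD addnn -mul2n exprM sqrrN expr1n expr1n mul1r.
by apply: eq_INT => t _; rewrite mulrC.
Qed.

Fixpoint primitive n phi : R -> R :=
  if n is n'.+1 then fun x => INT a x (primitive n' phi) else phi.

Lemma primitive_chain n phi : cont_on a b phi ->
  chain a b n (fun j => primitive (n - j) phi).
Proof.
move=> cphi; have cp k : cont_on a b (primitive k phi).
  by elim: k => //= k ih; case: (INT_primitive (ltW ab) ih).
split=> j jn; first exact: cp.
have -> : (n - j = (n - j.+1).+1)%N by lia.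
by case: (INT_primitive (ltW ab) (cp (n - j.+1)%N)).
Qed.

Lemma primitive_at n phi : (0 < n)%N -> primitive n phi a = 0.
Proof. by case: n => // n _; rewrite /= INT_set1. Qed.

(* the solution of (-1)^r U^(2r) = phi with the boundary conditions *)
Definition green_sol phi j x : R :=
  (-1) ^+ r * primitive (2 * r - j) phi x +
  (\sum_(k < r) (- ((-1) ^+ r * primitive (2 * r - k) phi b)) *: hermite k)^`(j).[x].

Lemma green_sol_chain phi : cont_on a b phi -> chain a b (2 * r) (green_sol phi).
Proof.
move=> cphi; apply: chainD; last exact: chain_poly.
by apply: chainZ; exact: primitive_chain.
Qed.

Lemma green_sol_bc phi j : (j < r)%N -> green_sol phi j a = 0 /\ green_sol phi j b = 0.
Proof.
move=> jr; rewrite /green_sol !derivn_lin_horner; split.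
  rewrite primitive_at ?mulr0 ?add0r; last by lia.
  by rewrite big1// => k _; have [_ /(_ j jr)[-> _]] := hermiteP k; rewrite mulr0.
rewrite (bigD1 (Ordinal jr))//= big1 ?addr0 => [|k kj].
  by have [_ /(_ j jr)[_ ->]] := hermiteP j; rewrite eqxx mulr1 subrr.
have [_ /(_ j jr)[_ ->]] := hermiteP k.
rewrite (_ : (j == k) = false) ?mulr0//.
by apply/negbTE; move: kj; rewrite -(inj_eq val_inj) eq_sym.
Qed.

Lemma green_sol_top phi x : green_sol phi (2 * r) x = (-1) ^+ r * phi x.
Proof.
rewrite /green_sol subnn derivn_poly0 ?horner0 ?addr0//.
rewrite (leq_trans (size_sum _ _ _))//; apply/bigmax_leqP => k _.
by rewrite (leq_trans (size_scale_leq _ _))//; case: (hermiteP k).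
Qed.

Lemma signrr : (-1) ^+ r * (-1) ^+ r = 1 :> R.
Proof. by rewrite -exprD addnn -mul2n exprM sqrrN expr1n expr1n. Qed.

Lemma cont_on_green x : a <= x <= b -> cont_on a b (green x).
Proof.
move=> axb; have /(_ isT) := (dgreen_chain x).1 0%N.
by move=> /eq_cont_on; apply=> y ayb; rewrite (green_sym axb ayb).
Qed.

Lemma INT_green phi x : a <= x <= b -> cont_on a b phi ->
  INT a b (fun y => green x y * phi y) = green_sol phi 0 x.
Proof.
move=> axb cphi.
rewrite -[RHS]mul1r -signrr -mulrA.
rewrite -(green_represents axb (green_sol_chain cphi) (@green_sol_bc phi)).
rewrite -INTZ; last first.
  by apply: cont_onM; [exact: (dgreen_chain x).1 0%N isT|exact: (green_sol_chain cphi).1 (2 * r)%N (leqnn _)].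
apply: eq_INT => y ayb; rewrite green_sol_top (green_sym axb ayb).
by rewrite [RHS]mulrCA [X in _ = _ * X]mulrA signrr mul1r.
Qed.

(** Energy identity: symmetry and positivity of the integral operator are both read off the
    right-hand side. *)
Lemma INT_green_form phi psi : cont_on a b phi -> cont_on a b psi ->
  INT a b (fun x => phi x * green_sol psi 0 x) =
  INT a b (fun x => green_sol phi r x * green_sol psi r x).
Proof.
move=> cphi cpsi; have cU := green_sol_chain cphi; have cV := green_sol_chain cpsi.
have cUr : chain a b r (fun j => green_sol phi (r + j)%N).
  by apply: chain_drop; rewrite addnn -mul2n.
have cVr : chain a b r (green_sol psi) by apply: chainW cV; lia.
have := chain_by_parts (ltW ab) cUr cVr (@green_sol_bc psi); rewrite addn0 => ->.
rewrite -INTZ; last by apply: cont_onM; [exact: (cUr.1 r (leqnn _))|exact: (cV.1 0%N isT)].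
by apply: eq_INT => x _; rewrite addnn -mul2n green_sol_top 2!mulrA signrr mul1r.
Qed.

(** For y inside, [g] and [green] have the same distributional derivative of order 2r in x, so they
    differ by a polynomial of degree below 2r. Both satisfy the clamped conditions, so [poly_eq0_bc]
    makes this polynomial zero. *)
Lemma green_unique (g : R -> R -> R) : is_green a b r g ->
  forall x y, a <= x <= b -> a <= y <= b -> g x y = green x y.
Proof.
move=> [Hg gend] x y axb ayb.
have [yo|] : (a < y < b) \/ (y = a \/ y = b).
  have [ay yb] := andP ayb; move: ay; rewrite le_eqVlt => /predU1P[ya|ay]; first by right; left.
  move: yb; rewrite le_eqVlt => /predU1P[yb|yb]; first by right; right.
  by left; rewrite ay.
2: { move=> yab; have [] := gend x _; first by rewrite in_itv.
  have [] := (dgreen_bc axb (ltac:(lia) : (0 < r)%N)).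
  move=> Ga Gb ga gb; rewrite (green_sym axb ayb) /green.
  by case: yab => ->; rewrite ?Ga ?Gb ?ga ?gb. }
have {Hg} [/ContOn cg gw gbc] := Hg y ltac:(by rewrite in_itv).
have cG := dgreen_chain y.
have cG0 : cont_on a b (green^~ y) by exact: (cG.1 0%N).
have cu : cont_on a b (fun x => g x y - green x y) by exact: cont_onB.
have [p sp pE] : exists2 p : {poly R}, (size p <= 2 * r)%N & forall psi, test psi ->
    \int[lebesgue_measure]_(x in `]a, b[) ((g x y - green x y - p.[x]) * psi x) = 0.
  apply: (du_bois_reymond ab); first exact: cont_on_itg.
  move=> psi tpsi.
  have cpsi : cont_on a b (derive1n (2 * r) psi).
    by apply/cont_on_continuous/smooth_continuous/test_smooth; exact: tpsi.
  rewrite IO_INT; last exact: cont_onM.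
  rewrite (@eq_INT _ _ _ _ (fun x => g x y * derive1n (2 * r) psi x -
     green x y * derive1n (2 * r) psi x)); last by move=> ? _; ring.
  rewrite INTB; [|exact: cont_onM..].
  rewrite -IO_INT; last exact: cont_onM.
  rewrite gw//.
  rewrite (@green_represents (fun j => derive1n j psi) y ayb) ?subrr//.
    exact/smooth_chain/(test_smooth tpsi).
  by move=> j _; apply: test_end; exact: test_derive1n.
have up z : a <= z <= b -> g z y = green z y + p.[z].
  move=> azb.
  have := cont_test_orthogonal ab _ pE azb.
  move=> /(_ ltac:(apply: cont_onB => //; exact: cont_on_continuous (@continuous_horner _ p))).
  by move/eqP; rewrite subr_eq0 subr_eq addrC => /eqP.
have cGp : chain a b (2 * r - 2) (fun j x => dgreen j y x + p^`(j).[x]).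
  by apply: chainD => //; exact: chain_poly.
suff p0 : p = 0 by rewrite up// p0 horner0 addr0.
apply: poly_eq0_bc sp _ => j jr.
have jr2 : (j <= 2 * r - 2)%N by lia.
have [ga gb] := gbc j jr; have [Ga Gb] := dgreen_bc ayb jr.
have D := derive_itvn_chain ab cGp up jr2.
have := D a; rewrite lexx (ltW ab) ga Ga add0r => /(_ isT) <-.
by have := D b; rewrite lexx (ltW ab) gb Gb add0r => /(_ isT) <-.
Qed.

End Green.

(** * Sign alternations and the overdetermined boundary problem *)

Section Alternation.
Variable R : realType.
Implicit Types (a b c d x y s : R) (u v : R -> R) (U : nat -> R -> R) (t : nat -> R).

(** At least n strict sign changes. Only the sign of [s] matters; leaving its size free lets it
    absorb the factors produced by the differential equation. *)
Definition alternates a b n u := exists t s,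
  [/\ forall i, (i < n)%N -> t i < t i.+1,
      forall i, (i <= n)%N -> a <= t i <= b &
      forall i, (i <= n)%N -> 0 < s * (-1) ^+ i * u (t i)].

(** Common engine of the Rolle-type lemmas: increments of alternating sign give, by the mean value
    theorem, interlaced points where the derivative has these signs. *)
Lemma alternates_mvt a b n u v t s : cont_on a b u -> ider a b u v ->
  a <= t 0%N -> t n.+1 <= b -> (forall i, (i <= n)%N -> t i < t i.+1) ->
  (forall i, (i <= n)%N -> 0 < s * (-1) ^+ i * (u (t i.+1) - u (t i))) ->
  alternates a b n v.
Proof.
move=> cu du at0 tb tt ut.
have tle i j : (i <= j)%N -> (j <= n.+1)%N -> t i <= t j.
  move=> /subnK <-; elim: (j - i)%N => // k ih kn.
  by rewrite (le_trans (ih _))// ?ltW ?tt// (leq_trans _ kn)// addSn.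
have /choice[w Hw] : forall i, exists c, (i <= n)%N ->
    t i < c < t i.+1 /\ u (t i.+1) - u (t i) = v c * (t i.+1 - t i).
  move=> i.
  have [le_in|] := leqP i n; last by exists 0.
  have [||c ci e] := segment_MVT _ (tt i le_in) _ cu du.
  - by apply: (le_trans at0); apply: tle => //; exact: leqW.
  - by apply: le_trans tb; exact: tle.
  by exists c.
exists w, s; split => i le_in.
- have [/andP[_ h1] _] := Hw i (ltnW le_in); have [/andP[h2 _] _] := Hw i.+1 le_in.
  exact: lt_trans h2.
- have [/andP[h1 h2] _] := Hw i le_in.
  have h3 : t 0%N <= t i by apply: tle => //; exact: leqW.
  have h4 : t i.+1 <= t n.+1 by exact: tle.
  by rewrite (le_trans at0) ?(le_trans h3) ?ltW// (lt_le_trans h2)// (le_trans h4).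
- have [h1 h2] := Hw i le_in; have := ut i le_in; rewrite h2 mulrA pmulr_lgt0//.
  by rewrite subr_gt0 tt.
Qed.

Lemma alternates_rolle a b n u v : cont_on a b u -> ider a b u v ->
  alternates a b n.+1 u -> alternates a b n v.
Proof.
move=> cu du [t [s [tt tab ut]]]; apply: (@alternates_mvt a b n u v t (- s)) => //.
- by case/andP: (tab 0%N isT).
- by case/andP: (tab n.+1 (leqnn _)).
- move=> i le_in; have := ut i (leqW le_in); have := ut i.+1 le_in.
  by rewrite exprS; set e := (-1) ^+ i; nra.
Qed.

Lemma alternates_rolle_left a b n u v : cont_on a b u -> ider a b u v -> u a = 0 ->
  alternates a b n u -> alternates a b n v.
Proof.
move=> cu du ua [t [s [tt tab ut]]].
pose t' i := if i is i'.+1 then t i' else a.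
have at0 : a < t 0%N.
  have /andP[h _] := tab 0%N isT; rewrite lt_neqAle h andbT; apply/eqP => e.
  by have := ut 0%N isT; rewrite -e ua mulr0 ltxx.
apply: (@alternates_mvt a b n u v t' s) => //.
- by case/andP: (tab n (leqnn _)).
- by case=> [//|i] le_in; exact: tt.
- case=> [_|i le_in]; first by rewrite /t' ua subr0; exact: ut.
  have := ut i (ltnW le_in); have := ut i.+1 le_in.
  by rewrite exprS /t'; set e := (-1) ^+ i; nra.
Qed.

Lemma alternates_rolle_ends a b n u v : cont_on a b u -> ider a b u v ->
  u a = 0 -> u b = 0 -> alternates a b n u -> alternates a b n.+1 v.
Proof.
move=> cu du ua ub [t [s [tt tab ut]]].
pose t' i := if i is i'.+1 then (if (i' <= n)%N then t i' else b) else a.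
have at0 : a < t 0%N.
  have /andP[h _] := tab 0%N isT; rewrite lt_neqAle h andbT; apply/eqP => e.
  by have := ut 0%N isT; rewrite -e ua mulr0 ltxx.
have tnb : t n < b.
  have /andP[_ h] := tab n (leqnn _); rewrite lt_neqAle h andbT; apply/eqP => e.
  by have := ut n (leqnn _); rewrite e ub mulr0 ltxx.
apply: (@alternates_mvt a b n.+1 u v t' s) => //.
- by rewrite /t' ltnn.
- case=> [//|i]; rewrite ltnS leq_eqVlt => /predU1P[->|le_in].
    by rewrite /t' ltnn leqnn.
  by rewrite /t' le_in ltnW//; exact: tt.
- case=> [_|i]; first by rewrite /t' ua subr0; exact: ut.
  rewrite ltnS leq_eqVlt => /predU1P[->|le_in].
    rewrite /t' ltnn leqnn ub; have := ut n (leqnn _).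
    by rewrite exprS; set e := (-1) ^+ n; nra.
  have := ut i (ltnW le_in); have := ut i.+1 le_in.
  by rewrite exprS /t' le_in ltnW//; set e := (-1) ^+ i; nra.
Qed.

Lemma alternates_zero a b n u : a <= b -> cont_on a b u -> alternates a b n.+1 u ->
  exists2 z, a <= z <= b & u z = 0.
Proof.
move=> ab cu [t [s [tt tab ut]]].
have h0 := tab 0%N isT; have h1 := tab 1%N isT; have h01 := tt 0%N isT.
have := ut 0%N isT; have := ut 1%N isT; rewrite expr0 expr1 mulr1 mulrN1 => u1 u0.
have c01 : cont_on (t 0%N) (t 1%N) u.
  by apply: cont_on_sub cu; [case/andP: h0|case/andP: h1].
have [|z zt uz] := IVT (ltW h01) (cont_on_within c01) (v := 0).
  have [s0|s0|s0] := ltgtP s 0.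
  - by rewrite ge_min le_max; apply/andP; split; apply/orP; [left|right]; nra.
  - by rewrite ge_min le_max; apply/andP; split; apply/orP; [right|left]; nra.
  - by move: u0; rewrite s0 mul0r ltxx.
by exists z => //; move: zt; rewrite in_itv/=; lra.
Qed.

(* Each clamped derivative gains an alternation, each free one loses it; the
   extra zero at a leaves a gain of one over 2r derivatives, so the alternations
   of a solution of U^(2r) = k U would be unbounded in number. *)
Lemma alternates_gain a b r U k n : (0 < r)%N -> chain a b (2 * r) U ->
  (forall j, (j < r)%N -> U j a = 0 /\ U j b = 0) -> U r a = 0 ->
  (forall x, a <= x <= b -> U (2 * r)%N x = k * U 0%N x) ->
  alternates a b n (U 0%N) -> alternates a b n.+1 (U 0%N).
Proof.
move=> r0 [cU dU] U0 Ura Uk al.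
have H1 j : (j <= r)%N -> alternates a b (n + j) (U j).
  elim: j => [|j ih] jr; first by rewrite addn0.
  have [ua ub] := U0 j jr; rewrite addnS.
  by apply: (alternates_rolle_ends _ _ ua ub (ih (ltnW jr))); [apply: cU|apply: dU]; lia.
have H2 j : (j < r)%N -> alternates a b (n + r - j) (U (r + j).+1).
  elim: j => [|j ih] jr.
    rewrite subn0 addn0.
    by apply: (alternates_rolle_left _ _ Ura (H1 r (leqnn _))); [apply: cU|apply: dU]; lia.
  have := ih (ltnW jr).
  have -> : (n + r - j = (n + r - j.+1).+1)%N by lia.
  rewrite addnS.
  by apply: alternates_rolle; [apply: cU|apply: dU]; lia.
have := H2 r.-1 ltac:(lia).
have -> : (n + r - r.-1 = n.+1)%N by lia.
have -> : (r + r.-1).+1 = (2 * r)%N by lia.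
move=> [t [s [tt tab ut]]]; exists t, (s * k); split=> // i le_in.
have := ut i le_in; rewrite Uk; last exact: tab.
by congr (_ < _); ring.
Qed.

(** With enough alternations, r consecutive ones fit in a segment [c, d] so short that the equation
    contracts: every derivative of order below r has a zero in [c, d], so the maximum of [|U 0|]
    there is at most [|k| * e < 1] times itself. It is then 0, which contradicts the
    alternations. *)
Lemma alternates_unbounded a b U r k : a < b -> (0 < r)%N -> chain a b r U ->
  (forall x, a <= x <= b -> U r x = k * U 0%N x) ->
  ~ (forall n, alternates a b n (U 0%N)).
Proof.
move=> ab r0 cU Uk alt.
(* Chosen so that [|k| * e < 1], and [e <= 1] so that powers of a length below [e] stay below
   [e]. *)
pose e := (`|k| + 1)^-1.
have k1 : 0 < `|k| + 1 by rewrite ltr_wpDl.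
have e0 : 0 < e by rewrite invr_gt0.
have e1 : e <= 1 by rewrite invf_le1// lerDr.
(* Pigeonhole: among [K] consecutive groups of r alternations, one spans a length at most [e], since
   [K%:R * e] exceeds [b - a]. *)
pose K := (Num.truncn ((b - a) / e)).+1.
have HK : b - a < K%:R * e.
  by rewrite -ltr_pdivrMr// truncnS_gt.
have [t [s [tt tab ut]]] := alt (K * r)%N.
have tle i j : (i <= j)%N -> (j <= K * r)%N -> t i <= t j.
  move=> /subnK <-; elim: (j - i)%N => // m ih mn.
  by rewrite (le_trans (ih _))// ?ltW ?tt// (leq_trans _ mn)// addSn.
have [m mK tm] : exists2 m, (m < K)%N & t (m.+1 * r)%N - t (m * r)%N <= e.
  apply: contrapT => /forall2NP H.
  have HH m : (m <= K)%N -> m%:R * e <= t (m * r)%N - t 0%N.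
    elim: m => [|m ih] mK; first by rewrite mul0r mul0n subrr.
    have [//|/negP] := H m; rewrite -ltNge => h1; have h2 := ih (ltnW mK).
    by rewrite -natr1 mulrDl mul1r; lra.
  have := HH K (leqnn _); have := tab (K * r)%N (leqnn _); have := tab 0%N isT.
  by move: HK; lra.
set c := t (m * r)%N in tm; set d := t (m.+1 * r)%N in tm.
have mrK i : (i <= r)%N -> (m * r + i <= K * r)%N.
  have : (m * r + r <= K * r)%N by rewrite -mulSnr leq_mul2r mK orbT.
  by lia.
have cd : c < d.
  apply: (@le_lt_trans _ _ (t (m * r + r.-1)%N)).
    by apply: tle; rewrite ?leq_addr// mrK// leq_pred.
  have -> : d = t (m * r + r.-1).+1 by rewrite /d; congr t; lia.
  by apply: tt; have := mrK r (leqnn _); lia.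
have ac : a <= c by case/andP: (tab (m * r)%N ltac:(by have := mrK 0%N isT; rewrite addn0)).
have db : d <= b.
  by case/andP: (tab (m.+1 * r)%N ltac:(by have := mrK r (leqnn _); rewrite mulSn addnC)).
have cUs : chain c d r U := chain_sub ac db cU.
have altr : alternates c d r (U 0%N).
  exists (fun i => t (m * r + i)%N), (s * (-1) ^+ (m * r)); split.
  - by move=> i ir; rewrite addnS; apply: tt; rewrite -addnS mrK.
  - move=> i ir; apply/andP; split; first by apply: tle; rewrite ?leq_addr ?mrK.
    rewrite /d mulSnr; apply: tle; first by rewrite leq_add2l.
    exact: mrK.
  - by move=> i ir; have := ut _ (mrK i ir); rewrite exprD mulrA.
have alj j : (j <= r)%N -> alternates c d (r - j) (U j).
  elim: j => [|j ih] jr; first by rewrite subn0.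
  have := ih (ltnW jr); have -> : (r - j = (r - j.+1).+1)%N by lia.
  by apply: alternates_rolle; [apply: cUs.1; exact: ltnW|exact: cUs.2].
have zj j : (j < r)%N -> exists2 z, c <= z <= d & U j z = 0.
  move=> jr; apply: (@alternates_zero c d (r - j.+1)); first exact: ltW.
    by apply: cUs.1; exact: ltnW.
  have -> : ((r - j.+1).+1 = r - j)%N by lia.
  exact/alj/ltnW.
have [z + Hz] := EVT_max (ltW cd) (cont_on_within (cont_on_abs (cUs.1 0%N isT))).
rewrite in_itv/= => zcd.
pose M0 := `|U 0%N z|; have Mz : M0 = `|U 0%N z| by [].
have HM0 x : c <= x <= d -> `|U 0%N x| <= M0.
  by move=> xcd; apply: Hz; rewrite in_itv.
have M00 : 0 <= M0 by rewrite Mz.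
have top x : c <= x <= d -> `|U r x| <= `|k| * M0.
  move=> xcd; rewrite Uk ?normrM ?ler_wpM2l ?HM0//.
  by move: xcd => /andP[cx xd]; rewrite (le_trans ac)// (le_trans xd).
have := chain_le (ltW cd) (mulr_ge0 (normr_ge0 k) M00) cUs zj top zcd.
rewrite -Mz => hM.
have dc : (d - c) ^+ r <= e.
  rewrite -(prednK r0) exprS (@le_trans _ _ (d - c))// ler_piMr ?subr_ge0 ?(ltW cd)//.
  by rewrite exprn_ile1// ?subr_ge0 ?(ltW cd)// (le_trans tm).
have M0le : M0 <= M0 * (`|k| * e).
  by rewrite (le_trans hM)// (mulrC `|k|) -mulrA !ler_wpM2l.
have ke : `|k| * e < 1 by rewrite /e ltr_pdivrMr// mul1r ltrDl.
have M0z : M0 = 0 by apply/eqP; rewrite eq_le M00 andbT; nra.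
have [t' [s' [_ tcd' ut']]] := altr.
have := ut' 0%N isT; have := HM0 _ (tcd' 0%N isT).
by rewrite M0z normr_le0 => /eqP ->; rewrite mulr0 ltxx.
Qed.

(** A single nonzero value is an alternation of length 0, and [alternates_gain] lengthens it
    forever. *)
Lemma overdetermined_eq0 a b r U k : a < b -> (0 < r)%N -> chain a b (2 * r) U ->
  (forall j, (j < r)%N -> U j a = 0 /\ U j b = 0) -> U r a = 0 ->
  (forall x, a <= x <= b -> U (2 * r)%N x = k * U 0%N x) ->
  forall x, a <= x <= b -> U 0%N x = 0.
Proof.
move=> ab r0 cU U0 Ura Uk x axb; apply: contrapT => /eqP ux.
apply: (alternates_unbounded ab _ cU Uk); first by rewrite muln_gt0.
elim=> [|n ih]; last exact: (alternates_gain r0 cU U0 Ura Uk ih).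
exists (fun=> x), (U 0%N x); split=> // -[|]//= _.
by rewrite expr0 mulr1 -expr2 exprn_even_gt0.
Qed.

End Alternation.

(** * The trapezoidal rule *)

Section Quadrature.
Variable R : realType.
Variables a b : R.
Hypothesis ab : a < b.
Implicit Types (x y c d M L B : R) (f g : R -> R) (u F : nat -> R -> R) (m l : nat).

Lemma chain_shift c d e n u : chain c d n u ->
  chain (c - e) (d - e) n (fun j x => u j (e + x)).
Proof.
move=> [cu du]; split=> j jn; first by apply: cont_on_shift; exact: cu.
by apply: ider_shift; exact: du.
Qed.

(** The sum omits the two end nodes: it is the trapezoidal rule for integrands vanishing at the
    ends, and a Riemann sum up to O(h) for the others. *)
Definition quad m f : R := mesh a b m * \sum_(l < m) f (node a b m l.+1).

Lemma mesh_gt0 m : 0 < mesh a b m.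
Proof. by rewrite divr_gt0// subr_gt0. Qed.

Lemma mesh_sum m : m.+1%:R * mesh a b m = b - a.
Proof. by rewrite mulrC divfK// pnatr_eq0. Qed.

Lemma node0 m : node a b m 0 = a.
Proof. by rewrite /node mul0r addr0. Qed.

Lemma node_last m : node a b m m.+1 = b.
Proof. by rewrite /node mesh_sum addrC subrK. Qed.

Lemma nodeS m l : node a b m l.+1 = node a b m l + mesh a b m.
Proof. by rewrite /node -natr1 mulrDl mul1r addrA. Qed.

Lemma node_in m l : (l <= m.+1)%N -> a <= node a b m l <= b.
Proof.
move=> lm; have h0 := mesh_gt0 m; apply/andP; split.
  by rewrite lerDl mulr_ge0// ltW.
rewrite -[leRHS](node_last m) /node lerD2l ler_wpM2r ?ler_nat//.
exact: ltW.
Qed.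

Lemma mesh_le m : mesh a b m <= b - a.
Proof.
have ab_ := ab; rewrite ler_pdivrMr// ler_peMr ?ler1n//; lra.
Qed.

(** Translate the grid: [S j t] is h times the sum of [P j] over the nodes shifted by t, where [P 0]
    is the primitive of [F 0] and [P j.+1] is [F j]. The increment of [S j] over [0, h] telescopes
    to boundary values of [P j], which vanish for j > 0, so the derivatives of [S 1] have zeros in
    [0, h]. The rule is [S 1 0], the integral is [S 1 c] for some c by the mean value theorem for
    [S 0], and the zeros bound [S 2] by a multiple of h^(N-1). *)
Lemma trapezoid_error N F M m : (0 < N)%N -> 0 <= M -> chain a b N F ->
  (forall j, (j < N)%N -> F j a = 0 /\ F j b = 0) ->
  (forall x, a <= x <= b -> `|F N x| <= M) ->
  `|quad m (F 0%N) - INT a b (F 0%N)| <= M * (b - a) * mesh a b m ^+ N.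
Proof.
move=> N0 M0 cF F0 FM; have h0 := mesh_gt0 m; set h := mesh a b m in h0 *.
have ab_ := ltW ab.
pose P j := if j is j'.+1 then F j' else fun x => INT a x (F 0%N).
have cP : chain a b N.+1 P.
  have [c0 d0] := INT_primitive ab_ (cF.1 0%N isT).
  by split=> -[|j]// jN; [exact: cF.1|exact: cF.2].
pose S j t := h * \sum_(l < m.+1) P j (node a b m l + t).
have cS : chain 0 h N.+1 S.
  apply: chainZ; apply: chain_sum => l _.
  have /andP[al _] := node_in (ltnW (ltn_ord l)).
  have /andP[_ lb] := @node_in m l.+1 (ltn_ord l).
  have := chain_shift (node a b m l) (chain_sub al lb cP).
  by rewrite nodeS subrr addrAC subrr add0r.
have telS j : S j h - S j 0 = h * (P j b - P j a).
  rewrite -mulrBr -sumrB; congr (_ * _).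
  have := telescope_sumr (fun l => P j (node a b m l)) (leq0n m.+1).
  rewrite big_mkord node_last node0 => <-.
  by apply: eq_bigr => l _; rewrite addr0 nodeS.
have zS j : (j.+1 <= N)%N -> exists2 z, 0 <= z <= h & S j.+2 z = 0.
  move=> jN; have [c c0h e] := segment_MVT (lexx 0) h0 (lexx h) (cS.1 j.+1 (leqW jN))
    (cS.2 j.+1 jN).
  exists c; first by lra.
  move: e; rewrite telS /P subr0; have [-> ->] := F0 j jN.
  by rewrite subr0 mulr0 => /esym/eqP; rewrite mulf_eq0 (gt_eqF h0) orbF => /eqP.
have SN x : 0 <= x <= h -> `|S N.+1 x| <= M * (b - a).
  move=> x0h; rewrite normrM (gtr0_norm h0).
  have : `|\sum_(l < m.+1) P N.+1 (node a b m l + x)| <= m.+1%:R * M.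
    rewrite (le_trans (ler_norm_sum _ _ _))// -[in leRHS](card_ord m.+1) mulrC mulr_natr.
    rewrite -sumr_const ler_sum// => l _; apply: FM.
    have /andP[h1 _] := node_in (ltnW (ltn_ord l)).
    have /andP[_ h2] := @node_in m l.+1 (ltn_ord l).
    by move: h2; rewrite nodeS -/h; lra.
  move=> /(ler_wpM2l (ltW h0)) H; rewrite (le_trans H)//.
  by rewrite mulrA (mulrC h) mesh_sum mulrC.
have S2 x : 0 <= x <= h -> `|S 2%N x| <= M * (b - a) * h ^+ N.-1.
  have cS2 : chain 0 h N.-1 (fun j => S (2 + j)%N).
    by apply: chain_drop; apply: chainW cS; lia.
  rewrite -[h in h ^+ _]subr0; apply: (chain_le (ltW h0) _ cS2).
  - by rewrite mulr_ge0// subr_ge0.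
  - by move=> j jN; apply: zS; lia.
  - have -> : (2 + N.-1 = N.+1)%N by lia.
    exact: SN.
have [c c0h e] := segment_MVT (lexx 0) h0 (lexx h) (cS.1 0%N isT) (cS.2 0%N isT).
have Ie : INT a b (F 0%N) = S 1%N c.
  apply: (mulfI (lt0r_neq0 h0)); rewrite [RHS]mulrC; move: e.
  by rewrite telS /P INT_set1 !subr0.
have Qe : quad m (F 0%N) = S 1%N 0.
  rewrite /quad /S; congr (_ * _); rewrite big_ord_recl/= addr0 node0.
  have [-> _] := F0 0%N N0; rewrite add0r; apply: eq_bigr => l _.
  by rewrite addr0.
rewrite Ie Qe distrC; have c0 : 0 < c by lra.
have ch : c <= h by lra.
have [d d0c ->] := segment_MVT (lexx 0) c0 ch (cS.1 1%N isT) (cS.2 1%N N0).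
rewrite subr0 normrM -[in leRHS](prednK N0) exprSr mulrA ler_pM//.
  by apply: S2; lra.
by rewrite gtr0_norm.
Qed.

Definition lip_on L f := forall x y, a <= x <= b -> a <= y <= b ->
  `|f x - f y| <= L * `|x - y|.

Lemma lip_on_cont L f : lip_on L f -> cont_on a b f.
Proof. exact: lipschitz_cont_on. Qed.

Lemma riemann_error L B f m : 0 <= L -> 0 <= B -> lip_on L f ->
  (forall x, a <= x <= b -> `|f x| <= B) ->
  `|quad m f - INT a b f| <= (L * (b - a) + B) * mesh a b m.
Proof.
move=> L0 B0 Lf fB; have h0 := mesh_gt0 m; set h := mesh a b m in h0 *.
have cf := lip_on_cont Lf; have ab_ := ltW ab.
have cell l : (l < m.+1)%N ->
    `|INT (node a b m l) (node a b m l.+1) f - h * f (node a b m l)| <= L * h * h.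
  move=> lm; have h1 := node_in (ltnW lm); have h2 := node_in lm.
  have hl : node a b m l <= node a b m l.+1 by rewrite nodeS lerDl ltW.
  have hl' : node a b m l.+1 - node a b m l = h by rewrite nodeS addrAC subrr add0r.
  have cl : cont_on (node a b m l) (node a b m l.+1) f.
    by apply: cont_on_sub cf; [case/andP: h1|case/andP: h2].
  rewrite mulrC -[X in _ * X]hl' -INT_cst// -INTB//; last exact: cont_on_cst.
  rewrite -[X in _ <= _ * X]hl'; apply: ler_abs_INT => //.
    by apply: cont_onB => //; exact: cont_on_cst.
  move=> x xl; rewrite (le_trans (Lf _ _ _ _))//; first by lra.
  by rewrite ler_wpM2l// ger0_norm; lra.
have split k : (k <= m.+1)%N ->
    INT a (node a b m k) f = \sum_(l < k) INT (node a b m l) (node a b m l.+1) f.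
  elim: k => [|k ih] km; first by rewrite big_ord0 node0 INT_set1.
  have h1 := node_in (ltnW km); have h2 := node_in km.
  have hl : node a b m k <= node a b m k.+1 by rewrite nodeS lerDl ltW.
  rewrite big_ord_recr/= -ih ?(ltnW km)//; apply: INT_split; first by case/andP: h1 => ->.
  by apply: cont_on_sub cf => //; case/andP: h2.
have E : INT a b f - quad m f =
    \sum_(l < m.+1) (INT (node a b m l) (node a b m l.+1) f - h * f (node a b m l)) + h * f a.
  rewrite sumrB -split// node_last -mulr_sumr big_ord_recl/= node0 /quad -/h.
  by ring.
rewrite distrC E (le_trans (ler_normD _ _))// mulrDl lerD//.
  rewrite (le_trans (ler_norm_sum _ _ _))// (@le_trans _ _ (\sum_(l < m.+1) L * h * h))//.
    by apply: ler_sum => l _; exact: cell.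
  by rewrite sumr_const card_ord -mulr_natl mulrA (mulrCA _ L) mesh_sum.
by rewrite normrM (gtr0_norm h0) mulrC; apply: ler_wpM2r; [exact: ltW|rewrite fB// lexx].
Qed.

End Quadrature.

(** * The spectral theorem for real symmetric matrices *)

Section SymmetricSpectral.
Import complex.
Variable R : realType.

Definition rdot n (u v : 'rV[R]_n) : R := \sum_i u 0 i * v 0 i.

Lemma mulmx_rdot n (u v : 'rV[R]_n) : u *m v^T = (rdot u v)%:M.
Proof.
apply/matrixP => i j; rewrite !ord1 !mxE eqxx mulr1n.
by apply: eq_bigr => k _; rewrite mxE.
Qed.

Lemma rdot_eq0 n (u : 'rV[R]_n) : rdot u u = 0 -> u = 0.
Proof.
move=> /eqP; rewrite psumr_eq0 => [/allP H|i _]; last by rewrite -expr2 sqr_ge0.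
apply/rowP => i; rewrite mxE; apply/eqP.
have := H i; rewrite mem_index_enum => /(_ isT).
by rewrite -expr2 sqrf_eq0.
Qed.

(* The Householder reflection exchanging the unit vectors v and e. *)
Lemma householder n (v e : 'rV[R]_n) : rdot v v = 1 -> rdot e e = 1 ->
  exists H : 'M[R]_n, [/\ H^T = H, H *m H = 1%:M & e *m H = v].
Proof.
move=> v1 e1; have [->|ve] := eqVneq v e.
  by exists 1%:M; rewrite !mulmx1 trmx1.
have [w wE] : exists w, w = v - e by exists (v - e).
have [q qE] : exists q, q = rdot w w by exists (rdot w w).
have q0 : q != 0 by apply/eqP; rewrite qE => /rdot_eq0/eqP; rewrite wE subr_eq0 (negbTE ve).
pose H : 'M[R]_n := 1%:M - (2 / q) *: (w^T *m w).
have ww : w *m w^T = q%:M by rewrite mulmx_rdot qE.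
have ew : e *m w^T = (- (q / 2))%:M.
  rewrite mulmx_rdot; congr (_%:M).
  have -> : q = rdot v v + rdot e e - 2 * rdot e v.
    rewrite qE /rdot -big_split/= mulr_sumr -sumrB; apply: eq_bigr => i _.
    by rewrite wE !mxE; ring.
  have -> : rdot e w = rdot e v - rdot e e.
    by rewrite /rdot -sumrB; apply: eq_bigr => i _; rewrite wE !mxE mulrBr.
  by rewrite v1 e1; field.
exists H; split.
- by rewrite /H linearB/= trmx1 linearZ/= trmx_mul trmxK.
- rewrite /H mulmxBl mul1mx -scalemxAl mulmxBr mulmx1 -scalemxAr.
  rewrite mulmxA -(mulmxA w^T) ww mul_mx_scalar -scalemxAl scalerA divfK//.
  rewrite (_ : w^T *m w - 2 *: (w^T *m w) = - (w^T *m w)).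
    by rewrite scalerN opprK subrK.
  by rewrite -[X in X - _]scale1r -scalerBl (_ : 1 - 2 = -1 :> R) ?scaleN1r//; ring.
- rewrite /H mulmxBr mulmx1 -scalemxAr mulmxA ew mul_scalar_mx scalerA.
  have -> : 2 / q * - (q / 2) = -1 by field.
  by rewrite scaleN1r opprK wE addrC subrK.
Qed.

Lemma eigenvector_normed n (D : 'M[R]_n) x : root (char_poly D) x ->
  exists2 v : 'rV[R]_n, rdot v v = 1 & v *m D = x *: v.
Proof.
rewrite -eigenvalue_root_char => /eigenvalueP[v vD v0].
have q0 : 0 < rdot v v.
  rewrite lt_neqAle sumr_ge0 ?andbT => [|i _]; last by rewrite -expr2 sqr_ge0.
  by apply/eqP => /esym/rdot_eq0/eqP; rewrite (negbTE v0).
exists ((Num.sqrt (rdot v v))^-1 *: v); last by rewrite -scalemxAl vD !scalerA mulrC.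
have -> : rdot ((Num.sqrt (rdot v v))^-1 *: v) ((Num.sqrt (rdot v v))^-1 *: v) =
    (Num.sqrt (rdot v v)) ^- 2 * rdot v v.
  rewrite {2 4}/rdot mulr_sumr; apply: eq_bigr => i _.
  by rewrite !mxE -exprVn expr2; ring.
by rewrite sqr_sqrtr ?(ltW q0)// mulVf// gt_eqF.
Qed.

Lemma char_poly_conj (S : comNzRingType) n (P Q A : 'M[S]_n) : Q *m P = 1%:M ->
  char_poly (Q *m A *m P) = char_poly A.
Proof.
move=> QP; pose toP (M : 'M[S]_n) := map_mx (@polyC S) M.
have QPP : toP Q *m toP P = 1%:M by rewrite /toP -map_mxM QP map_mx1.
have dQP : \det (toP Q) * \det (toP P) = 1 by rewrite -det_mulmx QPP det1.
have -> : char_poly (Q *m A *m P) = \det (toP Q *m char_poly_mx A *m toP P).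
  rewrite /char_poly /char_poly_mx mulmxBr mulmxBl mul_mx_scalar.
  by rewrite -scalemxAl QPP scalemx1 /toP -!map_mxM.
by rewrite !det_mulmx mulrAC dQP mul1r.
Qed.

(** Deflation: a reflection carries a unit eigenvector for the head of [s] to the first basis
    vector. By symmetry the conjugate matrix is block diagonal, and its lower block has the
    remaining linear factors. The order of the eigenvalues in [s] is preserved. *)
Lemma symmetric_spectral (s : seq R) (D : 'M[R]_(size s)) : D^T = D ->
  char_poly D = \prod_(x <- s) ('X - x%:P) ->
  exists P : 'M[R]_(size s), P *m P^T = 1%:M /\
    P *m D = diag_mx (\row_i s`_i) *m P.
Proof.
elim: s D => [|x s ih] /= D DT cD.
  by exists 1%:M; split; apply/matrixP => -[].
have rx : root (char_poly D) x by rewrite cD big_cons rootM root_XsubC eqxx.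
have [v v1 vD] := eigenvector_normed rx.
pose e : 'rV[R]_(size s).+1 := delta_mx 0 0.
have e1 : rdot e e = 1.
  rewrite /rdot (bigD1 0)//= big1 => [|i i0]; first by rewrite !mxE eqxx mulr1 addr0.
  by rewrite !mxE (negbTE i0) andbF mulr0.
have [H [HT HH eH]] := householder v1 e1.
have [E EE] : exists E : 'M[R]_(1 + size s), E = H *m D *m H by exists (H *m D *m H).
have ET : E^T = E by rewrite EE !trmx_mul HT DT mulmxA.
have eE : e *m E = x *: e.
  by rewrite EE !mulmxA eH vD -scalemxAl -[X in X *m H]eH -mulmxA HH mulmx1.
have E0 i : E 0 i = x *+ (0 == i).
  have := congr1 (fun M : 'rV_(1 + size s) => M 0 i) eE.
  rewrite -rowE !mxE => ->.
  by rewrite eqxx/= eq_sym mulr_natr.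
pose D' := drsubmx E.
have l0 : lshift (size s) (0 : 'I_1) = 0 :> 'I_(1 + size s) by apply/val_inj.
have EB : E = block_mx x%:M 0 0 D'.
  rewrite -[LHS]submxK; congr block_mx.
  - by apply/matrixP => i j; rewrite !ord1 !mxE !l0 E0 eqxx.
  - by apply/rowP => j; rewrite !mxE !l0 E0 -val_eqE.
  - apply/colP => i; rewrite !mxE !l0.
    have := congr1 (fun M : 'M[R]_(1 + size s) => M (rshift 1 i) 0) ET.
    by rewrite mxE => <-; rewrite E0 -val_eqE.
have D'T : D'^T = D' by rewrite /D' trmx_drsub ET.
have cE : char_poly E = char_poly D.
  by rewrite EE; exact: char_poly_conj.
have cD' : char_poly D' = \prod_(y <- s) ('X - y%:P).
  have : char_poly E = ('X - x%:P) * char_poly D'.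
    rewrite EB /char_poly /char_poly_mx map_block_mx map_scalar_mx/= !map_mx0.
    rewrite (scalar_mx_block 1 (size s) 'X) opp_block_mx add_block_mx !oppr0 !addr0.
    by rewrite det_ublock -rmorphB/= det_scalar1.
  rewrite cE cD big_cons => /(mulfI _) ->//.
  by rewrite polyXsubC_eq0.
have [P' [PP PD]] := ih D' D'T cD'.
exists ((block_mx 1%:M 0 0 P' : 'M[R]_(1 + size s)) *m H); split.
  rewrite trmx_mul HT -mulmxA (mulmxA H) HH mul1mx (@tr_block_mx _ 1 _ 1) trmx1 !trmx0.
  by rewrite (@mulmx_block _ 1 _ 1 _ 1) !mul0mx !mulmx0 !addr0 mul1mx add0r PP -scalar_mx_block.
rewrite -!mulmxA; have -> : H *m D = E *m H by rewrite EE -(mulmxA (H *m D)) HH mulmx1.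
rewrite mulmxA [RHS]mulmxA; congr (_ *m H); rewrite EB.
have -> : diag_mx (\row_i (x :: s)`_i) =
   block_mx x%:M 0 0 (diag_mx (\row_i s`_i)) :> 'M[R]_(1 + size s).
  rewrite -diag_const_mx -diag_mx_row; congr diag_mx.
  apply/rowP => i; rewrite !mxE; case: fintype.splitP => j ij; rewrite !mxE ij ?ord1//.
rewrite !(@mulmx_block _ 1 _ 1 _ 1) !mul0mx !mulmx0 !addr0 !add0r mul1mx mulmx1.
by rewrite PD.
Qed.

(* Splitting over R: the complex eigenvalues of a symmetric matrix are real. *)
Lemma symmetric_char_poly_split n (D : 'M[R]_n) : D^T = D ->
  exists s : seq R, size s = n /\ char_poly D = \prod_(x <- s) ('X - x%:P).
Proof.
move=> DT; pose A := map_mx (real_complex R) D.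
have Ah : A \is hermsymmx.
  apply/is_hermitianmxP; rewrite expr0 scale1r; apply/matrixP => i j.
  rewrite !mxE -[in RHS]DT mxE.
  by apply/esym/CrealP; rewrite complex_real.
have [An Ar] := (hermitian_normalmx Ah, hermitian_spectral_diag_real Ah).
have /orthomx_spectralP AE := An.
pose sp := spectral_diag A.
have cA : char_poly A = \prod_(i < n) ('X - (sp 0 i)%:P).
  rewrite {1}AE char_poly_conj; last by rewrite mulVmx// unitarymx_unit// spectral_unitarymx.
  rewrite char_poly_trig; last exact: diag_mx_is_trig.
  by apply: eq_bigr => i _; rewrite mxE eqxx mulr1n.
pose s := [seq complex.Re (sp 0 i) | i <- enum 'I_n].
exists s; split; first by rewrite size_map size_enum_ord.
apply: (@map_poly_inj _ _ (real_complex R)).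
rewrite map_char_poly -/A cA rmorph_prod/= big_map big_enum/=.
apply: eq_bigr => i _; rewrite rmorphB/= map_polyX map_polyC/=.
congr (_ - _%:P); rewrite RRe_real//.
by have /mxOverP := Ar; exact.
Qed.

End SymmetricSpectral.

(** * Consequences in finite dimension *)

Section FiniteSpectral.
Variable R : realType.

Lemma symmetric_spectral_size n (s : seq R) (D : 'M[R]_n) : size s = n -> D^T = D ->
  char_poly D = \prod_(x <- s) ('X - x%:P) ->
  exists P : 'M[R]_n, P *m P^T = 1%:M /\ P *m D = diag_mx (\row_i s`_i) *m P.
Proof. by move=> sn; case: n / sn D => D; exact: symmetric_spectral. Qed.

(** The dimension count behind every Courant-Fischer and width argument below. *)
Lemma nontrivial_solution k (A : 'I_k.+1 -> 'I_k -> R) : exists c : 'I_k.+1 -> R,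
  (exists i, c i != 0) /\ forall j, \sum_i c i * A i j = 0.
Proof.
pose M := \matrix_(i, j) A i j.
have : kermx M != 0.
  rewrite -mxrank_eq0 mxrank_ker -lt0n subn_gt0.
  exact: leq_ltn_trans (rank_leq_col _) _.
case/rowV0Pn => v /sub_kermxP vM v0.
exists (fun i => v 0 i); split.
  apply/existsP; apply: contra_neqT v0 => /existsPn H.
  by apply/rowP => i; rewrite mxE; apply/eqP; have := H i; rewrite negbK.
move=> j; have := congr1 (fun B : 'rV_k => B 0 j) vM; rewrite !mxE => H.
by rewrite -[RHS]H; apply: eq_bigr => i _; rewrite ?mxE.
Qed.

End FiniteSpectral.

(** * Limits along ultrafilters *)

Section UltraLimits.
Variable R : realType.
Variables a b : R.
Hypothesis ab : a < b.
Implicit Types (x y L B M C : R) (f g : nat -> R) (F G : R -> R).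

Lemma fmap_ultra (T : Type) (f : nat -> T) (U : set_system nat) :
  UltraFilter U -> UltraFilter (f @ U).
Proof.
move=> uU; split; first exact: fmap_proper_filter.
move=> G pG UG; apply/seteqP; split=> // A GA.
have [//|UnA] := in_ultra_setVsetC (f @^-1` A) uU.
have GnA : G (~` A) by exact: UG.
by have [x []] := filter_ex (filterI GA GnA).
Qed.

(** Compactness of a segment. One ultrafilter serves all bounded sequences at once, in place of
    diagonal extraction of subsequences. *)
Lemma ultra_cvg (U : set_system nat) f B : UltraFilter U ->
  U [set m | `|f m| <= B] -> exists l : R, f m @[m --> U] --> l.
Proof.
move=> uU fB; have pU : ProperFilter U by exact: ultra_proper.
have uf : UltraFilter (f @ U) := fmap_ultra f uU.
have fU : (f @ U) `[- B, B]%classic.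
  by apply: filterS fB => m h; rewrite /= in_itv/= -ler_norml; exact: h.
have := @segment_compact R (- B) B; rewrite compact_ultra.
by move=> /(_ (f @ U) uf fU)[l [_ fl]]; exists l.
Qed.

(* A sequence converges as soon as every ultrafilter sees the same limit. *)
Lemma ultra_cvg_oo f (l : R) : (forall U : set_system nat, UltraFilter U -> \oo `<=` U ->
  f m @[m --> U] --> l) -> f m @[m --> \oo] --> l.
Proof.
move=> H; apply: contrapT => nf.
have [e e0 ne] : exists2 e, 0 < e & ~ (\forall m \near \oo, `|l - f m| <= e).
  apply: contrapT => /forall2NP He; apply: nf; apply/cvgrPdist_le => e e0.
  by case: (He e) => [/(_ e0)[]|/contrapT].
(* The trace of \oo on the indices where [f] stays away from the limit is proper by [ne]; an
   ultrafilter finer than it contradicts [H]. *)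
pose F := within [set m | ~ (`|l - f m| <= e)] \oo.
have pF : ProperFilter F.
  apply: Build_ProperFilter_ex => P; rewrite /F /within /= => FP.
  apply: contrapT => nP; apply: ne; apply: filterS FP => m Hm.
  by apply: contrapT => /Hm Pm; apply: nP; exists m.
have [U [uU FU]] := ultraFilterLemma pF.
have ooU : \oo `<=` U.
  by move=> A Am; apply: FU; rewrite /F /within/=; apply: filterS Am.
have pU : ProperFilter U by exact: ultra_proper.
have /cvgrPdist_le/(_ e e0) h1 := H U uU ooU.
have h2 : U [set m | ~ (`|l - f m| <= e)] by apply: FU; exact: withinT.
by have [m [m1 m2]] := filter_ex (filterI h1 h2).
Qed.

Lemma cvg_sum (T : Type) (U : set_system T) (I : Type) (s : seq I) (P : pred I)
    (f : I -> T -> R) (l : I -> R) : Filter U ->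
  (forall i, P i -> f i x @[x --> U] --> l i) ->
  (\sum_(i <- s | P i) f i x) @[x --> U] --> \sum_(i <- s | P i) l i.
Proof.
move=> fU fl; elim: s => [|i s ih].
  rewrite big_nil; under eq_cvg do rewrite big_nil; exact: cvg_cst.
rewrite big_cons; under eq_cvg do rewrite big_cons.
by case: ifPn => Pi //; apply: cvgD => //; exact: fl.
Qed.

Lemma lip_onW L M F : L <= M -> lip_on a b L F -> lip_on a b M F.
Proof.
by move=> LM lF x y axb ayb; rewrite (le_trans (lF _ _ axb ayb))// ler_wpM2r.
Qed.

Lemma lip_onM L M B C F G : lip_on a b L F -> lip_on a b M G ->
  (forall x, a <= x <= b -> `|F x| <= B) -> (forall x, a <= x <= b -> `|G x| <= C) ->
  lip_on a b (B * M + C * L) (fun x => F x * G x).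
Proof.
move=> lF lG FB GC x y axb ayb.
have -> : F x * G x - F y * G y = F x * (G x - G y) + G y * (F x - F y) by ring.
rewrite (le_trans (ler_normD _ _))// mulrDl lerD// normrM -mulrA ler_pM//.
- exact: FB.
- exact: lG.
- exact: GC.
- exact: lF.
Qed.

(** The rule converges to the integral uniformly on functions with common Lipschitz and sup bounds.
    So rule m applied to [f m] is compared with rule p for one fixed fine p, a finite sum that
    passes to the limit termwise; each of the four errors is at most e / 4. *)
Lemma ultra_quad (U : set_system nat) L B (f : nat -> R -> R) F :
  UltraFilter U -> \oo `<=` U -> 0 <= L -> 0 <= B ->
  U [set m | lip_on a b L (f m) /\ forall x, a <= x <= b -> `|f m x| <= B] ->
  (forall x, a <= x <= b -> f m x @[m --> U] --> F x) ->
  [/\ lip_on a b L F, forall x, a <= x <= b -> `|F x| <= B &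
      quad a b m (f m) @[m --> U] --> INT a b F].
Proof.
move=> uU ooU L0 B0 UfLB fF; have pU : ProperFilter U by exact: ultra_proper.
have lF : lip_on a b L F.
  move=> x y axb ayb.
  have cd : `|f m x - f m y| @[m --> U] --> `|F x - F y|.
    by apply: cvg_norm; apply: cvgB; exact: fF.
  apply: (cvgr_to_le cd).
  by apply: filterS UfLB => m [lf _]; exact: lf.
have FB x : a <= x <= b -> `|F x| <= B.
  move=> axb; have cd : `|f m x| @[m --> U] --> `|F x| by apply: cvg_norm; exact: fF.
  apply: (cvgr_to_le cd).
  by apply: filterS UfLB => m [_]; exact.
split=> //; apply/cvgrPdist_le => e e0.
pose c := L * (b - a) + B + 1.
have c0 : 0 < c by rewrite ltr_wpDl// addr_ge0// mulr_ge0// subr_ge0 ltW.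
pose d := e / (4 * c).
have d0 : 0 < d by rewrite divr_gt0// mulr_gt0.
have mesh_small : \forall m \near \oo, mesh a b m <= d.
  near=> m; rewrite /mesh ler_pdivrMr// -ler_pdivrMl// mulrC.
  rewrite (@le_trans _ _ m%:R)//; last by rewrite ler_nat.
  by near: m; exact: nbhs_infty_ger.
have err m G : lip_on a b L G -> (forall x, a <= x <= b -> `|G x| <= B) ->
    mesh a b m <= d -> `|quad a b m G - INT a b G| <= e / 4.
  move=> lG GB md; rewrite (le_trans (riemann_error ab m L0 B0 lG GB))//.
  have <- : c * d = e / 4 by rewrite /d; move: (c) (c0) => t t0; field; rewrite gt_eqF.
  rewrite ler_pM//; first by rewrite addr_ge0// mulr_ge0// subr_ge0 ltW.
    exact/ltW/mesh_gt0.
  by rewrite /c lerDl.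
have [p Hp] := filter_ex mesh_small.
have cp : quad a b p (f m) @[m --> U] --> quad a b p F.
  rewrite /quad; apply: cvgM; [exact: cvg_cst|apply: cvg_sum => l _; apply: fF].
  by apply: node_in => //; rewrite ltnS; exact: ltnW.
have e4 : 0 < e / 4 by rewrite divr_gt0.
have H1 := ooU _ mesh_small.
have /cvgrPdist_le/(_ _ e4) H2 := cp.
apply: (filterS _ (filterI (filterI H1 H2) UfLB)) => m [[h1 h2] [lf fB]].
have E1 := err m _ lf fB h1; have E2 := err p _ lf fB Hp; have E3 := err p _ lF FB Hp.
move: E1 E2 E3 h2; rewrite /= !ler_norml.
move: (quad a b m (f m)) (quad a b p (f m)) (quad a b p F) (INT a b F) (INT a b (f m)).
by move=> q1 q2 q3 I1 I2; lra.
Unshelve. all: by end_near. Qed.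

End UltraLimits.

(** * Discrete eigenvectors and their Nystrom extensions *)

Section Nystrom.
Variable R : realType.
Variables a b : R.
Hypothesis ab : a < b.
Variables (K : R -> R -> R) (L B : R).
Hypothesis L0 : 0 <= L.
Hypothesis B0 : 0 <= B.
Hypothesis Ksym : forall x y, a <= x <= b -> a <= y <= b -> K x y = K y x.
Hypothesis Klip : forall y, a <= y <= b -> lip_on a b L (K^~ y).
Hypothesis KB : forall x y, a <= x <= b -> a <= y <= b -> `|K x y| <= B.
Implicit Types (x y c : R) (m : nat) (mu : nat -> R) (u v : nat -> R) (W : nat -> nat -> R).
Local Notation nd := (node a b).
Local Notation h := (mesh a b).

Definition dip m u v : R := h m * \sum_(l < m) u l * v l.

Definition dapp m u (i : nat) : R :=
  h m * \sum_(l < m) K (nd m i.+1) (nd m l.+1) * u l.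

(** An eigenbasis orthonormal for the discrete L^2 product [dip]; the last clause, Parseval's
    identity, expresses completeness. Vectors are functions on nat whose index l stands for node
    l+1, and [mu] is indexed from 1. *)
Definition dspec m mu W := [/\
  forall i j, (i < m)%N -> (j < m)%N -> dip m (W i) (W j) = (i == j)%:R,
  forall i j, (i < m)%N -> (j < m)%N -> dapp m (W j) i = mu j.+1 * W j i &
  forall u v, dip m u v = \sum_(j < m) dip m u (W j) * dip m v (W j)].

Lemma node_ord m (l : 'I_m) : a <= nd m l.+1 <= b.
Proof. by apply: (node_in ab); rewrite ltnS ltnW. Qed.

Lemma discrete_matrix_sym m : (discrete_matrix a b K m)^T = discrete_matrix a b K m.
Proof. by apply/matrixP => i j; rewrite !mxE Ksym//; exact: node_ord. Qed.

Lemma dspec_exists m mu : discrete_eigenvalues a b K m mu -> exists W, dspec m mu W.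
Proof.
move=> [cD _]; pose s := [seq mu k | k <- index_iota 1 m.+1].
have ss : size s = m by rewrite size_map size_iota subn1.
have sE (i : 'I_m) : s`_i = mu i.+1.
  by rewrite (nth_map 0%N) ?size_iota ?subn1// nth_iota ?subn1// add1n.
have cDs : char_poly (discrete_matrix a b K m) = \prod_(x <- s) ('X - x%:P).
  by rewrite cD /s big_map.
have [P [PP PD]] := symmetric_spectral_size ss (discrete_matrix_sym m) cDs.
have PP' : P^T *m P = 1%:M by exact: mulmx1C.
(* The rows of [P] are unit vectors for the Euclidean product; this factor makes them unit vectors
   for [dip], which carries the weight h. *)
pose c := (Num.sqrt (h m))^-1.
have hm := mesh_gt0 ab m.
have cc : h m * (c * c) = 1.
  by rewrite /c -invfM -expr2 sqr_sqrtr ?(ltW hm)// mulfV// gt_eqF.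
pose e (j l : nat) := oapp (fun j' : 'I_m => oapp (fun l' : 'I_m => P j' l') 0 (insub l)) 0 (insub j).
have eE (j l : 'I_m) : e j l = P j l by rewrite /e !valK.
exists (fun j l => c * e j l); split.
- move=> i j im jm; rewrite /dip.
  under eq_bigr => l _ do
    rewrite (eE (Ordinal im)) (eE (Ordinal jm)) mulrACA.
  rewrite -mulr_sumr mulrA cc mul1r.
  have := congr1 (fun M : 'M[R]_m => M (Ordinal im) (Ordinal jm)) PP; rewrite !mxE.
  by under eq_bigr do rewrite mxE; move=> ->.
- move=> i j im jm; rewrite /dapp.
  have := congr1 (fun M : 'M[R]_m => M (Ordinal jm) (Ordinal im)) PD.
  rewrite mul_diag_mx !mxE sE /= (eE (Ordinal jm) (Ordinal im)) => E.
  rewrite mulrCA -E !mulr_sumr; apply: eq_bigr => l _.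
  rewrite (eE (Ordinal jm)) mxE (@Ksym (nd m i.+1)); [|exact: (node_ord (Ordinal im))|exact: node_ord].
  by ring.
- move=> u v; pose ru (t : nat -> R) := \row_(l < m) t l : 'rV[R]_m.
  have H t (j : 'I_m) : dip m t (fun l => c * e j l) = h m * c * (ru t *m P^T) 0 j.
    rewrite /dip mxE -mulrA; congr (_ * _); rewrite mulr_sumr; apply: eq_bigr => l _.
    by rewrite eE !mxE; ring.
  under eq_bigr => j _ do rewrite !H mulrACA.
  rewrite -mulr_sumr (_ : h m * c * (h m * c) = h m); last first.
    by rewrite mulrACA -mulrA cc mulr1.
  rewrite /dip; congr (_ * _).
  have E : (ru u *m P^T) *m (ru v *m P^T)^T = ru u *m (ru v)^T.
    by rewrite trmx_mul trmxK mulmxA -(mulmxA (ru u)) PP' mulmx1.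
  have := congr1 (fun M : 'M[R]_1 => M 0 0) E; rewrite !mxE => E'.
  transitivity (\sum_j ru u 0 j * (ru v)^T j 0); first by apply: eq_bigr => j _; rewrite !mxE.
  by rewrite -E'; apply: eq_bigr => j _; rewrite [(_ ^T) j 0]mxE.
Qed.

Lemma discrete_eigenvalues_exist m : exists mu, discrete_eigenvalues a b K m mu.
Proof.
have [s [ss sE]] := symmetric_char_poly_split (discrete_matrix_sym m).
pose s' := sort >=%R s; exists (fun k => s'`_k.-1); split.
  rewrite sE (perm_big s') /=; last by rewrite perm_sym perm_sort.
  rewrite (big_nth 0) size_sort ss.
  by rewrite big_add1/=; apply: eq_big_nat => i _.
move=> j k j0 jk km.
have ss' : sorted >=%R s' by apply: sort_sorted; exact: ge_total.
apply: (sorted_leq_nth _ _ 0 ss'); rewrite ?inE ?size_sort ?ss.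
- by move=> ? ? ? h1 h2; exact: le_trans h2 h1.
- by move=> ?; exact: lexx.
- by lia.
- by lia.
- by lia.
Qed.

Section DSpec.
Variables (m : nat) (mu : nat -> R) (W : nat -> nat -> R).
Hypothesis HW : dspec m mu W.

Lemma dip_dapp u j : (j < m)%N -> dip m (dapp m u) (W j) = mu j.+1 * dip m u (W j).
Proof.
move=> jm; have [_ eW _] := HW.
transitivity (h m * \sum_(l < m) u l * dapp m (W j) l).
  rewrite /dip /dapp; congr (_ * _).
  under eq_bigr => i _ do rewrite -mulrA mulr_suml mulr_sumr.
  under [RHS]eq_bigr => i _ do rewrite mulrCA mulr_sumr mulr_sumr.
  rewrite exchange_big/=; apply: eq_bigr => l _; apply: eq_bigr => i _.
  by rewrite (@Ksym (nd m i.+1)); [ring|exact: node_ord..].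
rewrite /dip mulrCA; congr (_ * _); rewrite mulr_sumr; apply: eq_bigr => l _.
by rewrite eW//; ring.
Qed.

Lemma dip_dappE u v : dip m (dapp m u) v =
  \sum_(j < m) mu j.+1 * (dip m u (W j) * dip m v (W j)).
Proof.
have [_ _ pW] := HW; rewrite pW; apply: eq_bigr => j _.
by rewrite dip_dapp// mulrA.
Qed.

(** Bounds the discrete L^1 norm of a unit vector, uniformly in m. *)
Definition mean_bound : R := (b - a + 1) / 2.

Lemma mean_bound_ge0 : 0 <= mean_bound.
Proof. by have ab_ := ab; rewrite /mean_bound; lra. Qed.

(* |w| <= (1 + w^2) / 2 *)
Lemma mean_abs_W j : (j < m)%N -> h m * \sum_(l < m) `|W j l| <= mean_bound.
Proof.
move=> jm; have [oW _ _] := HW; have := oW j j jm jm; rewrite eqxx /dip => W1.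
have hm := mesh_gt0 ab m.
have : h m * \sum_(l < m) `|W j l| <= h m * \sum_(l < m) (2^-1 + 2^-1 * (W j l * W j l)).
  rewrite ler_wpM2l ?(ltW hm)//; apply: ler_sum => l _.
  have : `|W j l| * `|W j l| = W j l * W j l.
    by rewrite -normrM ger0_norm// -expr2 sqr_ge0.
  by have := sqr_ge0 (`|W j l| - 1); rewrite expr2; nra.
rewrite big_split/= -mulr_sumr sumr_const card_ord mulrDr (mulrCA _ 2^-1) W1 => H.
rewrite (le_trans H)// /mean_bound.
have hb : m%:R * h m <= b - a by rewrite -(mesh_sum a b m) ler_wpM2r ?(ltW hm)// ler_nat.
have -> : h m * (2^-1 *+ m) = (m%:R * h m) / 2 by rewrite -mulr_natr; ring.
by rewrite mulr1; lra.
Qed.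

Lemma abs_dip_W c j u : (j < m)%N -> 0 <= c -> (forall l : 'I_m, `|u l| <= c) ->
  `|dip m u (W j)| <= c * mean_bound.
Proof.
move=> jm c0 uc; have hm := mesh_gt0 ab m.
rewrite /dip normrM (gtr0_norm hm).
rewrite (@le_trans _ _ (h m * (c * \sum_(l < m) `|W j l|)))//.
  rewrite ler_wpM2l ?(ltW hm)// (le_trans (ler_norm_sum _ _ _))// mulr_sumr.
  by apply: ler_sum => l _; rewrite normrM ler_wpM2r.
by rewrite mulrCA ler_wpM2l// mean_abs_W.
Qed.

Lemma abs_mu j : (j < m)%N -> `|mu j.+1| <= B * mean_bound ^+ 2.
Proof.
move=> jm; have [oW eW _] := HW.
have -> : mu j.+1 = dip m (dapp m (W j)) (W j) by rewrite dip_dapp// oW// eqxx mulr1.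
rewrite expr2 mulrA; apply: abs_dip_W => //; first by rewrite mulr_ge0// mean_bound_ge0.
move=> i; apply: (@abs_dip_W B j (fun l => K (nd m i.+1) (nd m l.+1))) => // l.
by apply: KB; exact: node_ord.
Qed.

(** The discrete eigenvector extended to all x through the kernel. As long as its eigenvalue stays
    away from 0, it agrees with [W j] at the nodes and inherits Lipschitz and sup bounds from [K],
    uniformly in m, which provides the compactness for the limit. *)
Definition nystrom j x : R :=
  (mu j.+1)^-1 * dip m (fun l => K x (nd m l.+1)) (W j).

Lemma nystrom_lip j c : (j < m)%N -> 0 < c -> c <= mu j.+1 ->
  lip_on a b (c^-1 * (L * mean_bound)) (nystrom j).
Proof.
move=> jm c0 cmu x y axb ayb; rewrite /nystrom -mulrBr normrM -mulrA.
have -> : dip m (fun l => K x (nd m l.+1)) (W j) - dip m (fun l => K y (nd m l.+1)) (W j) =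
    dip m (fun l => K x (nd m l.+1) - K y (nd m l.+1)) (W j).
  rewrite /dip -mulrBr -sumrB; congr (_ * _); apply: eq_bigr => l _; ring.
apply: ler_pM => //.
  rewrite normfV lef_pV2 ?posrE ?normr_gt0 ?gt_eqF//; last exact: lt_le_trans cmu.
  by rewrite (le_trans cmu)// ler_norm.
rewrite mulrAC; apply: abs_dip_W => //; first by rewrite mulr_ge0.
by move=> l; apply: Klip => //; exact: node_ord.
Qed.

Lemma nystrom_bounded j c x : (j < m)%N -> 0 < c -> c <= mu j.+1 -> a <= x <= b ->
  `|nystrom j x| <= c^-1 * (B * mean_bound).
Proof.
move=> jm c0 cmu axb; rewrite /nystrom normrM; apply: ler_pM => //.
  rewrite normfV lef_pV2 ?posrE ?normr_gt0 ?gt_eqF//; last exact: lt_le_trans cmu.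
  by rewrite (le_trans cmu)// ler_norm.
by apply: abs_dip_W => // l; apply: KB => //; exact: node_ord.
Qed.

Lemma nystrom_node i j : (i < m)%N -> (j < m)%N -> mu j.+1 != 0 ->
  nystrom j (nd m i.+1) = W j i.
Proof.
by move=> im jm mu0; have [_ eW _] := HW; rewrite /nystrom (_ : dip _ _ _ = dapp m (W j) i)// eW// mulKf.
Qed.

End DSpec.
End Nystrom.

(** * Passage to the limit in the discrete spectral problem *)

Section Limits.
Variable R : realType.
Variables a b : R.
Hypothesis ab : a < b.
Variables (K : R -> R -> R) (L B : R).
Hypothesis L0 : 0 <= L.
Hypothesis B0 : 0 <= B.
Hypothesis Ksym : forall x y, a <= x <= b -> a <= y <= b -> K x y = K y x.
Hypothesis Klip : forall y, a <= y <= b -> lip_on a b L (K^~ y).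
Hypothesis KB : forall x y, a <= x <= b -> a <= y <= b -> `|K x y| <= B.
Implicit Types (x y c M : R) (m : nat) (w F G phi : R -> R) (f g : nat -> R -> R).

Definition kop phi x : R := INT a b (fun y => K x y * phi y).

(** A Courant-Fischer system, indexed from 0. The last clause is the maximum principle: [lam k]
    bounds the Rayleigh quotient on Lipschitz functions orthogonal to the first k eigenfunctions. It
    survives the limit from the discrete problem and is strong enough to determine [lam]. *)
Definition cfs (lam : nat -> R) (phi : nat -> R -> R) := [/\
  forall k, 0 < lam k,
  forall k, lam k.+1 <= lam k,
  forall k, exists2 M, 0 <= M & lip_on a b M (phi k),
  forall i j, INT a b (fun x => phi i x * phi j x) = (i == j)%:R &
  (forall k x, a <= x <= b -> kop (phi k) x = lam k * phi k x) /\
  (forall k w M, 0 <= M -> lip_on a b M w ->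
     (forall j, (j < k)%N -> INT a b (fun x => w x * phi j x) = 0) ->
     INT a b (fun x => w x * kop w x) <= lam k * INT a b (fun x => w x * w x))].

Lemma lip_bounded M F : 0 <= M -> lip_on a b M F ->
  exists2 C, 0 <= C & forall x, a <= x <= b -> `|F x| <= C.
Proof. by move=> M0 lF; apply: cont_on_bounded (lip_on_cont lF); exact: ltW. Qed.

Lemma Klipr x : a <= x <= b -> lip_on a b L (K x).
Proof. by move=> axb y z ayb azb; rewrite !(Ksym axb)//; exact: Klip. Qed.

Lemma quad_le m F M : 0 <= M -> (forall x, a <= x <= b -> `|F x| <= M) ->
  `|quad a b m F| <= M * (b - a).
Proof.
move=> M0 FM; have hm := mesh_gt0 ab m; rewrite /quad normrM (gtr0_norm hm).
rewrite (@le_trans _ _ (mesh a b m * (m%:R * M)))//.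
  rewrite ler_wpM2l ?(ltW hm)// (le_trans (ler_norm_sum _ _ _))//.
  rewrite mulr_natl -[in leRHS](card_ord m) -sumr_const; apply: ler_sum => l _.
  by apply: FM; exact: node_ord.
rewrite mulrA (mulrC _ M) ler_wpM2l// mulrC -(mesh_sum a b m).
by rewrite ler_wpM2r ?(ltW hm)// ler_nat.
Qed.

Section Ultra.
Variable U : set_system nat.
Hypothesis uU : UltraFilter U.
Hypothesis ooU : \oo `<=` U.

Let pU : ProperFilter U.
Proof. exact: ultra_proper. Qed.

(** Pointwise convergence along [U] with uniform Lipschitz and sup bounds: enough for quadratures to
    converge to integrals, and stable under products and under the operator. *)
Definition ulim f F := exists M C, [/\ 0 <= M, 0 <= C,
  U [set m | lip_on a b M (f m) /\ forall x, a <= x <= b -> `|f m x| <= C] &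
  forall x, a <= x <= b -> f m x @[m --> U] --> F x].

Lemma ulim_quad f F : ulim f F -> quad a b m (f m) @[m --> U] --> INT a b F.
Proof. by move=> [M [C [M0 C0 UMC fF]]]; case: (ultra_quad ab uU ooU M0 C0 UMC fF). Qed.

Lemma ulim_lip f F : ulim f F -> exists2 M, 0 <= M & lip_on a b M F.
Proof.
move=> [M [C [M0 C0 UMC fF]]]; exists M => //.
by case: (ultra_quad ab uU ooU M0 C0 UMC fF).
Qed.

Lemma ulim_cst M F : 0 <= M -> lip_on a b M F -> ulim (fun=> F) F.
Proof.
move=> M0 lF; have [C C0 HC] := lip_bounded M0 lF.
exists M, C; split=> //; first by apply: filterE => m; split.
by move=> x _; exact: cvg_cst.
Qed.

Lemma ulimM f g F G : ulim f F -> ulim g G ->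
  ulim (fun m x => f m x * g m x) (fun x => F x * G x).
Proof.
move=> [M1 [C1 [M10 C10 U1 f1]]] [M2 [C2 [M20 C20 U2 f2]]].
exists (C1 * M2 + C2 * M1), (C1 * C2); split.
- by rewrite addr_ge0// mulr_ge0.
- exact: mulr_ge0.
- apply: (filterS _ (filterI U1 U2)) => m [[l1 b1] [l2 b2]]; split.
    exact: lip_onM.
  by move=> x axb; rewrite normrM ler_pM// ?b1 ?b2.
- by move=> x axb; apply: cvgM; [exact: f1|exact: f2].
Qed.

Lemma ulim_K x : a <= x <= b -> ulim (fun=> K x) (K x).
Proof. by move=> axb; apply: (ulim_cst L0); exact: Klipr. Qed.

Lemma ulim_kop f F : ulim f F ->
  ulim (fun m x => quad a b m (fun y => K x y * f m y)) (kop F).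
Proof.
move=> uf; have [M [C [M0 C0 UMC fF]]] := uf.
have ba : 0 <= b - a by rewrite subr_ge0 ltW.
exists (L * C * (b - a)), (B * C * (b - a)); split.
- by rewrite !mulr_ge0.
- by rewrite !mulr_ge0.
- apply: filterS UMC => m [lf fC]; split.
    move=> x y axb ayb.
    have -> : quad a b m (fun z => K x z * f m z) - quad a b m (fun z => K y z * f m z) =
        quad a b m (fun z => (K x z - K y z) * f m z).
      by rewrite /quad -mulrBr -sumrB; congr (_ * _); apply: eq_bigr => l _; ring.
    rewrite -mulrA (mulrC (b - a)) mulrA; apply: quad_le; first by rewrite !mulr_ge0.
    move=> z azb; rewrite normrM (mulrAC L); apply: ler_pM => //; last exact: fC.
    exact: Klip.
  move=> x axb; apply: quad_le; first by rewrite mulr_ge0.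
  by move=> y ayb; rewrite normrM ler_pM// ?KB ?fC.
- move=> x axb; apply: (@ulim_quad (fun m y => K x y * f m y)).
  exact: ulimM (ulim_K axb) uf.
Qed.

Variables (mus : nat -> nat -> R) (Ws : nat -> nat -> nat -> R).
Hypothesis Hmu : forall m, discrete_eigenvalues a b K m (mus m).
Hypothesis HW : forall m, dspec a b K m (mus m) (Ws m).
Variable lam : nat -> R.
Hypothesis Hlam : forall j, mus m j.+1 @[m --> U] --> lam j.
Variable phi : nat -> R -> R.
Local Notation nys m j := (nystrom a b K m (mus m) (Ws m) j).
Hypothesis Hphi : forall j, 0 < lam j -> forall x, a <= x <= b ->
  nys m j x @[m --> U] --> phi j x.

Lemma U_gt j : U [set m | (j < m)%N].
Proof. by apply: ooU; exact: nbhs_infty_gt. Qed.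

Lemma U_mu j : 0 < lam j -> U [set m | lam j / 2 <= mus m j.+1 /\ (j < m)%N].
Proof.
move=> lj; apply: filterI (U_gt j).
have l2 : lam j / 2 < lam j by lra.
exact: (cvgr_ge _ (@Hlam j) _ l2).
Qed.

Lemma ulim_nys j : 0 < lam j -> ulim (fun m => nys m j) (phi j).
Proof.
move=> lj; have l2 : 0 < lam j / 2 by lra.
have mb := mean_bound_ge0 ab.
exists ((lam j / 2)^-1 * (L * mean_bound a b)), ((lam j / 2)^-1 * (B * mean_bound a b)).
split.
- by apply: mulr_ge0; [rewrite invr_ge0 ltW|exact: mulr_ge0].
- by apply: mulr_ge0; [rewrite invr_ge0 ltW|exact: mulr_ge0].
- apply: filterS (U_mu lj) => m [lm jm]; split.
    exact: (nystrom_lip ab L0 Klip (HW m)).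
  by move=> x axb; exact: (nystrom_bounded ab B0 KB (HW m)).
- exact: Hphi.
Qed.

Lemma quad_nys m j w : (j < m)%N -> mus m j.+1 != 0 ->
  quad a b m (fun x => w x * nys m j x) =
  dip a b m (fun l => w (node a b m l.+1)) (Ws m j).
Proof.
move=> jm mu0; rewrite /quad /dip; congr (_ * _); apply: eq_bigr => l _.
by rewrite (nystrom_node (HW m)).
Qed.

Lemma limit_orthonormal i j : 0 < lam i -> 0 < lam j ->
  INT a b (fun x => phi i x * phi j x) = (i == j)%:R.
Proof.
move=> li lj; have H := ulim_quad (ulimM (ulim_nys li) (ulim_nys lj)).
apply: (cvg_unique _ H) => //.
apply: cvg_near_cst; apply: (filterS _ (filterI (U_mu li) (U_mu lj))).
move=> m [[mi im] [mj jm]].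
have mi0 : mus m i.+1 != 0 by rewrite gt_eqF//; lra.
have mj0 : mus m j.+1 != 0 by rewrite gt_eqF//; lra.
rewrite quad_nys//; have [oW _ _] := HW m; rewrite -(oW i j im jm).
by rewrite /dip; congr (_ * _); apply: eq_bigr => l _; rewrite (nystrom_node (HW m)).
Qed.

Lemma limit_eigen j x : 0 < lam j -> a <= x <= b -> kop (phi j) x = lam j * phi j x.
Proof.
move=> lj axb; have H := ulim_quad (ulimM (ulim_K axb) (ulim_nys lj)).
apply: (cvg_unique _ H) => //.
have H2 : mus m j.+1 * nys m j x @[m --> U] --> lam j * phi j x.
  by apply: cvgM; [exact: Hlam|exact: Hphi].
apply: cvg_trans H2; apply: near_eq_cvg.
apply: filterS (U_mu lj) => m [mj jm].
have mj0 : mus m j.+1 != 0 by rewrite gt_eqF//; lra.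
by rewrite quad_nys// /nystrom mulVKf.
Qed.

(** Expand in the eigenbasis and bound the eigenvalues of rank above k by the one of rank k+1. The
    first sum measures the defect of orthogonality of w to the first k eigenvectors; it disappears
    in the limit. *)
Lemma quad_form_le m k w : (k < m)%N ->
  (forall j, (j < k)%N -> mus m j.+1 != 0) ->
  quad a b m (fun x => w x * quad a b m (fun y => K x y * w y)) <=
  \sum_(j < k) (mus m j.+1 - mus m k.+1) * quad a b m (fun x => w x * nys m j x) ^+ 2 +
  mus m k.+1 * quad a b m (fun x => w x * w x).
Proof.
move=> km mu0; pose u l := w (node a b m l.+1).
have -> : quad a b m (fun x => w x * quad a b m (fun y => K x y * w y)) =
    dip a b m (dapp a b K m u) u.
  by rewrite /quad /dip; congr (_ * _); apply: eq_bigr => l _; rewrite mulrC.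
rewrite (dip_dappE ab Ksym (HW m)).
have -> : quad a b m (fun x => w x * w x) = dip a b m u u by [].
have [_ _ pW] := HW m; rewrite [X in _ + _ * X]pW mulr_sumr.
pose d j := dip a b m u (Ws m j).
under [X in _ <= X + _]eq_bigr => j _ do
  rewrite quad_nys ?(ltn_trans (ltn_ord j))// ?mu0// -/u -/(d j).
rewrite -subr_ge0 -addrA -sumrB.
rewrite -(big_mkord xpredT (fun j => mus m k.+1 * (d j * d j) - mus m j.+1 * (d j * d j))).
rewrite (big_cat_nat _ (ltnW km))//= big_mkord addrA -big_split/=.
rewrite big1 ?add0r => [|j _]; last by ring.
rewrite big_nat_cond sumr_ge0// => j /andP[/andP[kj jm] _].
rewrite -mulrBl mulr_ge0// -?expr2 ?sqr_ge0// subr_ge0.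
by have [_ mono] := Hmu m; apply: mono.
Qed.

Lemma limit_form_le k w M : 0 <= M -> lip_on a b M w ->
  (forall j, (j < k)%N -> 0 < lam j) ->
  (forall j, (j < k)%N -> INT a b (fun x => w x * phi j x) = 0) ->
  INT a b (fun x => w x * kop w x) <= lam k * INT a b (fun x => w x * w x).
Proof.
move=> M0 lw lpos wphi; have uw := ulim_cst M0 lw.
have H1 := ulim_quad (ulimM uw (ulim_kop uw)).
have H2 := ulim_quad (ulimM uw uw).
have H3 j : (j < k)%N -> quad a b m (fun x => w x * nys m j x) @[m --> U] --> (0 : R).
  by move=> jk; rewrite -(wphi j jk); apply: (ulim_quad (ulimM uw (ulim_nys (lpos j jk)))).
have H4 : \sum_(j < k) (mus m j.+1 - mus m k.+1) * quad a b m (fun x => w x * nys m j x) ^+ 2 +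
    mus m k.+1 * quad a b m (fun x => w x * w x) @[m --> U] -->
    \sum_(j < k) (lam j - lam k) * (0 * 0) + lam k * INT a b (fun x => w x * w x).
  apply: cvgD; last by apply: cvgM; [exact: Hlam|exact: H2].
  apply: cvg_sum => j _; apply: cvgM; first by apply: cvgB; exact: Hlam.
  by apply: cvgM; exact: H3.
rewrite big1 ?add0r in H4 => [|j _]; last by rewrite mulr0 mulr0.
rewrite -subr_le0; apply: (cvgr_to_le (cvgB H1 H4)).
have Uk : U [set m | forall j, (j < k)%N -> mus m j.+1 != 0].
  elim: (k) lpos => [|n ih] lpos; first by apply: filterE.
  have {}ih := ih (fun j jn => lpos j (ltnW jn)).
  apply: (filterS _ (filterI ih (U_mu (lpos n (ltnSn n))))) => m [h1 [h2 nm]] j.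
  rewrite ltnS leq_eqVlt => /predU1P[->|]; last exact: h1.
  by rewrite gt_eqF//; have := lpos n (ltnSn n); lra.
apply: (filterS _ (filterI (U_gt k) Uk)) => m [km mu0].
by rewrite subr_le0; exact: quad_form_le.
Qed.

End Ultra.
End Limits.

(** * Existence and uniqueness of the limit spectrum *)

Section Spectrum.
Variable R : realType.
Variables a b : R.
Hypothesis ab : a < b.
Variables (K : R -> R -> R) (L B : R).
Hypothesis L0 : 0 <= L.
Hypothesis B0 : 0 <= B.
Hypothesis Ksym : forall x y, a <= x <= b -> a <= y <= b -> K x y = K y x.
Hypothesis Klip : forall y, a <= y <= b -> lip_on a b L (K^~ y).
Hypothesis KB : forall x y, a <= x <= b -> a <= y <= b -> `|K x y| <= B.
Hypothesis Kpos : forall w, cont_on a b w ->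
  INT a b (fun x => w x * kop a b K w x) <= 0 -> forall x, a <= x <= b -> w x = 0.
Implicit Types (x y c M : R) (m : nat) (w F G : R -> R) (f g : nat -> R -> R).
Implicit Types (lam : nat -> R) (phi : nat -> R -> R).
Local Notation kop := (kop a b K).
Local Notation cfs := (cfs a b K).

Lemma chain1_lip u v : cont_on a b u -> cont_on a b v -> ider a b u v ->
  exists2 M, 0 <= M & lip_on a b M u.
Proof.
move=> cu cv du; have [M M0 HM] := cont_on_bounded (ltW ab) cv.
exists M => //.
have H x y : a <= x -> x < y -> y <= b -> `|u y - u x| <= M * `|y - x|.
  move=> ax xy yb; have [c cxy ->] := segment_MVT ax xy yb cu du.
  by rewrite normrM ler_wpM2r//; apply: HM; lra.
move=> x y axb ayb; case: (ltgtP x y) => [xy|yx|->].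
- by rewrite distrC (distrC x); apply: H => //; lra.
- by apply: H => //; lra.
- by rewrite !subrr normr0 mulr0.
Qed.

Lemma poly_lip (p : {poly R}) : exists2 M, 0 <= M & lip_on a b M (horner p).
Proof.
have cp := @chain_poly R a b 1 p.
exact: (chain1_lip (cp.1 0%N isT) (cp.1 1%N isT) (cp.2 0%N isT)).
Qed.

Lemma orthogonal_poly k phi : (forall j, (j < k)%N -> cont_on a b (phi j)) ->
  exists p : {poly R}, p != 0 /\
    forall j, (j < k)%N -> INT a b (fun x => p.[x] * phi j x) = 0.
Proof.
move=> cphi; have [c [[i ci] Hc]] := nontrivial_solution
  (fun (i : 'I_k.+1) (j : 'I_k) => INT a b (fun x => x ^+ i * phi j x)).
exists (\poly_(i < k.+1) (oapp c 0 (insub i))); split.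
  apply/eqP => /polyP/(_ i); rewrite coef_poly ltn_ord coef0 valK /=.
  by move/eqP; apply/negP.
move=> j jk; rewrite -[RHS](Hc (Ordinal jk)).
have cx (i' : nat) : cont_on a b (fun x => x ^+ i').
  by apply: cont_on_continuous => x; exact: exprn_continuous.
transitivity (\sum_i INT a b (fun x => c i * (x ^+ i * phi j x))); last first.
  apply: eq_bigr => i' _; rewrite INTZ//.
  by apply: cont_onM; [exact: cx|exact: cphi].
rewrite -INT_sum => [|i' _]; last by apply: cont_onZ; apply: cont_onM; [exact: cx|exact: cphi].
apply: eq_INT => x _; rewrite horner_poly mulr_suml; apply: eq_bigr => i' _.
by rewrite valK/= mulrA.
Qed.

Lemma cfs_exists (U : set_system nat) (mus : nat -> nat -> R) : UltraFilter U ->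
  \oo `<=` U -> (forall m, discrete_eigenvalues a b K m (mus m)) ->
  exists lam phi, cfs lam phi /\ forall j, mus m j.+1 @[m --> U] --> lam j.
Proof.
move=> uU ooU Hmu; have pU : ProperFilter U by exact: ultra_proper.
have /choice[Ws HW] : forall m, exists W, dspec a b K m (mus m) W.
  by move=> m; exact: dspec_exists.
have /choice[lam Hlam] : forall j, exists l : R, mus m j.+1 @[m --> U] --> l.
  move=> j; apply: (@ultra_cvg _ _ _ (B * mean_bound a b ^+ 2)) => //.
  apply: filterS (U_gt ooU j) => m jm.
  exact: (abs_mu ab B0 Ksym KB (HW m)).
(* The Nystrom bounds require an eigenvalue bounded below, so the limit is first taken only where
   [lam j] is positive, with 0 as default. *)
have /choice[phi Hphi] : forall j, exists phi : R -> R, 0 < lam j -> forall x, a <= x <= b ->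
    nystrom a b K m (mus m) (Ws m) j x @[m --> U] --> phi x.
  move=> j; have [lj|] := ltP 0 (lam j); last by exists (fun=> 0).
  have /choice[phi Hphi] : forall x, exists l : R, a <= x <= b ->
      nystrom a b K m (mus m) (Ws m) j x @[m --> U] --> l.
    move=> x; have [axb|] := boolP (a <= x <= b); last by exists 0.
    have l2 : 0 < lam j / 2 by lra.
    have [|l Hl] := @ultra_cvg R U (fun m => nystrom a b K m (mus m) (Ws m) j x)
       ((lam j / 2)^-1 * (B * mean_bound a b)) uU.
      apply: filterS (U_mu uU ooU Hlam lj) => m [lm jm].
      exact: (nystrom_bounded ab B0 KB (HW m)).
    by exists l.
  by exists phi.
(* Positivity by strong induction: some nonzero polynomial is orthogonal to the first k limit
   eigenfunctions. If [lam k] were at most 0, its form would be at most 0, and [Kpos] would make the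
   polynomial vanish. *)
have lpos k : 0 < lam k.
  elim/ltn_ind: k => k ih.
  have ul j : (j < k)%N -> exists2 M, 0 <= M & lip_on a b M (phi j).
    by move=> jk; apply: (ulim_lip ab uU ooU (ulim_nys ab L0 B0 Klip KB uU ooU HW Hlam Hphi (ih j jk))).
  have [p [p0 Hp]] : exists p : {poly R}, p != 0 /\
      forall j, (j < k)%N -> INT a b (fun x => p.[x] * phi j x) = 0.
    by apply: orthogonal_poly => j /ul[M _]; exact: lip_on_cont.
  have [M M0 lp] := poly_lip p.
  have H := limit_form_le ab L0 B0 Ksym Klip KB uU ooU Hmu HW Hlam Hphi M0 lp ih Hp.
  rewrite ltNge; apply/negP => lk; move/eqP: p0; apply.
  apply: (poly_eq0_itv ab); apply: (Kpos (lip_on_cont lp)).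
  rewrite (le_trans H)// mulr_le0_ge0// INT_ge0// => x _.
  by rewrite -expr2 sqr_ge0.
exists lam, phi; split=> //; split=> //.
- move=> k.
  rewrite -subr_le0; apply: (cvgr_to_le (cvgB (@Hlam k.+1) (@Hlam k))).
  apply: filterS (U_gt ooU k.+1) => m km; rewrite subr_le0.
  by have [_ mono] := Hmu m; apply: mono.
- move=> k; exact: (ulim_lip ab uU ooU (ulim_nys ab L0 B0 Klip KB uU ooU HW Hlam Hphi (lpos k))).
- move=> i j; exact: (limit_orthonormal ab L0 B0 Klip KB uU ooU HW Hlam Hphi).
- split=> [k x axb|k w M M0 lw wphi].
    exact: (limit_eigen ab L0 B0 Ksym Klip KB uU ooU HW Hlam Hphi).
  exact: (limit_form_le ab L0 B0 Ksym Klip KB uU ooU Hmu HW Hlam Hphi M0 lw (fun j _ => lpos j) wphi).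
Qed.

Section CfsTheory.
Variables (lam : nat -> R) (phi : nat -> R -> R).
Hypothesis cf : cfs lam phi.

Lemma cfs_cont k : cont_on a b (phi k).
Proof. by case: cf => _ _ H _ _; have [M _] := H k; exact: lip_on_cont. Qed.

Lemma cfs_decr i j : (i <= j)%N -> lam j <= lam i.
Proof.
case: cf => _ H _ _ _ /subnK <-; elim: (j - i)%N => // k ih.
by rewrite (le_trans (H _)).
Qed.

Definition comb n (c : nat -> R) x := \sum_(i < n) c i * phi i x.

Lemma cont_comb n (c : nat -> R) : cont_on a b (comb n c).
Proof. by apply: cont_on_sum => i _; apply: cont_onZ; exact: cfs_cont. Qed.

Lemma INT_comb n (c : nat -> R) F : cont_on a b F ->
  INT a b (fun x => comb n c x * F x) = \sum_(i < n) c i * INT a b (fun x => phi i x * F x).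
Proof.
move=> cF; have cp i : cont_on a b (fun x => phi i x * F x).
  by apply: cont_onM => //; exact: cfs_cont.
under [RHS]eq_bigr => i _ do rewrite -INTZ//.
rewrite -INT_sum => [|i _]; last exact: cont_onZ.
apply: eq_INT => x _; rewrite /comb mulr_suml; apply: eq_bigr => i _; exact: esym (mulrA _ _ _).
Qed.

Lemma INT_comb2 n (c d : nat -> R) :
  INT a b (fun x => comb n c x * comb n d x) = \sum_(i < n) c i * d i.
Proof.
rewrite INT_comb; last exact: cont_comb.
apply: eq_bigr => i _; congr (_ * _).
rewrite (@eq_INT _ _ _ _ (fun x => comb n d x * phi i x)); last by move=> x _; exact: mulrC.
rewrite INT_comb; last exact: cfs_cont.
case: cf => _ _ _ o _; rewrite (bigD1 i)//= o eqxx mulr1 big1 ?addr0// => j ji.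
by rewrite o -[(_ == _)]/(val j == val i) (inj_eq val_inj) (negbTE ji) mulr0.
Qed.

Lemma cont_on_K x : a <= x <= b -> cont_on a b (K x).
Proof. by move=> axb; exact: lip_on_cont (Klipr Ksym Klip axb). Qed.

Lemma kop_comb n (c : nat -> R) x : a <= x <= b ->
  kop (comb n c) x = comb n (fun i => c i * lam i) x.
Proof.
move=> axb; rewrite /kop (@eq_INT _ _ _ _ (fun y => comb n c y * K x y)); last first.
  by move=> y _; exact: mulrC.
rewrite INT_comb; last exact: cont_on_K.
case: cf => _ _ _ _ [e _]; rewrite /comb; apply: eq_bigr => i _; rewrite -mulrA -e//.
by congr (_ * _); apply: eq_INT => y _; exact: mulrC.
Qed.

Lemma form_comb n (c : nat -> R) :
  INT a b (fun x => comb n c x * kop (comb n c) x) = \sum_(i < n) lam i * c i ^+ 2.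
Proof.
rewrite (@eq_INT _ _ _ _ (fun x => comb n c x * comb n (fun i => c i * lam i) x)).
  by rewrite INT_comb2; apply: eq_bigr => i _; ring.
by move=> x axb; rewrite kop_comb.
Qed.

Lemma comb_lip n (c : nat -> R) : exists2 M, 0 <= M & lip_on a b M (comb n c).
Proof.
case: cf => _ _ lp _ _; elim: n => [|n [M M0 lM]].
  by exists 0 => // x y _ _; rewrite /comb !big_ord0 subrr normr0 mul0r.
have [N N0 lN] := lp n; exists (M + `|c n| * N); first by rewrite addr_ge0// mulr_ge0.
move=> x y axb ayb; rewrite /comb !big_ord_recr/= opprD addrACA -mulrBr.
rewrite (le_trans (ler_normD _ _))// mulrDl lerD//; first exact: lM.
by rewrite normrM -mulrA ler_wpM2l//; exact: lN.
Qed.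

End CfsTheory.

(* Courant-Fischer: some combination of the first k+1 functions of one system is
   orthogonal to the first k functions of the other. *)
Lemma cfs_le lam phi lam' phi' : cfs lam phi -> cfs lam' phi' -> forall k, lam k <= lam' k.
Proof.
move=> cf cf' k.
have [c [[i0 ci] Hc]] := nontrivial_solution
  (fun (i : 'I_k.+1) (j : 'I_k) => INT a b (fun x => phi i x * phi' j x)).
pose d (i : nat) := oapp c 0 (insub i).
have dE (i : 'I_k.+1) : d i = c i by rewrite /d valK.
have [M M0 lM] := comb_lip cf k.+1 d.
have [_ _ _ _ [_ star]] := cf'.
have H := star k _ M M0 lM.
rewrite (form_comb cf) (INT_comb2 cf) in H.
have {}H : \sum_(i < k.+1) lam i * d i ^+ 2 <= lam' k * \sum_(i < k.+1) d i * d i.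
  apply: H => j jk; rewrite (INT_comb cf); last exact: cfs_cont cf' j.
  rewrite -[RHS](Hc (Ordinal jk)); apply: eq_bigr => i _.
  by rewrite dE.
have S0 : 0 < \sum_(i < k.+1) d i * d i.
  rewrite (bigD1 i0)//= ltr_wpDr//.
    by apply: sumr_ge0 => j _; rewrite -expr2 sqr_ge0.
  by rewrite dE -expr2 exprn_even_gt0.
rewrite -(ler_pM2r S0) (le_trans _ H)// mulr_sumr; apply: ler_sum => j _.
rewrite -expr2 ler_wpM2r ?sqr_ge0//; apply: (cfs_decr cf); rewrite -ltnS; exact: ltn_ord.
Qed.

(** By [cfs_le] every ultrafilter finer than \oo yields the same eigenvalues, which upgrades
    ultrafilter limits to ordinary convergence. *)
Lemma cfs_limit : exists lam phi, cfs lam phi /\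
  forall mus : nat -> nat -> R, (forall m, discrete_eigenvalues a b K m (mus m)) ->
    forall j, mus m j.+1 @[m --> \oo] --> lam j.
Proof.
have /choice[mus0 Hmus0] : forall m, exists mu, discrete_eigenvalues a b K m mu.
  by move=> m; exact: (discrete_eigenvalues_exist ab L0 B0 Ksym).
have [U0 [uU0 ooU0]] := @ultraFilterLemma nat \oo _.
have [lam [phi [cf _]]] := cfs_exists uU0 ooU0 Hmus0.
exists lam, phi; split=> // mus Hmus j; apply: ultra_cvg_oo => U uU ooU.
have [lam' [phi' [cf' H]]] := cfs_exists uU ooU Hmus.
suff -> : lam j = lam' j by exact: H.
by apply/eqP; rewrite eq_le (cfs_le cf cf') (cfs_le cf' cf).
Qed.

End Spectrum.

(** * The spectrum of the Green operator and the given eigensystem *)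

Section GreenSpectrum.
Variable R : realType.
Variables (a b : R) (r : nat).
Hypothesis ab : a < b.
Hypothesis r2 : (2 <= r)%N.
Implicit Types (x y c mu : R) (phi psi w : R -> R).
Local Notation G := (green a b r).
Local Notation kop := (kop a b G).
Local Notation cfs := (cfs a b G).
Local Notation gsol := (green_sol a b r).

Lemma kop_green phi x : a <= x <= b -> cont_on a b phi -> kop phi x = gsol phi 0 x.
Proof. by move=> axb cphi; exact: INT_green. Qed.

Lemma green_lip_bounded : exists2 C : R, 0 <= C &
  (forall y, a <= y <= b -> lip_on a b C (G^~ y)) /\
  (forall x y, a <= x <= b -> a <= y <= b -> `|G x y| <= C).
Proof.
have [C C0 HC] := dgreen_bounded ab r2; exists C => //; split; last first.
  by move=> x y axb ayb; apply: HC.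
move=> y ayb; have [cG dG] := dgreen_chain ab r2 y.
have c0 : cont_on a b (G^~ y) by apply: (cG 0%N).
have d0 : ider a b (G^~ y) (dgreen a b r 1 y) by apply: (dG 0%N); lia.
have H x z : a <= x -> x < z -> z <= b -> `|G z y - G x y| <= C * `|z - x|.
  move=> ax xz zb; have [c cxz ->] := segment_MVT ax xz zb c0 d0.
  by rewrite normrM ler_wpM2r// HC//; [lia|lra].
move=> x z axb azb; case: (ltgtP x z) => [xz|zx|->].
- by rewrite distrC (distrC x); apply: H => //; lra.
- by apply: H => //; lra.
- by rewrite !subrr normr0 mulr0.
Qed.

Lemma chain_eq0 n (u : nat -> R -> R) : chain a b n u ->
  (forall x, a <= x <= b -> u 0%N x = 0) ->
  forall j, (j <= n)%N -> forall x, a <= x <= b -> u j x = 0.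
Proof.
move=> [cu du] u0; elim=> [|j ih] jn; first exact: u0.
apply: (cont_on_eq0 ab (cu _ jn)) => x axb; have d1 := du j jn x axb.
have d2 : is_derive x 1 (u j) 0.
  apply: (eq_ider (@ider_cst _ a b 0) _ _ axb) => // y /andP[ay yb].
  by rewrite ih ?(ltnW jn) ?(ltW ay) ?(ltW yb).
by rewrite -(@derive_val _ _ _ _ _ _ _ d1) (@derive_val _ _ _ _ _ _ _ d2).
Qed.

(** The form is the square integral of the r-th derivative of the clamped solution with right-hand
    side w. If it is at most 0, the solution vanishes, and so does w, which is its derivative of
    order 2r up to sign. *)
Lemma green_pos w : cont_on a b w ->
  INT a b (fun x => w x * kop w x) <= 0 -> forall x, a <= x <= b -> w x = 0.
Proof.
move=> cw; rewrite (@eq_INT _ _ _ _ (fun x => w x * gsol w 0 x)); last first.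
  by move=> x axb; rewrite kop_green.
have cU := green_sol_chain ab r2 cw.
have cUr : cont_on a b (gsol w r) by apply: cU.1; lia.
rewrite INT_green_form// => I0.
have I1 : INT a b (fun x => gsol w r x * gsol w r x) = 0.
  by apply/eqP; rewrite eq_le I0 INT_ge0// => x _; rewrite -expr2 sqr_ge0.
have Ur x : a <= x <= b -> gsol w r x = 0.
  move=> axb; apply/eqP; rewrite -sqrf_eq0 expr2; apply/eqP.
  by apply: (INT_eq0 ab _ _ I1 axb) => [|y _]; [exact: cont_onM|rewrite -expr2 sqr_ge0].
have cUc : chain a b r (gsol w) by apply: chainW cU; lia.
have U0 x : a <= x <= b -> gsol w 0 x = 0.
  move=> axb; apply/eqP; rewrite -normr_le0 -[leRHS](mul0r ((b - a) ^+ r)).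
  apply: (chain_le (ltW ab) (lexx 0) cUc) => //.
    by move=> j /(green_sol_bc ab r2 w)[e _]; exists a => //; rewrite lexx ltW.
  by move=> y /Ur ->; rewrite normr0.
move=> x axb; have := chain_eq0 cU U0 (leqnn _) axb.
rewrite green_sol_top// => /eqP; rewrite mulf_eq0 signr_eq0 => /eqP//.
Qed.

Definition eigfun mu phi := cont_on a b phi /\
  forall x, a <= x <= b -> kop phi x = mu * phi x.

Lemma eigfun_chain mu phi : mu != 0 -> eigfun mu phi -> exists U,
  [/\ chain a b (2 * r) U,
      forall x, a <= x <= b -> U 0%N x = phi x,
      forall j, (j < r)%N -> U j a = 0 /\ U j b = 0 &
      forall x, U (2 * r)%N x = mu^-1 * (-1) ^+ r * phi x].
Proof.
move=> mu0 [cphi ephi]; exists (fun j x => mu^-1 * gsol phi j x); split.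
- by apply: chainZ; exact: green_sol_chain.
- by move=> x axb; rewrite -kop_green// ephi// mulKf.
- by move=> j /(green_sol_bc ab r2 phi)[-> ->]; rewrite mulr0.
- by move=> x; rewrite green_sol_top// mulrA.
Qed.

Lemma eigfun_lip mu phi : mu != 0 -> eigfun mu phi -> exists2 M, 0 <= M & lip_on a b M phi.
Proof.
move=> mu0 ep; have [U [[cU dU] U0 _ _]] := eigfun_chain mu0 ep.
have [|||M M0 lU] := chain1_lip ab (cU 0%N _) (cU 1%N _) (dU 0%N _); [lia|lia|lia|].
by exists M => // x y axb ayb; rewrite -!U0//; exact: lU.
Qed.

(** Subtracting the right multiple of [phi] from [psi] cancels the r-th derivative at a, and the
    difference solves the overdetermined problem. *)
Lemma eigfun_simple mu phi psi : mu != 0 -> eigfun mu phi -> eigfun mu psi ->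
  (exists2 x, a <= x <= b & phi x != 0) ->
  exists c, forall x, a <= x <= b -> psi x = c * phi x.
Proof.
move=> mu0 ephi epsi [z azb phiz].
have [U [cU U0 Ubc Utop]] := eigfun_chain mu0 ephi.
have [V [cV V0 Vbc Vtop]] := eigfun_chain mu0 epsi.
have r0 : (0 < r)%N by lia.
have Ur : U r a != 0.
  apply: contra_neq phiz => Ur; rewrite -U0//.
  apply: (overdetermined_eq0 ab r0 cU Ubc Ur _ azb (k := mu^-1 * (-1) ^+ r)).
  by move=> x axb; rewrite Utop U0.
pose c := V r a / U r a; exists c.
pose X j x := V j x + (- c) * U j x.
have cX : chain a b (2 * r) X by apply: chainD => //; exact: chainZ.
have X0 x : a <= x <= b -> X 0%N x = 0.
  apply: (overdetermined_eq0 ab r0 cX _ _ _ (k := mu^-1 * (-1) ^+ r)).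
  - move=> j jr; rewrite /X; have [-> ->] := Ubc j jr; have [-> ->] := Vbc j jr.
    by rewrite mulr0 addr0.
  - by rewrite /X /c mulNr divfK// subrr.
  - by move=> y ayb; rewrite /X Utop Vtop U0// V0//; ring.
move=> x axb; have := X0 x axb; rewrite /X U0// V0// mulNr => /eqP.
by rewrite subr_eq0 => /eqP.
Qed.

Lemma kop_sym phi psi : cont_on a b phi -> cont_on a b psi ->
  INT a b (fun x => kop phi x * psi x) = INT a b (fun x => phi x * kop psi x).
Proof.
move=> cphi cpsi.
rewrite (@eq_INT _ _ _ _ (fun x => psi x * gsol phi 0 x)); last first.
  by move=> x axb; rewrite kop_green// mulrC.
rewrite INT_green_form// [RHS](@eq_INT _ _ _ _ (fun x => phi x * gsol psi 0 x)); last first.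
  by move=> x axb; rewrite kop_green.
by rewrite INT_green_form//; apply: eq_INT => x _; exact: mulrC.
Qed.

Lemma eigfun_orthogonal mu nu phi psi : eigfun mu phi -> eigfun nu psi -> mu != nu ->
  INT a b (fun x => phi x * psi x) = 0.
Proof.
move=> [cphi ephi] [cpsi epsi] mn.
have cpp : cont_on a b (fun x => phi x * psi x) by exact: cont_onM.
have := kop_sym cphi cpsi.
rewrite (@eq_INT _ _ _ _ (fun x => mu * (phi x * psi x))); last first.
  by move=> x axb; rewrite ephi// mulrA.
rewrite [RHS](@eq_INT _ _ _ _ (fun x => nu * (phi x * psi x))); last first.
  by move=> x axb; rewrite epsi// mulrCA.
rewrite !INTZ// => /eqP; rewrite -subr_eq0 -mulrBl mulf_eq0 subr_eq0 (negbTE mn).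
by move/eqP.
Qed.

Section Cfs.
Variables (lam : nat -> R) (phi : nat -> R -> R).
Hypothesis cf : cfs lam phi.

Lemma cfs_eigfun k : eigfun (lam k) (phi k).
Proof. by split; [exact: cfs_cont cf k|move=> x; case: cf => _ _ _ _ [+ _]; exact]. Qed.

Lemma cfs_pos k : 0 < lam k.
Proof. by case: cf. Qed.

Lemma INT_neq0 w : INT a b (fun x => w x * w x) != 0 -> exists2 x, a <= x <= b & w x != 0.
Proof.
move=> w0; apply: contrapT => /forall2NP H; move/eqP: w0; apply.
rewrite (@eq_INT _ _ _ _ (fun=> 0)) ?INT0// => x axb.
by case: (H x) => // /negP; rewrite negbK => /eqP ->; rewrite mul0r.
Qed.

Lemma cfs_neq0 k : exists2 x, a <= x <= b & phi k x != 0.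
Proof. by apply: INT_neq0; case: cf => _ _ _ o _; rewrite o eqxx oner_neq0. Qed.

Lemma cfs_strict k : lam k.+1 < lam k.
Proof.
have dec : lam k.+1 <= lam k by case: cf.
rewrite lt_neqAle dec andbT; apply/eqP => e.
have [c Hc] : exists c, forall x, a <= x <= b -> phi k.+1 x = c * phi k x.
  apply: (eigfun_simple _ (cfs_eigfun k) _ (cfs_neq0 k)).
    by rewrite gt_eqF// cfs_pos.
  by rewrite -e; exact: cfs_eigfun.
case: cf => _ _ _ o _; have ck := cfs_cont cf k.
have o1 : INT a b (fun x => phi k.+1 x * phi k x) = c.
  rewrite (@eq_INT _ _ _ _ (fun x => c * (phi k x * phi k x))); last first.
    by move=> x axb; rewrite Hc// mulrA.
  by rewrite INTZ ?o ?eqxx ?mulr1//; exact: cont_onM.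
have c0 : c = 0 by rewrite -o1 o gtn_eqF.
have := o k.+1 k.+1; rewrite eqxx (@eq_INT _ _ _ _ (fun=> 0)) ?INT0.
  by move/eqP; rewrite eq_sym oner_eq0.
by move=> x axb; rewrite Hc// c0 !mul0r.
Qed.

End Cfs.

(** If the values of a strictly decreasing sequence all occur in a nonincreasing one, they occur
    there at indices at least as large. Used in both directions to match two enumerations of a
    spectrum. *)
Lemma decreasing_range_le (f g : nat -> R) : (forall k, f k.+1 < f k) ->
  (forall k, g k.+1 <= g k) -> (forall k, exists i, f k = g i) ->
  forall k, exists2 i, (k <= i)%N & f k = g i.
Proof.
move=> ff gg fg.
have gle i j : (i <= j)%N -> g j <= g i.
  by move=> /subnK <-; elim: (j - i)%N => // n ih; rewrite (le_trans (gg _)).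
elim=> [|k [i ki e]]; first by have [i e] := fg 0%N; exists i.
have [j e'] := fg k.+1; exists j => //; rewrite (leq_ltn_trans ki)// ltnNge.
by apply/negP => /gle; rewrite -e -e' leNgt ff.
Qed.

Lemma eigenpairP (g : R -> R -> R) mu psi :
  (forall x y, a <= x <= b -> a <= y <= b -> g x y = G x y) ->
  eigenpair a b g mu psi <-> eigfun mu psi.
Proof.
move=> gG; have E x : a <= x <= b ->
    \int[lebesgue_measure]_(y in `[a, b]) (g x y * psi y) = kop psi x.
  by move=> axb; apply: eq_INT => y ayb; rewrite gG.
split=> [[cpsi epsi]|[[cpsi] epsi]]; split=> // x axb.
  by rewrite -E// epsi// in_itv.
by move: axb; rewrite in_itv/= => axb; rewrite E// epsi.
Qed.

Section Eigensystem.
Variable g : R -> R -> R.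
Hypothesis gG : forall x y, a <= x <= b -> a <= y <= b -> g x y = G x y.
Variables (lam : nat -> R) (phi : nat -> R -> R).
Hypothesis es : eigensystem a b g lam phi.

Lemma es_pos k : 0 < lam k.+1.
Proof. by case: es => H _ _ _; case: (H k.+1 isT). Qed.

Lemma es_eigfun k : eigfun (lam k.+1) (phi k.+1).
Proof. by case: es => H _ _ _; case: (H k.+1 isT) => _ /(eigenpairP _ _ gG). Qed.

Lemma sum_delta N i (f : nat -> R) : (0 < i < N)%N ->
  \sum_(1 <= j < N) (j == i)%:R * f j = f i.
Proof.
move=> iN; rewrite (bigD1_seq i) ?iota_uniq ?mem_index_iota//= eqxx mul1r big1 ?addr0//.
by move=> j /negbTE ->; rewrite mul0r.
Qed.

Lemma es_neq0 k : exists2 x, a <= x <= b & phi k.+1 x != 0.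
Proof.
apply: contrapT => /forall2NP H; case: es => _ _ li _.
have /li/(_ k.+1) : forall x, x \in `[a, b] ->
    \sum_(1 <= j < k.+2) (j == k.+1)%:R * phi j x = 0.
  move=> x; rewrite in_itv/= => axb; rewrite sum_delta; last by lia.
  by case: (H x) => // /negP; rewrite negbK => /eqP.
by move=> /(_ ltac:(by rewrite /= ltnSn)) /=; rewrite eqxx => /eqP; rewrite oner_eq0.
Qed.

Lemma es_strict k : lam k.+2 < lam k.+1.
Proof.
have dec : lam k.+2 <= lam k.+1 by case: es => _ H _ _; apply: H.
rewrite lt_neqAle dec andbT; apply/eqP => e.
have [c Hc] : exists c, forall x, a <= x <= b -> phi k.+2 x = c * phi k.+1 x.
  apply: (eigfun_simple _ (es_eigfun k) _ (es_neq0 k)).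
    by rewrite gt_eqF// es_pos.
  by rewrite -e; exact: es_eigfun.
case: es => _ _ li _.
have /li/(_ k.+2) : forall x, x \in `[a, b] ->
    \sum_(1 <= j < k.+3) ((j == k.+2)%:R - c * (j == k.+1)%:R) * phi j x = 0.
  move=> x; rewrite in_itv/= => axb.
  under eq_bigr do rewrite mulrBl -mulrA.
  rewrite sumrB -mulr_sumr !sum_delta; [|lia..].
  by rewrite Hc// subrr.
move=> /(_ ltac:(by rewrite /= ltnSn)) /=; rewrite eqxx gtn_eqF// mulr0 subr0 => /eqP.
by rewrite oner_eq0.
Qed.

Variables (lam' : nat -> R) (phi' : nat -> R -> R).
Hypothesis cf : cfs lam' phi'.

Lemma es_complete k : exists i, lam' k = lam i.+1.
Proof.
case: es => _ _ _ cpl.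
have [|N [c Hc]] := cpl (lam' k) (phi' k) _ ((eigenpairP _ _ gG).2 (cfs_eigfun cf k)).
  by rewrite gt_eqF// (cfs_pos cf).
apply: contrapT => /forallNP H.
have [x axb] := cfs_neq0 cf k; rewrite Hc ?in_itv// big1_seq ?eqxx//.
move=> j /andP[/eqP lj]; rewrite mem_index_iota => /andP[j0 _].
by case: (H j.-1); rewrite prednK.
Qed.

(** Were the eigenvalue absent from [lam'], its eigenfunction would be orthogonal to every [phi'],
    and the maximum principle would put it below all of [lam']. But the [lam'] decrease strictly
    through values of [lam], hence eventually drop below it. *)
Lemma cfs_complete k : exists i, lam k.+1 = lam' i.
Proof.
apply: contrapT => /forallNP H.
have [M M0 lM] := eigfun_lip (ltac:(by rewrite gt_eqF// es_pos) : lam k.+1 != 0) (es_eigfun k).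
have cp := lip_on_cont lM.
have orth j : INT a b (fun x => phi k.+1 x * phi' j x) = 0.
  by apply: (eigfun_orthogonal (es_eigfun k) (cfs_eigfun cf j)); apply/eqP.
have lamle i : lam k.+1 <= lam' i.
  case: cf => _ _ _ _ [_ /(_ i _ M M0 lM (fun j _ => orth j))].
  rewrite (@eq_INT _ _ _ _ (fun x => lam k.+1 * (phi k.+1 x * phi k.+1 x))); last first.
    by move=> x axb; have [_ ->//] := es_eigfun k; rewrite mulrCA.
  rewrite INTZ; last exact: cont_onM.
  rewrite ler_pM2r// lt_neqAle INT_ge0 ?andbT; last by move=> x _; rewrite -expr2 sqr_ge0.
  apply/eqP => /esym I0; have [x axb /negP] := es_neq0 k; apply.
  rewrite -sqrf_eq0 expr2; apply/eqP.
  by apply: (INT_eq0 ab _ _ I0 axb) => [|y _]; [exact: cont_onM|rewrite -expr2 sqr_ge0].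
have dg j : lam j.+2 <= lam j.+1 by apply: ltW; exact: es_strict.
have [i ki e] := decreasing_range_le (cfs_strict cf) dg es_complete k.+1.
have := lamle k.+1; rewrite e leNgt => /negP; apply.
have le_dg p q : (p <= q)%N -> lam q.+1 <= lam p.+1.
  by move=> /subnK <-; elim: (q - p)%N => // n ih; rewrite (le_trans (dg _)).
exact: le_lt_trans (le_dg _ _ ki) (es_strict k).
Qed.

(** Both sequences strictly decrease and each value of one is a value of the other. *)
Lemma es_cfs k : lam k.+1 = lam' k.
Proof.
have dg j : lam j.+2 <= lam j.+1 by apply: ltW; exact: es_strict.
have dc j : lam' j.+1 <= lam' j by apply: ltW; exact: (cfs_strict cf).
have le_dg p q : (p <= q)%N -> lam q.+1 <= lam p.+1.
  by move=> /subnK <-; elim: (q - p)%N => // n ih; rewrite (le_trans (dg _)).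
have [i ki e] := decreasing_range_le (cfs_strict cf) dg es_complete k.
have [j kj e'] := decreasing_range_le es_strict dc cfs_complete k.
by apply/eqP; rewrite eq_le {1}e' (cfs_decr cf kj) e le_dg.
Qed.

Lemma es_cfs_fun k : exists c, forall x, a <= x <= b -> phi k.+1 x = c * phi' k x.
Proof.
apply: (eigfun_simple _ (cfs_eigfun cf k) _ (cfs_neq0 cf k)).
  by rewrite gt_eqF// (cfs_pos cf).
by rewrite -es_cfs; exact: es_eigfun.
Qed.

End Eigensystem.
End GreenSpectrum.

(** * Quadrature error on eigenfunctions, and the spectral gap *)

Section Rates.
Variable R : realType.
Variables (a b : R) (r : nat).
Hypothesis ab : a < b.
Hypothesis r2 : (2 <= r)%N.
Implicit Types (x y c : R) (phi psi w : R -> R).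
Local Notation G := (green a b r).
Local Notation eig := (eigfun a b r).
Local Notation h := (mesh a b).

Lemma max_abs_ge phi x : cont_on a b phi -> a <= x <= b -> `|phi x| <= max_abs a b phi.
Proof.
move=> cphi axb; have [M M0 HM] := cont_on_bounded (ltW ab) cphi.
apply: ub_le_sup; last by exists x; rewrite /= ?in_itv.
by exists M => _ [y yab <-]; apply: HM; move: yab; rewrite /= in_itv.
Qed.

Lemma max_abs_attained phi : cont_on a b phi ->
  exists2 x, a <= x <= b & `|phi x| = max_abs a b phi.
Proof.
move=> cphi; have [x + Hx] := EVT_max (ltW ab) (cont_on_within (cont_on_abs cphi)).
rewrite in_itv/= => axb; exists x => //; apply/eqP; rewrite eq_le max_abs_ge//=.
apply: ge_sup; first by exists `|phi x|, x => //; rewrite /=.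
by move=> _ [y yab <-]; exact: Hx.
Qed.

Lemma max_abs_le phi M : (forall x, a <= x <= b -> `|phi x| <= M) -> max_abs a b phi <= M.
Proof.
move=> HM; apply: ge_sup.
  by exists `|phi a|, a => //; rewrite /= bound_itvE ltW.
by move=> _ [y yab <-]; apply: HM; move: yab; rewrite /= in_itv.
Qed.

(* the derivatives in y of G x y * phi y *)
Lemma green_mul_chain mu phi : mu != 0 -> eig mu phi -> exists U,
  [/\ forall x, a <= x <= b -> chain a b (2 * r - 2) (fun j => leibniz j (fun i => dgreen a b r i x) U),
      forall x y, a <= x <= b -> a <= y <= b -> G x y * phi y = leibniz 0 (fun i => dgreen a b r i x) U y,
      forall x j, a <= x <= b -> (j < 2 * r)%N ->
        leibniz j (fun i => dgreen a b r i x) U a = 0 /\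
        leibniz j (fun i => dgreen a b r i x) U b = 0 &
      exists2 C : R, 0 <= C & forall x y, a <= x <= b -> a <= y <= b ->
        `|leibniz (2 * r - 2) (fun i => dgreen a b r i x) U y| <= C].
Proof.
move=> mu0 ep; have [U [cU U0 Ubc _]] := eigfun_chain ab r2 mu0 ep.
have [K K0 HK] := dgreen_bounded ab r2.
exists U; split.
- move=> x axb; apply: chainM; first exact: dgreen_chain.
  by apply: chainW cU; lia.
- by move=> x y axb ayb; rewrite /leibniz U0// green_sym.
(* Kernel section and eigenfunction each vanish to order r at both ends, so their product vanishes
   to order 2r. *)
- move=> x j axb jr; split; apply: (@leibniz_eq0 _ _ _ _ _ r r); try lia.
  + by move=> i ir; case: (dgreen_bc ab axb ir).
  + by move=> i ir; case: (Ubc i ir).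
  + by move=> i ir; case: (dgreen_bc ab axb ir).
  + by move=> i ir; case: (Ubc i ir).
have /choice[M HM] : forall i : 'I_(2 * r), exists M, 0 <= M /\ forall y, a <= y <= b -> `|U i y| <= M.
  move=> i; have [|M M0 HM] := cont_on_bounded (ltW ab) (cU.1 i _); first exact: ltnW.
  by exists M.
have S0 : 0 <= \sum_i M i by apply: sumr_ge0 => i _; case: (HM i).
exists (2 ^+ (2 * r - 2) * (K * \sum_i M i)).
  by rewrite mulr_ge0 ?exprn_ge0// mulr_ge0.
move=> x y axb ayb; apply: leibniz_le => // i ir; first exact: HK.
have ir' : (i < 2 * r)%N by lia.
rewrite (le_trans ((HM (Ordinal ir')).2 y ayb))// (bigD1 (Ordinal ir'))//= lerDl.
by apply: sumr_ge0 => j _; case: (HM j).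
Qed.

(** This is [trapezoid_error] of order 2r-2 for y |-> [G x y * phi y], whose top derivative is
    bounded uniformly in x; the exact integral is [mu * phi x]. *)
Lemma quad_green_error mu phi : mu != 0 -> eig mu phi -> exists2 C : R, 0 < C &
  forall m x, a <= x <= b ->
    `|quad a b m (fun y => G x y * phi y) - mu * phi x| <= C * h m ^+ (2 * r - 2).
Proof.
move=> mu0 ep; have [U [cF F0 Fbc [C C0 HC]]] := green_mul_chain mu0 ep.
have ba : 0 < b - a by rewrite subr_gt0.
exists (C * (b - a) + 1); first by rewrite ltr_wpDl// mulr_ge0// ltW.
move=> m x axb; have hm := mesh_gt0 ab m.
have N0 : (0 < 2 * r - 2)%N by lia.
have Fbc' j : (j < 2 * r - 2)%N -> leibniz j (fun i => dgreen a b r i x) U a = 0 /\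
    leibniz j (fun i => dgreen a b r i x) U b = 0.
  by move=> jr; apply: Fbc => //; lia.
have H := trapezoid_error ab m N0 C0 (cF x axb) Fbc' (fun y ayb => HC x y axb ayb).
have [_ <-//] := ep.
have -> : quad a b m (fun y => G x y * phi y) =
    quad a b m (leibniz 0 (fun i => dgreen a b r i x) U).
  rewrite /quad; congr (_ * _); apply: eq_bigr => l _; apply: F0 => //.
  exact: node_ord.
have -> : kop a b G phi x = INT a b (leibniz 0 (fun i => dgreen a b r i x) U).
  by apply: eq_INT => y ayb; apply: F0.
by rewrite (le_trans H)// ler_wpM2r ?exprn_ge0 ?(ltW hm)// lerDl.
Qed.

(** Lets this maximum be absorbed in the constant. Take z with [phi z] nonzero: if the top
    derivative at x = z vanished for all y, so would the clamped product, hence its integral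
    [mu * phi z]. *)
Lemma max_abs2_gt0 (g : R -> R -> R) mu phi : mu != 0 -> eig mu phi ->
  (forall x y, a <= x <= b -> a <= y <= b -> g x y = G x y) ->
  (exists2 x, a <= x <= b & phi x != 0) ->
  0 < max_abs2 a b (fun x => derive_itvn a b (2 * r - 2) (fun y => g x y * phi y)).
Proof.
move=> mu0 ep gG [z azb phiz]; have [U [cF F0 Fbc [C C0 HC]]] := green_mul_chain mu0 ep.
have D x y : a <= x <= b -> a <= y <= b ->
    derive_itvn a b (2 * r - 2) (fun y => g x y * phi y) y =
    leibniz (2 * r - 2) (fun i => dgreen a b r i x) U y.
  move=> axb ayb; apply: (derive_itvn_chain ab (cF x axb)) => // t atb.
  by rewrite gG// F0.
have [y ayb Fy] : exists2 y, a <= y <= b &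
    leibniz (2 * r - 2) (fun i => dgreen a b r i z) U y != 0.
  apply: contrapT => /forall2NP H; move/eqP: phiz; apply.
  apply: (mulfI mu0); rewrite mulr0; have [_ <-//] := ep.
  rewrite /kop (@eq_INT _ _ _ _ (fun=> 0)) ?INT0// => t atb; rewrite F0//.
  apply/eqP; rewrite -normr_le0 -[leRHS](mul0r ((b - a) ^+ (2 * r - 2))).
  apply: (chain_le (ltW ab) (lexx 0) (cF z azb)) => //.
    move=> j jr; exists a; first by rewrite lexx ltW.
    by case: (Fbc z j azb); first lia.
  by move=> s asb; case: (H s) => // /negP; rewrite negbK => /eqP ->; rewrite normr0.
rewrite (@lt_le_trans _ _ `|leibniz (2 * r - 2) (fun i => dgreen a b r i z) U y|) ?normr_gt0//.
apply: ub_le_sup.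
  exists C => _ [x xab [t tab <-]]; move: xab tab; rewrite /= !in_itv/= => axb atb.
  by rewrite D// HC.
by exists z; [rewrite /= in_itv|exists y; [rewrite /= in_itv|rewrite /= D]].
Qed.

(** Passes from sequences to a bound uniform over all eigenvalue lists: at each m pick a list
    violating [P] if there is one. *)
Lemma discrete_near (P : nat -> (nat -> R) -> Prop) (K : R -> R -> R) :
  (forall m, exists mu, discrete_eigenvalues a b K m mu) ->
  (forall mus : nat -> nat -> R, (forall m, discrete_eigenvalues a b K m (mus m)) ->
     \forall m \near \oo, P m (mus m)) ->
  \forall m \near \oo, forall mu, discrete_eigenvalues a b K m mu -> P m mu.
Proof.
move=> /choice[mus0 H0] H.
have /choice[mus Hmus] : forall m, exists mu, discrete_eigenvalues a b K m mu /\
    (P m mu -> forall mu, discrete_eigenvalues a b K m mu -> P m mu).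
  move=> m; have [[mu [dmu nP]]|nE] :=
    pselect (exists mu, discrete_eigenvalues a b K m mu /\ ~ P m mu).
    by exists mu; split=> // /nP.
  exists (mus0 m); split=> // _ mu dmu; apply: contrapT => nP.
  by apply: nE; exists mu.
have := H mus (fun m => (Hmus m).1); apply: filterS => m Pm.
exact: (Hmus m).2.
Qed.

Lemma green_hyps : exists2 B : R, 0 <= B & [/\
  (forall x y, a <= x <= b -> a <= y <= b -> G x y = G y x),
  (forall y, a <= y <= b -> lip_on a b B (G^~ y)) &
  (forall x y, a <= x <= b -> a <= y <= b -> `|G x y| <= B)].
Proof.
have [C C0 [lC bC]] := green_lip_bounded ab r2; exists C => //; split=> //.
exact: green_sym.
Qed.

Section Cfs.
Variables (lam : nat -> R) (phi : nat -> R -> R).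
Hypothesis cf : cfs a b G lam phi.

Lemma discrete_limit (mus : nat -> nat -> R) :
  (forall m, discrete_eigenvalues a b G m (mus m)) ->
  forall j, mus m j.+1 @[m --> \oo] --> lam j.
Proof.
have [B B0 [sG lG bG]] := green_hyps.
have [lam' [phi' [cf' H]]] := cfs_limit ab B0 B0 sG lG bG (green_pos ab r2).
move=> Hmus j; have -> : lam j = lam' j; last exact: H.
by apply/eqP; rewrite eq_le (cfs_le sG lG cf cf') (cfs_le sG lG cf' cf).
Qed.

Definition separated k gam m (mu : nat -> R) := [/\ (k < m)%N,
  forall j, (j < m)%N -> j != k -> gam <= `|mu j.+1 - lam k| &
  `|mu k.+1 - lam k| <= gam / 2].

(** The neighbours of [lam k] are at distance at least twice [gam]. Once the neighbouring discrete
    eigenvalues are within [gam] of their limits, monotonicity keeps all the others at least [gam]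
    away from [lam k]. The bound [gam <= lam k] later ensures that the k-th discrete eigenvalue is
    not 0. *)
Lemma spectral_gap k : exists2 gam, 0 < gam <= lam k & \forall m \near \oo,
  forall mu, discrete_eigenvalues a b G m mu -> separated k gam m mu.
Proof.
have [B B0 [sG lG bG]] := green_hyps.
(* [lam 0] has no larger neighbour, so [g2] is then set to [g1]. *)
pose g1 := lam k - lam k.+1; pose g2 := if k is k'.+1 then lam k' - lam k else g1.
have g10 : 0 < g1 by rewrite subr_gt0 (cfs_strict ab r2 cf).
have g20 : 0 < g2.
  by rewrite /g2; case: (k) => // k'; rewrite subr_gt0 (cfs_strict ab r2 cf).
pose gam : R := Num.min g1 g2 / 2.
have gam0 : 0 < gam by rewrite divr_gt0// lt_min g10.
have gg1 : 2 * gam <= g1 by rewrite mulrC divfK// ge_min lexx.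
have gg2 : 2 * gam <= g2 by rewrite mulrC divfK// ge_min lexx orbT.
exists gam.
  by have := cfs_pos cf k.+1; move: gg1; rewrite gam0 /g1/=; lra.
apply: discrete_near.
  by move=> m; exact: (discrete_eigenvalues_exist ab B0 B0 sG).
move=> mus Hmus; have lim j := discrete_limit Hmus (j := j).
have gam2 : 0 < gam / 2 by rewrite divr_gt0.
have N1 := cvgr_dist_le _ _ (lim k) _ gam2; have N2 := cvgr_dist_le _ _ (lim k.+1) _ gam0.
have N3 := cvgr_dist_le _ _ (lim k.-1) _ gam0.
near=> m.
have h1 : `|lam k - mus m k.+1| <= gam / 2 by near: m; exact: N1.
have h2 : `|lam k.+1 - mus m k.+2| <= gam by near: m; exact: N2.
have h3 : `|lam k.-1 - mus m k.-1.+1| <= gam by near: m; exact: N3.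
have km : (k.+1 < m)%N by near: m; exact: nbhs_infty_gt.
have [_ mono] := Hmus m.
split; [exact: ltnW| |by rewrite distrC].
move=> j jm; rewrite neq_ltn => /orP[jk|kj].
- have k0 : (0 < k)%N by exact: leq_ltn_trans jk.
  have mj : mus m k <= mus m j.+1 by apply: mono => //; lia.
  move: h3 gg2; rewrite /g2 -(prednK k0)/= ler_norml => h3 gg2.
  rewrite ger0_norm; last by move: mj h3 gg2; rewrite -(prednK k0); lra.
  by move: mj h3 gg2; rewrite -(prednK k0); lra.
- have mj : mus m j.+1 <= mus m k.+2 by apply: mono => //; lia.
  move: h2 gg1; rewrite /g1 ler_norml => h2 gg1.
  rewrite ler0_norm; last by lra.
  by lra.
Unshelve. all: by end_near. Qed.

End Cfs.
End Rates.

(** * From the residual to eigenvalue and eigenfunction errors *)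

Section EigenvalueRates.
Variable R : realType.
Variables (a b : R) (r : nat).
Hypothesis ab : a < b.
Hypothesis r2 : (2 <= r)%N.
Implicit Types (x y c : R) (phi psi w : R -> R).
Local Notation G := (green a b r).
Local Notation eig := (eigfun a b r).
Local Notation h := (mesh a b).
Local Notation nd := (node a b).

Lemma dipBl m (u v w : nat -> R) c :
  dip a b m (fun l => u l - c * v l) w = dip a b m u w - c * dip a b m v w.
Proof.
rewrite /dip mulrCA -mulrBr; congr (_ * _); rewrite mulr_sumr -sumrB.
by apply: eq_bigr => l _; ring.
Qed.

Lemma dip_le m (u : nat -> R) E : (forall l : 'I_m, `|u l| <= E) ->
  dip a b m u u <= E ^+ 2 * (b - a).
Proof.
move=> uE; have hm := mesh_gt0 ab m.
rewrite /dip (@le_trans _ _ (h m * (m%:R * E ^+ 2)))//.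
  rewrite ler_wpM2l ?(ltW hm)// mulr_natl -[in leRHS](card_ord m) -sumr_const.
  apply: ler_sum => l _; rewrite -expr2 -(real_normK (num_real (u l))).
  by rewrite lerXn2r ?nnegrE//; exact: le_trans (uE l).
rewrite mulrA (mulrC _ (E ^+ 2)) ler_wpM2l ?sqr_ge0// mulrC -(mesh_sum a b m).
by rewrite ler_wpM2r ?(ltW hm)// ler_nat.
Qed.

Lemma discrete_eigenfunction_cont m mu phih :
  discrete_eigenfunction a b G m mu phih -> cont_on a b phih.
Proof.
move=> [v [_ Hv _]]; have [B B0 [_ lG _]] := green_hyps ab r2.
apply: (eq_cont_on (f := fun x => h m / mu * \sum_(l < m) v l ord0 * G x (nd m l.+1))).
  apply: cont_onZ; apply: cont_on_sum => l _; apply: cont_onZ.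
  by apply: lip_on_cont (lG _ _); exact: node_ord.
move=> x axb; rewrite Hv ?in_itv//; congr (_ * _).
by apply: eq_bigr => l _; rewrite mulrC.
Qed.

Section Expansion.
Variables (m : nat) (mu : nat -> R) (W : nat -> nat -> R).
Hypothesis HW : dspec a b G m mu W.
Variables (lambda E : R) (phi : R -> R).
Hypothesis res : forall x, a <= x <= b ->
  `|quad a b m (fun y => G x y * phi y) - lambda * phi x| <= E.
Local Notation d j := (dip a b m (fun l => phi (nd m l.+1)) (W j)).

Let Gsym := fun x y => @green_sym R a b r ab r2 x y.

(** The residual of the samples of [phi] has component [(mu j.+1 - lambda) * d j] along [W j];
    conclude by Parseval. *)
Lemma residual_expansion :
  \sum_(j < m) ((mu j.+1 - lambda) * d j) ^+ 2 <= E ^+ 2 * (b - a).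
Proof.
pose u l := phi (nd m l.+1).
pose rs l := dapp a b G m u l - lambda * u l.
have [_ _ pW] := HW.
have dj (j : 'I_m) : dip a b m rs (W j) = (mu j.+1 - lambda) * d j.
  by rewrite dipBl (dip_dapp ab Gsym HW)// mulrBl.
under eq_bigr => j _ do rewrite -dj expr2.
by rewrite -pW; apply: dip_le => l; apply: res; exact: node_ord.
Qed.

Variables (k : nat) (gam : R).
Hypothesis gam0 : 0 < gam.
Hypothesis km : (k < m)%N.
Hypothesis gap : forall j, (j < m)%N -> j != k -> gam <= `|mu j.+1 - lambda|.

Lemma tail_expansion :
  \sum_(j < m | j != Ordinal km) d j ^+ 2 <= E ^+ 2 * ((b - a) / gam ^+ 2).
Proof.
rewrite mulrA ler_pdivlMr ?exprn_gt0//; apply: le_trans residual_expansion.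
rewrite mulr_suml [leRHS](bigD1 (Ordinal km))//=.
rewrite -[leLHS]add0r lerD ?sqr_ge0//; apply: ler_sum => j jk.
rewrite [leRHS]exprMn [leLHS]mulrC; apply: ler_wpM2r; rewrite ?sqr_ge0// -[leRHS](real_normK (num_real _)).
by rewrite lerXn2r ?nnegrE ?(ltW gam0)//; apply: gap.
Qed.

Lemma eigenvalue_bound I : 0 < I -> I / 2 <= quad a b m (fun x => phi x * phi x) ->
  E ^+ 2 * ((b - a) / gam ^+ 2) <= I / 4 ->
  (mu k.+1 - lambda) ^+ 2 * (I / 4) <= E ^+ 2 * (b - a).
Proof.
move=> I0 qI EI; have [_ _ pW] := HW.
have : quad a b m (fun x => phi x * phi x) = \sum_(j < m) d j ^+ 2.
  exact: (pW (fun l => phi (nd m l.+1)) (fun l => phi (nd m l.+1))).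
rewrite (bigD1 (Ordinal km))//= => e.
have dk : I / 4 <= d k ^+ 2 by have := tail_expansion; lra.
apply: le_trans residual_expansion; rewrite (bigD1 (Ordinal km))//=.
rewrite -[leLHS]addr0 lerD//; last by apply: sumr_ge0 => j _; exact: sqr_ge0.
by rewrite [leRHS]exprMn ler_wpM2l ?sqr_ge0.
Qed.

Variable phih : R -> R.
Hypothesis E0 : 0 < E.
Hypothesis l0 : 0 < lambda.
Hypothesis muk : mu k.+1 != 0.
Hypothesis close : `|mu k.+1 - lambda| <= gam / 2.
Hypothesis dphih : discrete_eigenfunction a b G m (mu k.+1) phih.
Hypothesis cphi : cont_on a b phi.
Hypothesis phi1 : max_abs a b phi = 1.
Variable B : R.
Hypothesis GB : forall x y, a <= x <= b -> a <= y <= b -> `|G x y| <= B.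

(** The gap separates [mu k.+1] from the other discrete eigenvalues, so the eigenvector defining
    [phih] is orthogonal to the other [W j] and proportional to [W k]; the factor is nonzero because
    [phih] has maximum 1. *)
Lemma eigenfunction_multiple : exists2 t, t != 0 & forall x, a <= x <= b ->
  mu k.+1 * phih x = t * dip a b m (fun l => G x (nd m l.+1)) (W k).
Proof.
have [v [Dv Hv mx]] := dphih; have [_ _ pW] := HW.
pose u l := oapp (fun l' : 'I_m => v l' ord0) 0 (insub l).
have uE (l : 'I_m) : u l = v l ord0 by rewrite /u valK.
have eu (i : 'I_m) : dapp a b G m u i = mu k.+1 * u i.
  have := congr1 (fun M : 'cV[R]_m => M i 0) Dv; rewrite !mxE -uE => <-.
  by rewrite /dapp mulr_sumr; apply: eq_bigr => l _; rewrite !mxE uE mulrA.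
have uW (j : 'I_m) : j != Ordinal km -> dip a b m u (W j) = 0.
  move=> jk; have := dip_dapp ab Gsym HW u (ltn_ord j).
  rewrite (_ : dip _ _ _ _ _ = mu k.+1 * dip a b m u (W j)); last first.
    by rewrite /dip mulrCA; congr (_ * _); rewrite mulr_sumr; apply: eq_bigr => l _; rewrite eu mulrA.
  move/eqP; rewrite -subr_eq0 -mulrBl mulf_eq0 => /orP[|/eqP//].
  rewrite subr_eq0 => /eqP e; have := gap (ltn_ord j) jk; rewrite -e => g1.
  by have := le_trans g1 close; have g0 := gam0; lra.
have H x : a <= x <= b -> mu k.+1 * phih x =
    dip a b m u (W k) * dip a b m (fun l => G x (nd m l.+1)) (W k).
  move=> axb; rewrite Hv ?in_itv// mulrA (mulrC (h m)) mulrA mulfV// mul1r.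
  have -> : h m * \sum_(l < m) G x (nd m l.+1) * v l ord0 =
      dip a b m u (fun l => G x (nd m l.+1)).
    by rewrite /dip; congr (_ * _); apply: eq_bigr => l _; rewrite uE mulrC.
  rewrite pW (bigD1 (Ordinal km))//= big1 ?addr0// => j jk.
  by rewrite uW// mul0r.
exists (dip a b m u (W k)) => //; apply/eqP => t0.
have : max_abs a b phih <= 0.
  apply: (max_abs_le ab) => x /H; rewrite t0 mul0r => /eqP.
  by rewrite mulf_eq0 (negbTE muk)/= => /eqP ->; rewrite normr0.
by rewrite mx ler10.
Qed.

(** The pointwise residual contributes 1 and the two halves of the AM-GM estimate of the tail
    contribute the rest; dividing by [lambda] recovers [phi] from [lambda * phi]. *)
Definition rate_const := (1 + (B ^+ 2 * (b - a) + (b - a) / gam ^+ 2)) / lambda.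

(* AM-GM on the components of phi along the other discrete eigenvectors *)
Lemma eigenfunction_near_multiple : exists beta, forall x, a <= x <= b ->
  `|phi x - beta * phih x| <= E * rate_const.
Proof.
have [t t0 Ht] := eigenfunction_multiple; have [_ _ pW] := HW.
(* With this factor, [beta * phih x] is the k-th term in the eigenbasis expansion of the quadrature
   of [G x y * phi y], divided by [lambda]. *)
exists (d k * mu k.+1 / (lambda * t)) => x axb.
pose Gx (l : nat) := G x (nd m l.+1).
have e1 : d k * mu k.+1 / (lambda * t) * phih x = d k * dip a b m Gx (W k) / lambda.
  have -> : d k * mu k.+1 / (lambda * t) * phih x = d k * (mu k.+1 * phih x) / (lambda * t).
    by ring.
  by rewrite Ht//; field; rewrite t0 gt_eqF.
rewrite e1 /rate_const mulrA ler_pdivlMr// -[X in _ * X](gtr0_norm l0) -normrM.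
have -> : (phi x - d k * dip a b m Gx (W k) / lambda) * lambda =
    lambda * phi x - d k * dip a b m Gx (W k).
  by rewrite mulrBl divfK ?gt_eqF// mulrC.
have : quad a b m (fun y => G x y * phi y) = dip a b m Gx (W k) * d k +
    \sum_(j < m | j != Ordinal km) dip a b m Gx (W j) * d j.
  have -> : quad a b m (fun y => G x y * phi y) = dip a b m Gx (fun l => phi (nd m l.+1)) by [].
  by rewrite pW (bigD1 (Ordinal km)).
set T := \sum_(j < m | _) _ => e2; have r1 := res axb; rewrite e2 in r1.
have Tle : `|T| <= E * (B ^+ 2 * (b - a)) + E * ((b - a) / gam ^+ 2).
  have G2 : \sum_(j < m | j != Ordinal km) dip a b m Gx (W j) ^+ 2 <= B ^+ 2 * (b - a).
    apply: (@le_trans _ _ (dip a b m Gx Gx)).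
      rewrite pW [leRHS](bigD1 (Ordinal km))//= -[leLHS]add0r lerD//.
      by rewrite -expr2 sqr_ge0.
    by apply: dip_le => l; apply: GB => //; exact: node_ord.
  have D2 := tail_expansion.
  apply: (@le_trans _ _ (\sum_(j < m | j != Ordinal km)
      (E * dip a b m Gx (W j) ^+ 2 + E^-1 * d j ^+ 2))).
    rewrite (le_trans (ler_norm_sum _ _ _))//; apply: ler_sum => j _.
    rewrite normrM -(real_normK (num_real (dip a b m Gx (W j)))).
    rewrite -(real_normK (num_real (d j))).
    set p := `|dip _ _ _ Gx _|; set q := `|d j|.
    have -> : E * p ^+ 2 + E^-1 * q ^+ 2 = E^-1 * ((E * p) ^+ 2 + q ^+ 2).
      by field; rewrite gt_eqF.
    rewrite [leRHS]mulrC ler_pdivlMr//.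
    have pp : 0 <= p := normr_ge0 _; have qq : 0 <= q := normr_ge0 _.
    have := sqr_ge0 (E * p - q); have := mulr_ge0 (mulr_ge0 (ltW E0) pp) qq.
    rewrite !expr2; nra.
  rewrite big_split/= -!mulr_sumr lerD//; first by rewrite ler_wpM2l// ltW.
  rewrite [leLHS]mulrC ler_pdivrMr// (le_trans D2)// le_eqVlt; apply/orP; left.
  by apply/eqP; ring.
have -> : lambda * phi x - d k * dip a b m Gx (W k) =
   - (dip a b m Gx (W k) * d k + T - lambda * phi x) + T by ring.
rewrite (le_trans (ler_normD _ _))// normrN mulrDr mulr1 lerD// mulrDr.
exact: Tle.
Qed.

(** Both functions have maximum 1, so [|beta|] differs from 1 by at most the same error; replacing
    [beta] by its sign costs that error once more. *)
Lemma eigenfunction_bound : exists s : R, (s = 1 \/ s = -1) /\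
  max_abs a b (fun x => phi x - s * phih x) <= 2 * (E * rate_const).
Proof.
have [beta] := eigenfunction_near_multiple; set del := E * _ => H.
have cph := discrete_eigenfunction_cont dphih.
have [v [_ _ mx]] := dphih.
have del0 : 0 <= del by apply: le_trans (normr_ge0 _) (H a _); rewrite lexx ltW.
have le1 : 1 - `|beta| <= del.
  rewrite lerBlDr -phi1; apply: (max_abs_le ab) => x axb.
  rewrite -[phi x](subrK (beta * phih x)) (le_trans (ler_normD _ _))// lerD ?H//.
  by rewrite normrM ler_piMr// -mx max_abs_ge.
have le2 : `|beta| - 1 <= del.
  have [->|b0] := eqVneq beta 0; first by rewrite normr0; lra.
  rewrite lerBlDr -[leLHS]mulr1 -mx mulrC -ler_pdivlMr ?normr_gt0//.
  apply: (max_abs_le ab) => x axb.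
  rewrite ler_pdivlMr ?normr_gt0// -normrM mulrC.
  have -> : beta * phih x = - (phi x - beta * phih x) + phi x by ring.
  rewrite (le_trans (ler_normD _ _))// normrN lerD ?H// mx -phi1 max_abs_ge//.
pose s : R := if 0 <= beta then 1 else -1.
have sb : `|beta - s| <= del.
  rewrite /s; case: ifPn => b0.
    by move: le1 le2; rewrite ger0_norm// ler_norml; lra.
  by move: le1 le2 b0; rewrite -ltNge => le1 le2 b0; move: le1 le2; rewrite ltr0_norm// ler_norml; lra.
exists s; split; first by rewrite /s; case: ifP; [left|right].
apply: (max_abs_le ab) => x axb.
have -> : phi x - s * phih x = (phi x - beta * phih x) + (beta - s) * phih x by ring.
rewrite (le_trans (ler_normD _ _))// mulr_natl mulr2n lerD ?H// normrM.
rewrite (le_trans _ sb)// ler_piMr// -mx max_abs_ge//.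
Qed.

End Expansion.
End EigenvalueRates.

(** * Convergence rates for all meshes *)

Section Rates.
Variable R : realType.
Variables (a b : R) (r : nat).
Hypothesis ab : a < b.
Hypothesis r2 : (2 <= r)%N.
Implicit Types (x y c : R) (phi psi w : R -> R).
Local Notation G := (green a b r).
Local Notation eig := (eigfun a b r).
Local Notation h := (mesh a b).

(** Meshes coarser than [h m0] number finitely many, and on them the a priori bound [M] is at most
    [|M| / h m0 ^+ N] times [h m ^+ N]. *)
Lemma bound_of_near (Q : nat -> R -> Prop) N C M :
  (forall m s t, s <= t -> Q m s -> Q m t) -> 0 < C ->
  (\forall m \near \oo, Q m (C * h m ^+ N)) -> (forall m, Q m M) ->
  exists2 D, 0 < D & forall m, Q m (D * h m ^+ N).
Proof.
move=> Qmono C0 [m0 _ Hm0] HM.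
pose t := h m0 ^+ N; have t0 : 0 < t by rewrite exprn_gt0// mesh_gt0.
exists (C + `|M| / t); first by rewrite ltr_wpDr// divr_ge0// ltW.
move=> m; have hN : 0 <= h m ^+ N by rewrite exprn_ge0// ltW// mesh_gt0.
have [mm|mm] := leqP m0 m.
  by apply: Qmono (Hm0 m mm); rewrite ler_wpM2r// lerDl divr_ge0// ltW.
apply: Qmono (HM m); rewrite (le_trans (ler_norm M))//.
rewrite mulrDl -[leLHS]add0r lerD//; first by rewrite mulr_ge0// ltW.
rewrite mulrAC ler_pdivlMr// ler_wpM2l// lerXn2r ?nnegrE ?(ltW (mesh_gt0 ab _))//.
rewrite /mesh ler_wpM2l ?subr_ge0 ?(ltW ab)// lef_pV2 ?posrE ?ltr0n// ler_nat.
by rewrite ltnS ltnW.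
Qed.

Lemma cvg_pow (f : nat -> R) (l : R) n : f m @[m --> \oo] --> l ->
  f m ^+ n @[m --> \oo] --> l ^+ n.
Proof.
move=> fl; elim: n => [|n ih]; first exact: cvg_cst.
by rewrite exprS; under eq_cvg do rewrite exprS; exact: cvgM.
Qed.

Lemma cvg_mesh : h m @[m --> \oo] --> (0 : R).
Proof.
rewrite -[X in _ --> X](mulr0 (b - a)); apply: cvgM; first exact: cvg_cst.
exact: cvg_harmonic.
Qed.

Lemma cvg_mesh_pow C N : (0 < N)%N -> C * h m ^+ N @[m --> \oo] --> (0 : R).
Proof.
move=> N0; rewrite -[X in _ --> X](mulr0 C); apply: cvgM; first exact: cvg_cst.
have -> : (0 : R) = 0 ^+ N by rewrite expr0n gtn_eqF.
by apply: cvg_pow; exact: cvg_mesh.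
Qed.

Lemma cvg_quad L psi : 0 <= L -> lip_on a b L psi -> quad a b m psi @[m --> \oo] --> INT a b psi.
Proof.
move=> L0 lpsi; have [B B0 HB] := lip_bounded ab L0 lpsi.
apply/cvgrPdist_le => e e0.
have H0 := cvgr_dist_le _ _ (cvg_mesh_pow (L * (b - a) + B) (ltn0Sn 0)) _ e0.
near=> m; rewrite distrC.
have : `|0 - (L * (b - a) + B) * h m ^+ 1| <= e by near: m; exact: H0.
rewrite sub0r normrN expr1 => H.
apply: (le_trans (riemann_error ab m L0 B0 lpsi HB)).
exact: le_trans (ler_norm _) H.
Unshelve. all: by end_near. Qed.

Section Cfs.
Variables (lam : nat -> R) (phi : nat -> R -> R).
Hypothesis cf : cfs a b G lam phi.

Lemma rate_eigenvalue k : exists2 C : R, 0 < C & forall m mu, (k < m)%N ->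
  discrete_eigenvalues a b G m mu -> `|mu k.+1 - lam k| <= C * h m ^+ (2 * r - 2).
Proof.
have [B B0 [sG lG bG]] := green_hyps ab r2.
have lk := cfs_pos cf k; have lk0 : lam k != 0 by rewrite gt_eqF.
have [C C0 HC] := quad_green_error ab r2 lk0 (cfs_eigfun cf k).
have [gam /andP[gam0 _] Hgam] := spectral_gap ab r2 cf k.
have ba : 0 < b - a by rewrite subr_gt0.
(* [S ^+ 2] dominates [4 * (b - a)], the factor by which [eigenvalue_bound] with I = 1 multiplies
   the squared residual. *)
pose S := 2 * (b - a) + 1; have S0 : 0 < S by rewrite /S; lra.
have N0 : (0 < 2 * r - 2)%N by lia.
pose Q m t := forall mu, (k < m)%N -> discrete_eigenvalues a b G m mu -> `|mu k.+1 - lam k| <= t.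
have [||||D D0 HD] := @bound_of_near Q (2 * r - 2) (C * S) (B * mean_bound a b ^+ 2 + lam k); last 1 first.
- by exists D.
- by move=> m s t st H mu km dmu; exact: le_trans (H mu km dmu) st.
- exact: mulr_gt0.
- have [M M0 lM] : exists2 M, 0 <= M & lip_on a b M (phi k) by case: cf.
  have [P P0 HP] := lip_bounded ab M0 lM.
  have cq : quad a b m (fun x => phi k x * phi k x) @[m --> \oo] --> (1 : R).
    have <- : INT a b (fun x => phi k x * phi k x) = 1 by case: cf => _ _ _ -> _; rewrite eqxx.
    by apply: cvg_quad (lip_onM lM lM HP HP); rewrite addr_ge0// mulr_ge0.
  have h2 : (1 / 2 : R) < 1 by lra.
  have n1 := cvgr_ge _ cq _ h2.
  have T0 : (0 : R) < 1 / 4 by lra.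
  have n2 : \forall m \near \oo, (C * h m ^+ (2 * r - 2)) ^+ 2 * ((b - a) / gam ^+ 2) <= 1 / 4.
    have c0 : (C * h m ^+ (2 * r - 2)) ^+ 2 * ((b - a) / gam ^+ 2) @[m --> \oo] --> (0 : R).
      rewrite -[X in _ --> X](mul0r ((b - a) / gam ^+ 2)).
      apply: cvgM; last exact: cvg_cst.
      rewrite -[X in _ --> X](expr0n R 2); apply: cvg_pow; exact: cvg_mesh_pow.
    exact: cvgr_le _ c0 _ T0.
  near=> m; move=> mu km dmu.
  have Hg : forall mu, discrete_eigenvalues a b G m mu -> separated lam k gam m mu.
    by near: m; exact: Hgam.
  have q1 : 1 / 2 <= quad a b m (fun x => phi k x * phi k x) by near: m; exact: n1.
  have q2 : (C * h m ^+ (2 * r - 2)) ^+ 2 * ((b - a) / gam ^+ 2) <= 1 / 4.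
    by near: m; exact: n2.
  have [W HW] := dspec_exists ab sG dmu; have [_ gap close] := Hg mu dmu.
  have := eigenvalue_bound ab r2 HW (HC m) gam0 km gap ltr01 q1 q2.
  set E := C * _; have E0 : 0 < E by rewrite mulr_gt0// exprn_gt0// mesh_gt0.
  move=> H; rewrite mulrAC -/E -(ger0_norm (ltW (mulr_gt0 E0 S0))).
  rewrite -(@ler_pXn2r _ 2) ?nnegrE// !real_normK ?num_real// exprMn.
  have : E ^+ 2 * (4 * (b - a)) <= E ^+ 2 * S ^+ 2.
    rewrite ler_wpM2l ?sqr_ge0// /S !expr2; nra.
  by apply: le_trans; move: H; lra.
- move=> m mu km dmu; have [W HW] := dspec_exists ab sG dmu.
  rewrite (le_trans (ler_normB _ _))// lerD//; last by rewrite gtr0_norm.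
  exact: (abs_mu ab B0 sG bG HW).
Unshelve. all: by end_near. Qed.

Lemma rate_eigenfunction k psi : eig (lam k) psi -> max_abs a b psi = 1 ->
  exists2 C : R, 0 < C & forall m mu phih, (k < m)%N ->
    discrete_eigenvalues a b G m mu -> discrete_eigenfunction a b G m (mu k.+1) phih ->
    exists s : R, (s = 1 \/ s = -1) /\
      max_abs a b (fun x => psi x - s * phih x) <= C * h m ^+ (2 * r - 2).
Proof.
move=> epsi psi1; have [B B0 [sG lG bG]] := green_hyps ab r2.
have lk := cfs_pos cf k; have lk0 : lam k != 0 by rewrite gt_eqF.
have [C C0 HC] := quad_green_error ab r2 lk0 epsi.
have [gam /andP[gam0 gl] Hgam] := spectral_gap ab r2 cf k.
have ba : 0 < b - a by rewrite subr_gt0.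
have N0 : (0 < 2 * r - 2)%N by lia.
pose Q m t := forall mu phih, (k < m)%N ->
    discrete_eigenvalues a b G m mu -> discrete_eigenfunction a b G m (mu k.+1) phih ->
    exists s : R, (s = 1 \/ s = -1) /\ max_abs a b (fun x => psi x - s * phih x) <= t.
pose K := rate_const a b (lam k) gam B.
have K0 : 0 < K.
  rewrite divr_gt0// ltr_wpDr ?ltr01// addr_ge0//.
    by rewrite mulr_ge0 ?sqr_ge0// ltW.
  by rewrite divr_ge0 ?sqr_ge0// ltW.
have [||||D D0 HD] := @bound_of_near Q (2 * r - 2) (2 * K * C) 2; last 1 first.
- by exists D.
- move=> m s t st H mu phih km dmu df; have [s' [s1 Hs]] := H mu phih km dmu df.
  by exists s'; split => //; exact: le_trans st.
- by rewrite mulr_gt0// mulr_gt0.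
- apply: (filterS _ Hgam) => m Hg mu phih km dmu df.
  have [W HW] := dspec_exists ab sG dmu; have [_ gap close] := Hg mu dmu.
  have E0 : 0 < C * h m ^+ (2 * r - 2) by rewrite mulr_gt0// exprn_gt0// mesh_gt0.
  have mu0 : mu k.+1 != 0.
    by apply: contraTneq close => ->; rewrite sub0r normrN gtr0_norm// -ltNge; lra.
  have [s [s1 Hs]] := eigenfunction_bound ab r2 HW (HC m) gam0 km gap E0 lk mu0 close df
    epsi.1 psi1 bG.
  by exists s; split=> //; rewrite (le_trans Hs)// -/K le_eqVlt; apply/orP; left; apply/eqP; ring.
- move=> m mu phih km dmu df; exists 1; split; first by left.
  have [v [_ _ mx]] := df; have cph := discrete_eigenfunction_cont ab r2 df.
  have [cpsi _] := epsi.
  apply: (max_abs_le ab) => x axb; rewrite mul1r (le_trans (ler_normB _ _))//.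
  have H1 : `|psi x| <= 1 by rewrite -psi1 max_abs_ge.
  have H2 : `|phih x| <= 1 by rewrite -mx max_abs_ge.
  by lra.
Qed.

End Cfs.
End Rates.

(** * The eigenpair estimate for a given Green's function *)

Section EigenpairRates.
Variable R : realType.
Variables (a b : R) (r : nat).
Hypothesis ab : a < b.
Hypothesis r2 : (2 <= r)%N.
Variable g : R -> R -> R.
Local Notation G := (green a b r).
Hypothesis gG : forall x y, a <= x <= b -> a <= y <= b -> g x y = G x y.
Local Notation h := (mesh a b).

Lemma green_discrete_matrix m : discrete_matrix a b g m = discrete_matrix a b G m.
Proof. by apply/matrixP => i j; rewrite !mxE gG//; exact: node_ord. Qed.

Lemma green_discrete_eigenvalues m mu :
  discrete_eigenvalues a b g m mu -> discrete_eigenvalues a b G m mu.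
Proof. by rewrite /discrete_eigenvalues green_discrete_matrix. Qed.

Lemma green_discrete_eigenfunction m (mu : R) psi :
  discrete_eigenfunction a b g m mu psi -> discrete_eigenfunction a b G m mu psi.
Proof.
move=> [v [Dv Hv mx]]; exists v; split=> //; first by rewrite -green_discrete_matrix.
move=> x xab; have axb : a <= x <= b by move: xab; rewrite in_itv.
rewrite Hv//; congr (_ * _); apply: eq_bigr => l _; rewrite gG//.
exact: node_ord.
Qed.

Lemma green_cfs : exists lam phi, cfs a b G lam phi.
Proof.
have [B B0 [sG lG bG]] := green_hyps ab r2.
have [lam [phi [cf _]]] := cfs_limit ab B0 B0 sG lG bG (green_pos ab r2).
by exists lam, phi.
Qed.

Theorem eigenpair_rate lam phi k : eigensystem a b g lam phi -> (1 <= k)%N ->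
  exists C : R, 0 < C /\
    forall m lamh phih, (k <= m)%N ->
      discrete_eigenvalues a b g m lamh ->
      discrete_eigenfunction a b g m (lamh k) phih ->
      exists s : R, (s = 1 \/ s = -1) /\
        `|lam k - lamh k| + max_abs a b (fun x => phi k x - s * phih x) <=
        C * h m ^+ (2 * r - 2) *
        max_abs2 a b (fun x =>
          derive_itvn a b (2 * r - 2) (fun y => g x y * phi k y)).
Proof.
move=> es; case: k => // k _; have [lam' [phi' cf]] := green_cfs.
have el := es_cfs ab r2 gG es cf k.
have ep := es_eigfun gG es k.
have lk0 : lam k.+1 != 0 by rewrite el gt_eqF// (cfs_pos cf).
have phi1 : max_abs a b (phi k.+1) = 1 by case: es => H _ _ _; case: (H k.+1 isT).
have M0 := max_abs2_gt0 ab r2 lk0 ep gG (es_neq0 ab r2 es k).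
set M := max_abs2 _ _ _ in M0 *.
have [C1 C10 H1] := rate_eigenvalue ab r2 cf k.
rewrite el in ep; have [C2 C20 H2] := rate_eigenfunction ab r2 cf ep phi1.
(* [M] is positive and independent of m, so the plain rate may be rewritten with the factor [M]. *)
exists ((C1 + C2) / M); split; first by rewrite divr_gt0// addr_gt0.
move=> m lamh phih km /green_discrete_eigenvalues dl /green_discrete_eigenfunction df.
have [s [s1 Hs]] := H2 m lamh phih km dl df; exists s; split=> //.
have -> : (C1 + C2) / M * h m ^+ (2 * r - 2) * M =
    C1 * h m ^+ (2 * r - 2) + C2 * h m ^+ (2 * r - 2).
  by rewrite mulrAC divfK ?gt_eqF// mulrDl.
by rewrite lerD// el distrC; exact: H1.
Qed.

End EigenpairRates.

(** * Iterated primitives of integrable functions *)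

Section IteratedPrimitive.
Variable R : realType.
Variables a b : R.
Hypothesis ab : a < b.
Implicit Types (x y t c : R) (f g u v w psi : R -> R).
Local Notation mu := (@lebesgue_measure R).
Local Notation itc f := (mu.-integrable `[a, b] (EFin \o f)).

Lemma restrict_EFin (D : set R) f : (EFin \o f) \_ D = EFin \o (f \_ D).
Proof. by apply/funext => x; rewrite /= !patchE; case: ifP. Qed.

Lemma integrable_tensor f g :
  mu.-integrable setT (EFin \o f) -> mu.-integrable setT (EFin \o g) ->
  (mu \x mu)%E.-integrable setT (fun p : R * R => (f p.1 * g p.2)%:E).
Proof.
move=> itf itg; have /integrableP[mf ff] := itf; have /integrableP[mg gf] := itg.
have mf' : measurable_fun setT f by exact/measurable_EFinP.
have mg' : measurable_fun setT g by exact/measurable_EFinP.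
apply/integrable12ltyP.
  apply/measurable_EFinP; apply: measurable_funM.
    by apply: (measurableT_comp mf').
  by apply: (measurableT_comp mg').
have E x : (\int[mu]_y `|(f (x, y).1 * g (x, y).2)%:E| =
    `|(f x)%:E| * \int[mu]_y `|(g y)%:E|)%E.
  under eq_integral => y _ do rewrite /= normrM EFinM.
  by rewrite ge0_integralZl//=; apply/measurable_EFinP; exact: measurableT_comp.
under eq_integral do rewrite E.
rewrite ge0_integralZr//; [|exact: measurableT_comp|exact: integral_ge0].
by rewrite lte_mul_pinfty ?integral_ge0// ge0_fin_numE ?integral_ge0.
Qed.

Lemma itcS f c d : a <= c -> d <= b -> itc f -> mu.-integrable `[c, d] (EFin \o f).
Proof.
move=> ac db; apply: integrableS => //; apply: subset_itv.
  by rewrite bnd_simp.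
by rewrite bnd_simp.
Qed.

Lemma itc_restrict f : itc f -> mu.-integrable setT (EFin \o (f \_ `[a, b])).
Proof. by move=> itf; have := (integrable_mkcond (mu := mu) (EFin \o f) (measurable_itv `[a, b])).1 itf; rewrite restrict_EFin. Qed.

(** Fubini on the triangle t <= x, for f and v extended by 0 outside the segment. *)
Lemma INT_fubini f v : itc f -> itc v ->
  INT a b (fun x => INT a x f * v x) = INT a b (fun t => f t * INT t b v).
Proof.
move=> itf itv; have itf1 := itc_restrict itf; have itv1 := itc_restrict itv.
set f1 := f \_ _ in itf1; set v1 := v \_ _ in itv1.
pose F (p : R * R) := (f1 p.1 * v1 p.2 * (p.1 <= p.2)%R%:R)%:E.
have itF : (mu \x mu)%E.-integrable setT F.
  apply: le_integrable (integrable_tensor itf1 itv1) => //.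
    apply/measurable_EFinP; apply: measurable_funM.
      by have /integrableP[/measurable_EFinP] := integrable_tensor itf1 itv1.
    rewrite (_ : (fun _ => _) = fun p : R * R => if (p.1 <= p.2)%R then 1 else 0 : R); last first.
      by apply/funext => p; case: ifP.
    by apply: measurable_fun_ifT => //; apply: measurable_fun_ler.
  move=> p _; rewrite lee_fin normrM ler_piMr//.
  by rewrite normr_nat lern1 leq_b1.
have H := Fubini itF.
have E1 t : (\int[mu]_x F (t, x) = (f1 t * INT t b v)%:E)%E.
  rewrite /f1 patchE; case: ifPn => [|tab]; last first.
    rewrite (_ : (fun x => F (t, x)) = cst 0%E) ?integral0 ?mul0r//.
    by apply/funext => x; rewrite /F /f1 patchE (negbTE tab) !mul0r.
  rewrite inE/= in_itv/= => /andP[at_ tb].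
  have it1 := itcS at_ (lexx b) itv.
  transitivity (\int[mu]_x ((f t)%:E * ((EFin \o v) \_ `[t, b]) x))%E.
    apply: eq_integral => x _; rewrite /F /f1 /v1 /= !patchE.
    rewrite (mem_set (_ : `[a, b]%classic t)) ?inE/= ?in_itv/= ?at_// .
    rewrite !mem_setE !in_itv/=; case: (leP t x) => tx /=.
      by rewrite (le_trans at_ tx)/=; case: ifP => _; rewrite ?mulr1 ?mulr0 ?mule0.
    by rewrite mulr0 mule0.
  rewrite integralZl//; last exact: (integrable_mkcond (mu := mu) (EFin \o v) (measurable_itv `[t, b])).1 it1.
  by rewrite -integral_mkcond EFinM fineK//; exact: integrable_fin_num it1.
have E2 x : (\int[mu]_t F (t, x) = (INT a x f * v1 x)%:E)%E.
  rewrite /v1 patchE; case: ifPn => [|xab]; last first.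
    rewrite (_ : (fun t => F (t, x)) = cst 0%E) ?integral0 ?mulr0//.
    by apply/funext => t; rewrite /F /v1 /= patchE (negbTE xab) mulr0 mul0r.
  rewrite inE/= in_itv/= => /andP[ax xb].
  have it1 := itcS (lexx a) xb itf.
  transitivity (\int[mu]_t (((EFin \o f) \_ `[a, x]) t * (v x)%:E))%E.
    apply: eq_integral => t _; rewrite /F /f1 /v1 /= !patchE.
    rewrite (mem_set (_ : `[a, b]%classic x)) ?inE/= ?in_itv/= ?ax// .
    rewrite !mem_setE !in_itv/=; case: (leP t x) => tx /=.
      by rewrite (le_trans tx xb) !andbT; case: ifP => _; rewrite ?mulr1 ?mul0r ?mul0e.
    by rewrite andbF mulr0 mul0e.
  rewrite integralZr//; last exact: (integrable_mkcond (mu := mu) (EFin \o f) (measurable_itv `[a, x])).1 it1.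
  by rewrite -integral_mkcond EFinM fineK//; exact: integrable_fin_num it1.
have {}H : (\int[mu]_t (f1 t * INT t b v)%:E = \int[mu]_x (INT a x f * v1 x)%:E)%E.
  by under eq_integral do rewrite -E1; rewrite H; apply: eq_integral => x _; rewrite E2.
rewrite /INT /Rintegral [in LHS]integral_mkcond [in RHS]integral_mkcond.
congr fine; transitivity (\int[mu]_x (INT a x f * v1 x)%:E)%E; last rewrite -H.
  by apply: eq_integral => x _; rewrite /v1 !patchE; case: ifP; rewrite ?mulr0.
by apply: eq_integral => x _; rewrite /f1 !patchE; case: ifP; rewrite ?mul0r.
Qed.

Lemma INT_tail v t : itc v -> a <= t <= b -> INT t b v = INT a b v - INT a t v.
Proof.
move=> itv /andP[at_ tb]; rewrite /INT -Rintegral_itv_obnd_cbnd.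
  by rewrite -(Rintegral_itvB itv)// bnd_simp.
by apply: integrableS (itcS at_ (lexx b) itv) => //; apply: subset_itv_oc_cc.
Qed.

Lemma cont_on_INT f : itc f -> cont_on a b (fun x => INT a x f).
Proof. by move=> itf; split; exact: (@parameterized_integral_continuous R a b f (ltW ab) itf). Qed.

Lemma cont_on_INT_tail v : itc v -> cont_on a b (fun x => INT x b v).
Proof.
move=> itv; apply: (eq_cont_on (f := fun x => INT a b v - INT a x v)).
  by apply: cont_onB; [exact: cont_on_cst|exact: cont_on_INT].
by move=> x axb; rewrite [RHS]INT_tail.
Qed.

Lemma itcM f g : itc f -> cont_on a b g -> itc (fun x => f x * g x).
Proof.
move=> itf cg; have [M M0 gM] := cont_on_bounded (ltW ab) cg.
have mg : measurable_fun `[a, b] g.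
  by have /integrableP[/measurable_EFinP] := cont_on_integrable cg.
have /= := @integrableMl _ _ _ mu `[a, b]%classic _ (EFin \o f) g itf mg.
apply => //; exists M; split; first exact: num_real.
by move=> z Mz x /=; rewrite in_itv/= => axb; rewrite (le_trans (gM x axb))// ltW.
Qed.

Lemma itcD f g : itc f -> itc g -> itc (fun x => f x + g x).
Proof. by move=> itf itg; exact: (@integrableD _ _ _ mu _ (measurable_itv `[a, b]) _ _ itf itg). Qed.

Lemma itcZ f c : itc f -> itc (fun x => c * f x).
Proof.
by move=> itf; exact: (@integrableZl _ _ _ mu _ (measurable_itv `[a, b]) c (EFin \o f) itf).
Qed.

(** [iprim] integrates from a and [iprim_tail] up to b; by [INT_fubini] they are adjoint, which
    stands in for integration by parts with merely integrable data. *)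
Definition iprim n f := iter n (fun g x => INT a x g) f.
Definition iprim_tail n f := iter n (fun g x => INT x b g) f.

Lemma cont_iprim n f : itc f -> cont_on a b (iprim n.+1 f).
Proof.
by elim: n => [|n ih] itf; apply: cont_on_INT => //; apply/cont_on_integrable/ih.
Qed.

Lemma cont_iprim_tail n f : itc f -> cont_on a b (iprim_tail n.+1 f).
Proof.
by elim: n => [|n ih] itf; apply: cont_on_INT_tail => //; apply/cont_on_integrable/ih.
Qed.

Lemma itc_iprim n f : itc f -> itc (iprim n f).
Proof. by case: n => // n itf; apply/cont_on_integrable/cont_iprim. Qed.

Lemma iprim_adjoint n f v : itc f -> itc v ->
  INT a b (fun x => iprim n f x * v x) = INT a b (fun x => f x * iprim_tail n v x).
Proof.
elim: n v => // n ih v itf itv; rewrite {1}/iprim iterS -/(iprim n f).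
rewrite (INT_fubini (itc_iprim n itf) itv).
rewrite ih//; last exact/cont_on_integrable/cont_on_INT_tail.
by rewrite /iprim_tail iterSr.
Qed.

Lemma INT_tail_lip g : cont_on a b g -> exists2 M, 0 <= M & lip_on a b M (fun x => INT x b g).
Proof.
move=> cg; have [cP dP] := INT_primitive (ltW ab) cg.
have [M M0 lM] := chain1_lip ab cP cg dP; exists M => // x y axb ayb.
have itg := cont_on_integrable cg.
rewrite (INT_tail itg axb) (INT_tail itg ayb) opprB addrC addrA subrK distrC; exact: lM.
Qed.

Lemma iprim_tail_lip n f : itc f -> exists2 M, 0 <= M & lip_on a b M (iprim_tail n.+2 f).
Proof. by move=> itf; exact: INT_tail_lip (cont_iprim_tail n itf). Qed.

End IteratedPrimitive.

(** * The space L^2 through integrals on the closed segment *)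

Section SquareIntegrable.
Variable R : realType.
Variables a b : R.
Hypothesis ab : a < b.
Implicit Types (x y t c : R) (f g u v w psi : R -> R).
Local Notation mu := (@lebesgue_measure R).
Local Notation itc f := (mu.-integrable `[a, b] (EFin \o f)).

Lemma integral_lebesgue_itv (f : R -> \bar R) : measurable_fun setT f ->
  (forall x, (0 <= f x)%E) ->
  (\int[lebesgue_itv a b]_x f x = \int[mu]_(x in `[a, b]) f x)%E.
Proof.
move=> mf f0; have mI : measurable (`]a, b[%classic : set (measurableTypeR R)).
  exact: measurable_itv.
have -> : (\int[lebesgue_itv a b]_x f x =
    \int[lebesgue_itv a b]_(x in setT `\` ~` `]a, b[) f x)%E.
  apply: ge0_negligible_integral => //; first exact: measurableC.
  by rewrite /lebesgue_itv /= /mrestr setICl measure0.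
rewrite setDE setTI setCK (eq_measure_integral mu); last first.
  by move=> A mA AI; rewrite /lebesgue_itv /= /mrestr setIidl.
rewrite integral_itv_obnd_cbnd; last exact: measurable_funTS.
by rewrite integral_itv_bndo_bndc//; exact: measurable_funTS.
Qed.

Definition l2 u := measurable_fun setT u /\ itc (fun x => u x * u x).

Lemma norm_powR2 c : `|c| `^ 2 = c * c.
Proof. by rewrite powR_mulrn// real_normK ?num_real// expr2. Qed.

Lemma l2_sqr_measurable u : measurable_fun setT u ->
  measurable_fun setT (fun x => (u x * u x)%:E).
Proof. by move=> m_u; apply/measurable_EFinP; exact: measurable_funM. Qed.

Lemma integral_sqr u : measurable_fun setT u ->
  (\int[lebesgue_itv a b]_x (`|u x| `^ 2)%:E = \int[mu]_(x in `[a, b]) (u x * u x)%:E)%E.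
Proof.
move=> m_u; under eq_integral do rewrite norm_powR2.
rewrite integral_lebesgue_itv//; first exact: l2_sqr_measurable.
by move=> x; rewrite lee_fin -expr2 sqr_ge0.
Qed.

Lemma L2P u : L2 a b u <-> l2 u.
Proof.
rewrite /L2 /= /Lfun; split.
  move=> /andP[]; rewrite !inE /= => m_u; rewrite /finite_norm unlock /= => H.
  split=> //; apply/integrableP; split.
    by apply: measurable_funTS; exact: l2_sqr_measurable.
  have := lty_poweRy _ H; rewrite integral_sqr// => {}H.
  under eq_integral => x _ do rewrite gee0_abs ?lee_fin -?expr2 ?sqr_ge0//.
  exact: H.
move=> [m_u /integrableP[_ H]]; apply/andP; rewrite !inE; split=> //.
rewrite /finite_norm unlock /= poweR_lty// integral_sqr//.
apply: le_lt_trans H; apply: ge0_le_integral => //=.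
- by move=> x _; rewrite lee_fin -expr2 sqr_ge0.
- by apply: measurable_funTS; exact: l2_sqr_measurable.
- apply: measurable_funTS; apply/measurable_EFinP; apply: measurableT_comp => //.
  exact: measurable_funM.
- by move=> x _; rewrite lee_fin ler_norm.
Qed.

Lemma L2normE u : l2 u -> L2norm a b u = (Num.sqrt (INT a b (fun x => u x * u x)))%:E.
Proof.
move=> [m_u itu]; rewrite /L2norm unlock /= integral_sqr//.
rewrite /INT /Rintegral -[in LHS](fineK (integrable_fin_num _ itu))//.
rewrite poweR_EFin powR12_sqrt//; apply: fine_ge0; apply: integral_ge0 => x _.
by rewrite lee_fin -expr2 sqr_ge0.
Qed.

Lemma l2_cst c : l2 (fun=> c).
Proof. by split=> //; apply: cont_on_integrable; exact: cont_on_cst. Qed.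

Lemma l2M u v : l2 u -> l2 v -> itc (fun x => u x * v x).
Proof.
move=> [m_u iu] [m_v iv].
apply: (le_integrable _ _ _ (itcD iu iv)) => //.
- by apply/measurable_EFinP; apply: measurable_funTS; exact: measurable_funM.
- move=> x _ /=; rewrite lee_fin [leRHS]ger0_norm; last first.
    by rewrite addr_ge0// -expr2 sqr_ge0.
  rewrite ler_norml; have := sqr_ge0 (u x + v x); have := sqr_ge0 (u x - v x).
  by rewrite !expr2 => h1 h2; nra.
Qed.

Lemma l2_itc u : l2 u -> itc u.
Proof.
move=> lu; have := l2M lu (l2_cst 1); congr (is_true (integrable _ _ _)).
by apply/funext => x /=; rewrite mulr1.
Qed.

Lemma l2DZ u v c : l2 u -> l2 v -> l2 (fun x => u x + c * v x).
Proof.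
move=> lu lv; have [m_u iu] := lu; have [m_v iv] := lv; split.
  by apply: measurable_funD => //; exact: measurable_funM.
have := itcD iu (itcD (itcZ (2 * c) (l2M lu lv)) (itcZ (c * c) iv)).
congr (is_true (integrable _ _ _)).
by apply/funext => x /=; congr EFin; ring.
Qed.

(** Membership asks for measurability on the whole line, whereas f is controlled only on the
    segment; hence the extension by 0. *)
Lemma l2_patch f : cont_on a b f -> l2 (f \_ `[a, b]).
Proof.
move=> cf; have mf : measurable_fun `[a, b] f.
  by have /integrableP[/measurable_EFinP] := cont_on_integrable cf.
split; first by apply/(measurable_restrictT _ _).1 => //; exact: measurable_itv.
apply: cont_on_integrable; apply: (eq_cont_on (cont_onM cf cf)) => x axb.
by rewrite patchE mem_set//= in_itv.
Qed.

Definition dot u v := INT a b (fun x => u x * v x).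

Lemma dotC u v : dot u v = dot v u.
Proof. by apply: eq_INT => x _; rewrite mulrC. Qed.

Lemma dot_ge0 u : 0 <= dot u u.
Proof. by apply: INT_ge0 => x _; rewrite -expr2 sqr_ge0. Qed.

Lemma dotDZ u v w c : l2 u -> l2 v -> l2 w ->
  dot (fun x => u x + c * v x) w = dot u w + c * dot v w.
Proof.
move=> lu lv lw; rewrite /dot /INT -RintegralZl//; last exact: l2M.
rewrite -RintegralD//; [|exact: l2M|exact: itcZ (l2M _ _)].
by apply: eq_Rintegral => x _; ring.
Qed.

Lemma dotDZr u v w c : l2 u -> l2 v -> l2 w ->
  dot w (fun x => u x + c * v x) = dot w u + c * dot w v.
Proof. by move=> lu lv lw; rewrite dotC dotDZ// ![dot _ w]dotC. Qed.

Lemma cauchy_schwarz u v : l2 u -> l2 v -> dot u v ^+ 2 <= dot u u * dot v v.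
Proof.
move=> lu lv.
have H c : 0 <= dot u u + c * (2 * dot u v) + c ^+ 2 * dot v v.
  apply: le_trans (dot_ge0 (fun x => u x + c * v x)) _.
  have luv := l2DZ c lu lv; rewrite dotDZ// !dotDZr// (dotC v u) le_eqVlt.
  by apply/orP; left; apply/eqP; ring.
have v0 := dot_ge0 v; have u0 := dot_ge0 u; have [v00|vn0] := eqVneq (dot v v) 0.
  rewrite v00 mulr0; have [->|uv0] := eqVneq (dot u v) 0; first by rewrite expr0n.
  have := H (- (dot u u + 1) / (2 * dot u v)).
  rewrite v00 mulr0 addr0 divfK ?mulf_neq0 ?pnatr_eq0//; lra.
have vp : 0 < dot v v by rewrite lt_neqAle eq_sym vn0.
have := H (- dot u v / dot v v).
have -> : dot u u + - dot u v / dot v v * (2 * dot u v) + (- dot u v / dot v v) ^+ 2 * dot v v =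
  (dot u u * dot v v - dot u v ^+ 2) / dot v v by field.
by rewrite pmulr_lge0 ?invr_gt0// subr_ge0.
Qed.

End SquareIntegrable.

(** * Weak derivatives and Sobolev functions *)

Section WeakDerivative.
Variable R : realType.
Variables a b : R.
Hypothesis ab : a < b.
Implicit Types (x y t c : R) (f g u v w psi : R -> R) (n : nat).
Local Notation mu := (@lebesgue_measure R).
Local Notation itc f := (mu.-integrable `[a, b] (EFin \o f)).
Local Notation IO f := (\int[mu]_(x in `]a, b[) f x).
Local Notation test := (test_function a b).
Local Notation l2 := (l2 a b).
Local Notation dot := (dot a b).

Lemma itc_itg f : itc f -> mu.-integrable `]a, b[ (EFin \o f).
Proof. by apply: integrableS => //; exact: subset_itv_oo_cc. Qed.

Lemma IO_itc f : itc f -> IO f = INT a b f.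
Proof.
move=> itf; rewrite Rintegral_itv_obnd_cbnd; last exact: itc_itg.
rewrite Rintegral_itv_bndo_bndc//; apply: integrableS itf => //.
exact: subset_itv_co_cc.
Qed.

Lemma iprim_tail_test n psi x : test psi -> a <= x <= b ->
  iprim_tail b n (derive1n n psi) x = (-1) ^+ n * psi x.
Proof.
elim: n psi x => [|n ih] psi x tp axb; first by rewrite mul1r.
rewrite derive1Sn /iprim_tail iterS -/(iprim_tail b n _).
have [ax xb] := andP axb; have tp' := test_derive tp.
rewrite (@eq_INT _ _ _ _ (fun t => (-1) ^+ n * psi^`()%classic t)); last first.
  by move=> t /andP[xt tb]; rewrite ih// (le_trans ax xt).
have cp' := cont_on_sub ax (lexx b) (cont_on_test tp').
rewrite INTZ// (INT_FTC2 xb (cont_on_sub ax (lexx b) (cont_on_test tp)) cp').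
  have [_ ->] := test_end tp. by rewrite sub0r mulrN exprS mulN1r mulNr.
by move=> t _; apply: smooth_is_derive; exact: test_smooth tp.
Qed.

Lemma itcB f g : itc f -> itc g -> itc (fun x => f x - g x).
Proof.
move=> itf itg; have := itcD itf (itcZ (-1) itg).
by congr (is_true (integrable _ _ _)); apply/funext => x /=; rewrite mulN1r.
Qed.

(* By du Bois-Reymond, u is a polynomial plus the r-fold primitive of w. *)
Lemma weak_derivative_dot n u w f : l2 u -> l2 w -> weak_derivative a b n u w ->
  l2 f -> (forall p : {poly R}, (size p <= n)%N -> INT a b (fun x => p.[x] * f x) = 0) ->
  dot u f = INT a b (fun x => w x * iprim_tail b n f x).
Proof.
move=> lu lw uw lf fp.
have iu := l2_itc lu; have iw := l2_itc lw; have if_ := l2_itc lf.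
pose P := iprim a n w; have iP : itc P by exact: itc_iprim.
pose v x := u x - P x; have iv : itc v by exact: itcB.
have iPf : itc (fun x => P x * f x).
  rewrite /P; case: n {uw fp P iP v iv} => [|n]; first exact: (l2M lw lf).
  have := itcM ab if_ (cont_iprim ab n iw).
  by congr (is_true (integrable _ _ _)); apply/funext => x /=; rewrite mulrC.
rewrite -(iprim_adjoint ab n iw if_) -/P.
have v0 psi : test psi -> IO (fun x => v x * derive1n n psi x) = 0.
  move=> tp; have cp := cont_on_test (test_derive1n n tp).
  have i1 := itcM ab iu cp; have i2 := itcM ab iP cp.
  have -> : IO (fun x => v x * derive1n n psi x) =
      IO (fun x => u x * derive1n n psi x - P x * derive1n n psi x).
    by apply: eq_Rintegral => x _; rewrite mulrBl.
  rewrite RintegralB//; [|exact: itc_itg..].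
  rewrite uw// (IO_itc i2) (iprim_adjoint ab n iw (cont_on_integrable cp)).
  rewrite (@eq_INT _ _ _ _ (fun x => (-1) ^+ n * (w x * psi x))); last first.
    by move=> x axb; rewrite iprim_tail_test// mulrCA.
  have iwp := itcM ab iw (cont_on_test tp).
  by rewrite /INT RintegralZl// -/(INT a b _) -(IO_itc iwp) subrr.
have [p sp pE] := du_bois_reymond ab (itc_itg iv) v0.
have cp : cont_on a b (horner p) by apply: cont_on_continuous; exact: continuous_horner.
have ivp : itc (fun x => v x - p.[x]) by apply: itcB => //; exact: cont_on_integrable.
have ae := ae_test_orthogonal ab (itc_itg ivp) pE.
have iuf := l2M lu lf.
have ipf : itc (fun x => p.[x] * f x).
  have := itcM ab if_ cp.
  by congr (is_true (integrable _ _ _)); apply/funext => x /=; rewrite mulrC.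
have : IO (fun x => u x * f x) = IO (fun x => P x * f x + p.[x] * f x).
  rewrite /Rintegral; congr fine; apply: ae_eq_integral => //.
  - by have /integrableP[] := itc_itg iuf.
  - by have /integrableP[] := itc_itg (itcD iPf ipf).
  move: ae; apply: filterS; first exact: (ae_filter_ringOfSetsType mu).
  move=> x H; rewrite /= in_itv/= => /H /eqP.
  by rewrite subr_eq0 subr_eq => /eqP ->; congr EFin; ring.
rewrite RintegralD//; [|exact: itc_itg..].
by rewrite !IO_itc// fp// addr0.
Qed.

Lemma chain_weak_derivative n U u w : chain a b n U ->
  (forall x, a <= x <= b -> u x = U 0%N x) -> (forall x, a <= x <= b -> w x = U n x) ->
  weak_derivative a b n u w.
Proof.
move=> cU u0 wn psi tp; have sc := smooth_chain a b n (test_smooth tp).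
have H f g : (forall x, a <= x <= b -> f x = g x) -> cont_on a b g -> IO f = INT a b g.
  move=> fg cg; rewrite -IO_INT//; apply: eq_Rintegral => x.
  by rewrite inE/= in_itv/= => /andP[ax xb]; apply: fg; rewrite !ltW.
rewrite (H _ (fun x => U 0%N x * derive1n n psi x)); last 2 first.
- by move=> x axb; rewrite u0.
- by apply: cont_onM; [exact: cU.1|exact: sc.1].
rewrite (H (fun x => w x * psi x) (fun x => U n x * derive1n 0 psi x)); last 2 first.
- by move=> x axb; rewrite wn.
- by apply: cont_onM; [exact: cU.1|exact: (sc.1 0%N)].
rewrite (@chain_by_parts _ a b n U (fun j => derive1n j psi) (ltW ab) cU sc)//.
by move=> j _; apply: test_end; exact: test_derive1n.
Qed.

Lemma patchE_itv f x : a <= x <= b -> (f \_ `[a, b]) x = f x.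
Proof. by move=> axb; rewrite patchE mem_set//= in_itv. Qed.

Lemma chain_sobolev n U : chain a b n U -> sobolev a b n (U 0%N \_ `[a, b]).
Proof.
move=> cU; split; first by apply/L2P/l2_patch/cU.1.
move=> k kn; exists (U k \_ `[a, b]); first by apply/L2P/l2_patch/cU.1.
by apply: (chain_weak_derivative (chainW kn cU)) => x; exact: patchE_itv.
Qed.

End WeakDerivative.

(** * Orthogonal projection in L^2 *)

Section Projection.
Variable R : realType.
Variables a b : R.
Hypothesis ab : a < b.
Implicit Types (x y t c : R) (f g u v w : R -> R).
Local Notation l2 := (l2 a b).
Local Notation dot := (dot a b).

Lemma l2_sum (I : Type) (s : seq I) (c : I -> R) (e : I -> R -> R) :
  (forall i, l2 (e i)) -> l2 (fun x => \sum_(i <- s) c i * e i x).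
Proof.
move=> le; elim: s => [|i s ih].
  have -> : (fun x => \sum_(i <- [::]) c i * e i x) = fun=> 0.
    by apply/funext => x; rewrite big_nil.
  exact: l2_cst.
have -> : (fun x => \sum_(j <- i :: s) c j * e j x) =
    (fun x => \sum_(j <- s) c j * e j x + c i * e i x).
  by apply/funext => x; rewrite big_cons addrC.
exact: l2DZ.
Qed.

Lemma dot_sum (I : Type) (s : seq I) (c : I -> R) (e : I -> R -> R) w :
  (forall i, l2 (e i)) -> l2 w ->
  dot (fun x => \sum_(i <- s) c i * e i x) w = \sum_(i <- s) c i * dot (e i) w.
Proof.
move=> le lw; elim: s => [|i s ih].
  rewrite big_nil -[RHS](INT0 a b); apply: eq_INT => x _.
  by rewrite big_nil mul0r.
rewrite big_cons addrC -ih -dotDZ//; last exact: l2_sum.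
by apply: eq_INT => x _; rewrite big_cons addrC.
Qed.

Lemma L2dist_lincomb n (e : 'I_n -> R -> R) (c : 'I_n -> R) u :
  l2 u -> (forall i, l2 (e i)) ->
  L2dist a b u (lincomb e c) =
  (Num.sqrt (dot (fun x => u x - lincomb e c x) (fun x => u x - lincomb e c x)))%:E.
Proof.
move=> lu le; rewrite /L2dist L2normE//.
have := l2DZ (-1) lu (l2_sum (index_enum 'I_n) c le).
by under eq_fun do rewrite mulN1r.
Qed.

Lemma l2_residual n (e : 'I_n -> R -> R) (c : 'I_n -> R) u :
  l2 u -> (forall i, l2 (e i)) -> l2 (fun x => u x - lincomb e c x).
Proof.
move=> lu le; have := l2DZ (-1) lu (l2_sum (index_enum 'I_n) c le).
by under eq_fun do rewrite mulN1r.
Qed.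

Lemma dot_residual n (e : 'I_n -> R -> R) (c : 'I_n -> R) u w :
  l2 u -> (forall i, l2 (e i)) -> l2 w ->
  dot (fun x => u x - lincomb e c x) w = dot u w - \sum_i c i * dot (e i) w.
Proof.
move=> lu le lw; rewrite -dot_sum// -mulN1r -dotDZ//; last exact: l2_sum.
by apply: eq_INT => x _; rewrite mulN1r.
Qed.

Lemma orthogonal_residual_le n (e : 'I_n -> R -> R) (c : 'I_n -> R) u :
  l2 u -> (forall i, l2 (e i)) -> (forall i, dot u (e i) = 0) ->
  dot u u <= dot (fun x => u x - lincomb e c x) (fun x => u x - lincomb e c x).
Proof.
move=> lu le ue; have lr := l2_residual c lu le.
have lc : l2 (lincomb e c) by exact: l2_sum.
have ur : dot (fun x => u x - lincomb e c x) u = dot u u.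
  by rewrite dot_residual// big1 ?subr0// => i _; rewrite dotC ue mulr0.
have er i : dot (fun x => u x - lincomb e c x) (e i) = - dot (lincomb e c) (e i).
  by rewrite dot_residual// ue sub0r dot_sum.
rewrite [leRHS]dot_residual// (dotC _ _ u) ur.
under eq_bigr => i _ do rewrite dotC er mulrN.
rewrite sumrN opprK lerDl (_ : \sum_i _ = dot (lincomb e c) (lincomb e c)) ?dot_ge0//.
by rewrite [RHS]dot_sum//; apply: eq_bigr => i _; rewrite dotC.
Qed.

(** Normal equations: by independence of [e] the Gram matrix is invertible. *)
Lemma projection_exists n (e : 'I_n -> R -> R) u : l2 u -> (forall i, l2 (e i)) ->
  (forall c : 'I_n -> R, dot (lincomb e c) (lincomb e c) = 0 -> forall i, c i = 0) ->
  exists c : 'I_n -> R, forall i, dot (fun x => u x - lincomb e c x) (e i) = 0.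
Proof.
move=> lu le ind; pose M := \matrix_(i < n, j < n) dot (e i) (e j).
have uM : M \in unitmx.
  rewrite -row_free_unit -kermx_eq0; apply/eqP/row_matrixP => i; rewrite row0.
  set v := row i _; have vM : v *m M = 0 by apply/sub_kermxP; exact: row_sub.
  apply/rowP => j; rewrite [RHS]mxE; apply: (ind (fun j => v 0 j)).
  rewrite {1}/lincomb dot_sum//; last exact: l2_sum.
  under eq_bigr => i' _ do rewrite dotC dot_sum// mulr_sumr.
  rewrite exchange_big/= big1// => i' _.
  under eq_bigr => j' _ do rewrite mulrCA dotC.
  rewrite -mulr_sumr.
  rewrite [X in _ * X](_ : _ = (v *m M) 0 i'); first by rewrite vM [X in _ * X]mxE mulr0.
  rewrite mxE; apply: eq_bigr => j' _; rewrite [M _ _]mxE; congr (_ * _).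
have [c cM] : exists c : 'rV[R]_n, c *m M = \row_j dot u (e j).
  by exists (\row_j dot u (e j) *m invmx M); rewrite mulmxKV.
exists (fun i => c 0 i) => j; rewrite dot_residual//.
have := congr1 (fun A : 'rV[R]_n => A 0 j) cM; rewrite !mxE => <-.
by apply/eqP; rewrite subr_eq0; apply/eqP/eq_bigr => i _; rewrite mxE.
Qed.

Lemma projection_min n (e : 'I_n -> R -> R) (c c' : 'I_n -> R) u :
  l2 u -> (forall i, l2 (e i)) ->
  (forall i, dot (fun x => u x - lincomb e c x) (e i) = 0) ->
  dot (fun x => u x - lincomb e c x) (fun x => u x - lincomb e c x) <=
  dot (fun x => u x - lincomb e c' x) (fun x => u x - lincomb e c' x).
Proof.
move=> lu le ue.
have := orthogonal_residual_le (fun i => c' i - c i) (l2_residual c lu le) le ue.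
rewrite (_ : (fun x => u x - lincomb e c x - lincomb e (fun i => c' i - c i) x) =
  (fun x => u x - lincomb e c' x))//.
apply/funext => x; rewrite /lincomb; under [X in _ - X]eq_bigr do rewrite mulrBl.
by rewrite sumrB; ring.
Qed.

End Projection.

(** * The optimal approximating functions *)

Section WidthFamily.
Variable R : realType.
Variables (a b : R) (r : nat).
Hypothesis ab : a < b.
Hypothesis r2 : (2 <= r)%N.
Implicit Types (x y t : R) (f g u v w : R -> R) (k n m : nat).
Local Notation G := (green a b r).
Local Notation l2 := (l2 a b).
Local Notation dot := (dot a b).

Lemma INT_sqr_sum (I : finType) (P : pred I) (c d : I -> R) (f : I -> R -> R) :
  (forall i, P i -> cont_on a b (f i)) ->
  (forall i j, P i -> P j -> INT a b (fun x => f i x * f j x) = (i == j)%:R * d i) ->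
  INT a b (fun x => (\sum_(i | P i) c i * f i x) * (\sum_(i | P i) c i * f i x)) =
  \sum_(i | P i) c i ^+ 2 * d i.
Proof.
move=> cf H.
rewrite (@eq_INT _ _ _ _ (fun x => \sum_(i | P i) \sum_(j | P j)
    (c i * c j) * (f i x * f j x))); last first.
  move=> x _; rewrite mulr_suml; apply: eq_bigr => i _; rewrite mulr_sumr.
  by apply: eq_bigr => j _; ring.
rewrite INT_sum; last first.
  move=> i Pi; apply: cont_on_sum => j Pj; apply: cont_onZ.
  by apply: cont_onM; exact: cf.
apply: eq_bigr => i Pi; rewrite INT_sum; last first.
  by move=> j Pj; apply: cont_onZ; apply: cont_onM; exact: cf.
rewrite (bigD1 i)//= big1 ?addr0 => [|j /andP[Pj ji]]; last first.
  rewrite INTZ; last by apply: cont_onM; exact: cf.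
  by rewrite H// eq_sym (negbTE ji) mul0r mulr0.
rewrite INTZ; last by apply: cont_onM; exact: cf.
by rewrite H// eqxx mul1r expr2.
Qed.

Variables (lam : nat -> R) (phi : nat -> R -> R).
Hypothesis cf : cfs a b G lam phi.

Lemma eigenfunction_chains : exists U : nat -> nat -> R -> R, forall j,
  [/\ chain a b (2 * r) (U j),
      forall x, a <= x <= b -> U j 0%N x = phi j x,
      forall i, (i < r)%N -> U j i a = 0 /\ U j i b = 0 &
      forall x, U j (2 * r)%N x = (lam j)^-1 * (-1) ^+ r * phi j x].
Proof.
have /choice[U HU] : forall j, exists V : nat -> R -> R, [/\ chain a b (2 * r) V,
    forall x, a <= x <= b -> V 0%N x = phi j x,
    forall i, (i < r)%N -> V i a = 0 /\ V i b = 0 &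
    forall x, V (2 * r)%N x = (lam j)^-1 * (-1) ^+ r * phi j x].
  move=> j; apply: (eigfun_chain ab r2 _ (cfs_eigfun cf j)).
  by rewrite gt_eqF// (cfs_pos cf).
by exists U.
Qed.

Variable U : nat -> nat -> R -> R.
Hypothesis HU : forall j, [/\ chain a b (2 * r) (U j),
      forall x, a <= x <= b -> U j 0%N x = phi j x,
      forall i, (i < r)%N -> U j i a = 0 /\ U j i b = 0 &
      forall x, U j (2 * r)%N x = (lam j)^-1 * (-1) ^+ r * phi j x].

(** Monomials of degree below r, followed by the r-th derivatives of the eigenfunctions, each with
    its further derivatives up to order r. *)
Definition width_chain i : nat -> R -> R :=
  if (i < r)%N then fun j x => ('X^i)^`(j).[x] else fun j => U (i - r) (r + j).

Definition width_fun i : R -> R := width_chain i 0 \_ `[a, b].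

Lemma U_drop j : chain a b r (fun i => U j (r + i)%N).
Proof. by have [cU _ _ _] := HU j; apply: chain_drop; rewrite addnn -mul2n. Qed.

Lemma width_chainP i : chain a b r (width_chain i).
Proof. by rewrite /width_chain; case: ifP => _; [exact: chain_poly|exact: U_drop]. Qed.

Lemma width_chain_lo i j x : (i < r)%N -> width_chain i j x = ('X^i)^`(j).[x].
Proof. by rewrite /width_chain => ->. Qed.

Lemma width_chain_hi i j x : ~~ (i < r)%N -> width_chain i j x = U (i - r) (r + j) x.
Proof. by rewrite /width_chain => /negbTE ->. Qed.

Lemma width_top_lo i x : (i < r)%N -> width_chain i r x = 0.
Proof. by move=> ir; rewrite width_chain_lo// derivn_poly0 ?horner0// size_polyXn. Qed.

Lemma width_top_hi i x : ~~ (i < r)%N ->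
  width_chain i r x = (lam (i - r))^-1 * (-1) ^+ r * phi (i - r) x.
Proof.
by move=> ir; rewrite width_chain_hi// addnn -mul2n; have [_ _ _ ->] := HU (i - r).
Qed.

Lemma width_fun_l2 i : l2 (width_fun i).
Proof. by apply: l2_patch => //; apply: (width_chainP i).1. Qed.

Lemma cont_U j i : (i <= 2 * r)%N -> cont_on a b (U j i).
Proof. by have [cU _ _ _] := HU j; exact: cU.1. Qed.

Lemma poly_U_orthogonal (q : {poly R}) j : (size q <= r)%N ->
  INT a b (fun x => q.[x] * U j r x) = 0.
Proof.
move=> sq; have [cU _ Ubc _] := HU j.
have cUr : chain a b r (U j) by apply: chainW cU; lia.
rewrite (@chain_by_parts _ a b r (fun i x => q^`(i).[x]) _ (ltW ab) (chain_poly a b r q) cUr Ubc).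
rewrite (@eq_INT _ _ _ _ (fun=> 0)) ?INT0 ?mulr0// => x _.
by rewrite derivn_poly0// horner0 mul0r.
Qed.

(** Moving r derivatives from the clamped [U j] to [U i] produces [phi i] over [lam i], and the
    eigenfunctions are orthonormal. *)
Lemma U_gram i j : INT a b (fun x => U i r x * U j r x) = (i == j)%:R * (lam i)^-1.
Proof.
have [cU _ Ubc _] := HU j; have [_ _ _ Utop] := HU i; have [_ U0 _ _] := HU j.
have cUr : chain a b r (U j) by apply: chainW cU; lia.
have := chain_by_parts (ltW ab) (U_drop i) cUr Ubc; rewrite addn0 => ->.
have cp k : cont_on a b (phi k) by exact: cfs_cont cf k.
rewrite (@eq_INT _ _ _ _ (fun x => ((lam i)^-1 * (-1) ^+ r) * (phi i x * phi j x))); last first.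
  by move=> x axb; rewrite addnn -mul2n Utop U0// mulrA.
rewrite INTZ; last exact: cont_onM.
have -> : INT a b (fun x => phi i x * phi j x) = (i == j)%:R by case: cf.
by rewrite mulrA mulrCA (@signrr R) mulr1 mulrC.
Qed.

Section Combination.
Variables (m : nat) (c : 'I_m -> R).
Local Notation V := (fun j x => \sum_(i < m) c i * width_chain i j x).
Local Notation u := (lincomb (fun i : 'I_m => width_fun i) c).

Lemma comb_chain : chain a b r V.
Proof. by apply: chain_sum => i _; apply: chainZ; exact: width_chainP. Qed.

Lemma lincomb_width x : a <= x <= b -> u x = V 0%N x.
Proof. by move=> axb; apply: eq_bigr => i _; rewrite /width_fun patchE_itv. Qed.

Lemma lincomb_widthE : u = V 0%N \_ `[a, b].
Proof.
apply/funext => x; rewrite patchE; case: ifPn => xab.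
  by apply: lincomb_width; move: xab; rewrite inE/= in_itv.
by rewrite /lincomb big1// => i _; rewrite /width_fun patchE (negbTE xab) mulr0.
Qed.

Let q := \sum_(i < m | (i < r)%N) c i *: 'X^i : {poly R}.

Lemma width_norm : dot u u = INT a b (fun x => q.[x] * q.[x]) +
  \sum_(i < m | ~~ (i < r)%N) c i ^+ 2 * (lam (i - r))^-1.
Proof.
pose z x := \sum_(i < m | ~~ (i < r)%N) c i * U (i - r) r x.
have cU i : cont_on a b (U i r) by apply: cont_U; lia.
have cz : cont_on a b z by apply: cont_on_sum => i _; exact: cont_onZ.
have cq : cont_on a b (horner q) by apply: cont_on_continuous; exact: continuous_horner.
have sq : (size q <= r)%N.
  rewrite (leq_trans (size_sum _ _ _))//; apply/bigmax_leqP => i ir.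
  by rewrite (leq_trans (size_scale_leq _ _))// size_polyXn.
have uE x : a <= x <= b -> u x = q.[x] + z x.
  move=> axb; rewrite lincomb_width// (bigID (fun i : 'I_m => (i < r)%N))/=.
  congr (_ + _); last by apply: eq_bigr => i ir; rewrite width_chain_hi// addn0.
  rewrite /q horner_sum; apply: eq_bigr => i ir.
  by rewrite width_chain_lo// hornerZ.
have zE : INT a b (fun x => z x * z x) = \sum_(i < m | ~~ (i < r)%N) c i ^+ 2 * (lam (i - r))^-1.
  apply: (@INT_sqr_sum _ (fun i : 'I_m => ~~ (i < r)%N) c (fun i => (lam (i - r))^-1)
    (fun i => U (i - r) r)) => // i j ir jr; rewrite U_gram; congr (_ * _).
  have -> : ((i - r)%N == (j - r)%N) = (i == j) => //.
  by apply/eqP/eqP => [e|->//]; apply: val_inj => /=; lia.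
have qz : INT a b (fun x => q.[x] * z x) = 0.
  rewrite (@eq_INT _ _ _ _ (fun x => \sum_(i < m | ~~ (i < r)%N) c i * (q.[x] * U (i - r) r x))).
    rewrite INT_sum => [|i _]; last by apply: cont_onZ; exact: cont_onM.
    rewrite big1// => i _; rewrite INTZ; last exact: cont_onM.
    by rewrite poly_U_orthogonal// mulr0.
  by move=> x _; rewrite mulr_sumr; apply: eq_bigr => i _; rewrite mulrCA.
rewrite -[LHS]/(INT a b (fun x => u x * u x)) (@eq_INT _ _ _ _ (fun x => q.[x] * q.[x] + (2 * (q.[x] * z x) + z x * z x))).
  have c1 := cont_onM cq cq; have c2 := cont_onZ 2 (cont_onM cq cz); have c3 := cont_onM cz cz.
  rewrite INTD//; last exact: cont_onD.
  by rewrite INTD// INTZ ?qz ?mulr0 ?add0r ?zE//; exact: cont_onM.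
by move=> x axb; rewrite uE//; ring.
Qed.

(** The r-th derivative kills the monomials and turns the others into multiples of eigenfunctions.
    Compared with [width_norm], each mode has ratio [lam (i - r)] between squared norm and squared
    norm of the r-th derivative. *)
Lemma width_top_norm : INT a b (fun x => V r x * V r x) =
  \sum_(i < m | ~~ (i < r)%N) c i ^+ 2 * (lam (i - r))^-1 ^+ 2.
Proof.
have cp k : cont_on a b (phi k) by exact: cfs_cont cf k.
rewrite (@eq_INT _ _ _ _ (fun x =>
   (\sum_(i < m | ~~ (i < r)%N) c i * ((lam (i - r))^-1 * (-1) ^+ r * phi (i - r) x)) *
   (\sum_(i < m | ~~ (i < r)%N) c i * ((lam (i - r))^-1 * (-1) ^+ r * phi (i - r) x)))).
  apply: (@INT_sqr_sum _ (fun i : 'I_m => ~~ (i < r)%N) c (fun i => (lam (i - r))^-1 ^+ 2)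
    (fun i x => (lam (i - r))^-1 * (-1) ^+ r * phi (i - r) x)).
    by move=> i _; exact: cont_onZ.
  move=> i j ir jr.
  rewrite (@eq_INT _ _ _ _ (fun x => ((lam (i - r))^-1 * (lam (j - r))^-1) *
      (phi (i - r) x * phi (j - r) x))); last first.
    move=> x _; rewrite [LHS](_ : _ = ((-1) ^+ r * (-1) ^+ r) * ((lam (i - r))^-1 *
      (lam (j - r))^-1 * (phi (i - r) x * phi (j - r) x))); last by ring.
    by rewrite (@signrr R) mul1r.
  rewrite INTZ; last exact: cont_onM.
  have -> : INT a b (fun x => phi (i - r) x * phi (j - r) x) = ((i - r)%N == (j - r)%N)%:R by case: cf.
  have -> : ((i - r)%N == (j - r)%N) = (i == j).
    by apply/eqP/eqP => [e|->//]; apply: val_inj => /=; lia.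
  by case: eqP => [->|_]; rewrite ?mulr1 ?mul1r ?expr2// mulr0 mul0r.
move=> x _; have -> // : V r x =
  \sum_(i < m | ~~ (i < r)%N) c i * ((lam (i - r))^-1 * (-1) ^+ r * phi (i - r) x).
rewrite (bigID (fun i : 'I_m => (i < r)%N))/= big1 ?add0r => [|i ir]; last first.
  by rewrite width_top_lo// mulr0.
by apply: eq_bigr => i ir; rewrite width_top_hi.
Qed.

Lemma width_independent : dot u u = 0 -> forall i, c i = 0.
Proof.
rewrite width_norm => H.
have S0 : 0 <= \sum_(i < m | ~~ (i < r)%N) c i ^+ 2 * (lam (i - r))^-1.
  by apply: sumr_ge0 => i _; rewrite mulr_ge0 ?sqr_ge0// invr_ge0 ltW// (cfs_pos cf).
have q0 : 0 <= INT a b (fun x => q.[x] * q.[x]).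
  by apply: INT_ge0 => x _; rewrite -expr2 sqr_ge0.
have S1 : \sum_(i < m | ~~ (i < r)%N) c i ^+ 2 * (lam (i - r))^-1 = 0 by lra.
have q1 : INT a b (fun x => q.[x] * q.[x]) = 0 by lra.
have cq : cont_on a b (horner q) by apply: cont_on_continuous; exact: continuous_horner.
have qz : q = 0.
  apply: (poly_eq0_itv ab) => x axb; apply/eqP; rewrite -sqrf_eq0 expr2; apply/eqP.
  by apply: (INT_eq0 ab _ _ q1 axb) => [|y _]; [exact: cont_onM|rewrite -expr2 sqr_ge0].
move=> i; case: (boolP (i < r)%N) => ir.
  have := congr1 (fun p : {poly R} => p`_i) qz; rewrite coef0 /q coef_sum.
  rewrite (bigD1 i)//= big1 ?addr0 => [|j /andP[_ ji]]; last first.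
    by rewrite coefZ coefXn (_ : (i == j :> nat) = false) ?mulr0// eq_sym; exact/negbTE.
  by rewrite coefZ coefXn eqxx mulr1.
move/eqP: S1; rewrite psumr_eq0 => [/allP/(_ i)|j _]; last first.
  by rewrite mulr_ge0 ?sqr_ge0// invr_ge0 ltW// (cfs_pos cf).
rewrite mem_index_enum ir => /(_ isT) /=.
by rewrite mulf_eq0 sqrf_eq0 invr_eq0 (gt_eqF (cfs_pos cf _)) orbF => /eqP.
Qed.

End Combination.
End WidthFamily.

(** * The exact value of the n-width *)

Section WidthBounds.
Variable R : realType.
Variables (a b : R) (r : nat).
Hypothesis ab : a < b.
Hypothesis r2 : (2 <= r)%N.
Implicit Types (x y t : R) (f u v w : R -> R) (k n m : nat).
Local Notation G := (green a b r).
Local Notation l2 := (l2 a b).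
Local Notation dot := (dot a b).
Variables (lam : nat -> R) (phi : nat -> R -> R).
Hypothesis cf : cfs a b G lam phi.

Lemma le_of_sqr_le (x y : R) : 0 <= x -> 0 <= y -> x ^+ 2 <= y * x -> x <= y.
Proof.
rewrite le_eqVlt => /predU1P[<-//|x0] y0.
by rewrite expr2 ler_pM2r.
Qed.

Lemma l2_sqrt_le u w c : l2 u -> l2 w -> 0 <= c -> dot u u <= c * dot w w ->
  Num.sqrt (dot u u) <= Num.sqrt c * Num.sqrt (dot w w).
Proof. by move=> lu lw c0 H; rewrite -sqrtrM// ler_wsqrtr. Qed.

Lemma dot_patch f g : dot (f \_ `[a, b]) (g \_ `[a, b]) = INT a b (fun x => f x * g x).
Proof. by apply: eq_INT => x axb; rewrite !patchE_itv. Qed.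

(** By dimension, some nonzero combination u of the first n+1 width functions is orthogonal to the
    given n-dimensional space, so its distance to that space is its norm. All modes of u have ratio
    at least [lam (n - r)]. *)
Theorem approximation_constant_ge n C : (r <= n)%N ->
  approximation_constant a b r n C -> Num.sqrt (lam (n - r)) <= C.
Proof.
move=> rn [e [le_ _] He]; have [U HU] := eigenfunction_chains ab r2 cf.
pose F i := width_fun a b r U i; pose E := width_chain r U.
have le i : l2 (e i) by apply/L2P; exact: le_.
have lF i : l2 (F i) by exact: (width_fun_l2 HU).
have [c [[i0 ci0] Hc]] := nontrivial_solution (fun i j => dot (F (i : 'I_n.+1)) (e j)).
pose u := lincomb (fun i : 'I_n.+1 => F i) c.
pose V j x := \sum_(i < n.+1) c i * E i j x.
have cV : chain a b r V by exact: (comb_chain HU c).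
have uV : u = V 0%N \_ `[a, b] by exact: lincomb_widthE.
have lu : l2 u by exact: l2_sum.
pose w := V r \_ `[a, b]; have lw : l2 w by apply: l2_patch; apply: cV.1.
have [||c0 _ Hc0] := He u w _ (proj2 (L2P a b w) lw).
- by rewrite uV; exact: chain_sobolev.
- by apply: (chain_weak_derivative ab cV) => x axb; rewrite ?uV /w patchE_itv.
have ue j : dot u (e j) = 0 by rewrite /u dot_sum// Hc.
move: Hc0; rewrite L2dist_lincomb// L2normE// -/(dot w w) -EFinM lee_fin => Hc0.
have {}Hc0 := le_trans (ler_wsqrtr (orthogonal_residual_le c0 lu le ue)) Hc0.
have lk i : 0 < lam i := cfs_pos cf i.
have key : lam (n - r) * dot w w <= dot u u.
  rewrite /w dot_patch (width_top_norm ab r2 cf HU) (width_norm ab r2 cf HU).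
  rewrite -[leLHS]add0r lerD//; first by apply: INT_ge0 => x _; rewrite -expr2 sqr_ge0.
  rewrite mulr_sumr; apply: ler_sum => i ir; rewrite mulrCA ler_wpM2l ?sqr_ge0//.
  rewrite expr2 mulrA ler_piMl ?invr_ge0 ?(ltW (lk _))// ler_pdivrMr// mul1r.
  apply: (cfs_decr cf); have := ltn_ord i; lia.
(* If the r-th derivative had norm 0, the approximation estimate would force u = 0, against the
   independence of the width functions. *)
have w0 : 0 < dot w w.
  rewrite lt_neqAle dot_ge0 andbT; apply/eqP => /esym w0.
  have u0 : dot u u = 0.
    apply/eqP; rewrite eq_le dot_ge0 andbT -sqrtr_eq0.
    by rewrite eq_le sqrtr_ge0 andbT (le_trans Hc0)// w0 sqrtr0 mulr0.
  by have := width_independent ab r2 cf HU u0 i0 => /eqP; rewrite (negbTE ci0).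
rewrite -(ler_pM2r (_ : 0 < Num.sqrt (dot w w))) ?sqrtr_gt0//.
by rewrite -sqrtrM ?(ltW (lk _))// (le_trans (ler_wsqrtr key)).
Qed.

(** Duality, with f the residual of u: [dot f f] equals [dot u f], which is the pairing of w with
    the r-fold primitive [F] of f. Since the squared norm of [F] is at most [lam k * dot f f]
    ([poincare]), Cauchy-Schwarz concludes. *)
Lemma orthogonal_width_le k U f u w :
  (forall j, [/\ chain a b (2 * r) (U j),
      forall x, a <= x <= b -> U j 0%N x = phi j x,
      forall i, (i < r)%N -> U j i a = 0 /\ U j i b = 0 &
      forall x, U j (2 * r)%N x = (lam j)^-1 * (-1) ^+ r * phi j x]) ->
  l2 f -> (forall i, (i < r + k)%N -> dot f (width_fun a b r U i) = 0) ->
  l2 u -> l2 w -> weak_derivative a b r u w -> dot u f = dot f f ->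
  dot f f <= lam k * dot w w.
Proof.
move=> HU lf fF lu lw uw uf; have lk i : 0 < lam i := cfs_pos cf i.
have lF i : l2 (width_fun a b r U i) by exact: (width_fun_l2 HU).
have fp (p : {poly R}) : (size p <= r)%N -> INT a b (fun x => p.[x] * f x) = 0.
  move=> sp; transitivity (dot (fun x => \sum_(i < r) p`_i * width_fun a b r U i x) f).
    apply: eq_INT => x axb; rewrite (horner_coef_wide _ sp); congr (_ * _).
    apply: eq_bigr => i _; rewrite /width_fun patchE_itv// width_chain_lo//.
    by rewrite derivn0 hornerXn.
  rewrite dot_sum// big1// => i _; rewrite dotC fF ?mulr0//.
  by rewrite (leq_trans (ltn_ord i))// leq_addr.
(* Because f is orthogonal to polynomials of degree below r, pairing any Sobolev function with f is
   pairing its r-th weak derivative with [F]. *)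
pose F := iprim_tail b r f.
have [M M0 lipF] : exists2 M, 0 <= M & lip_on a b M F.
  rewrite /F; case: r r2 => [|[|s]]// _; exact: (iprim_tail_lip ab s (l2_itc lf)).
have cF := lip_on_cont lipF.
have lF2 : l2 (F \_ `[a, b]) by exact: l2_patch.
pose N := INT a b (fun x => F x * F x).
have N0 : 0 <= N by apply: INT_ge0 => x _; rewrite -expr2 sqr_ge0.
have weak V : chain a b r V ->
    dot (V 0%N \_ `[a, b]) f = INT a b (fun x => V r x * F x).
  move=> cV; have l0 : l2 (V 0%N \_ `[a, b]) by apply: l2_patch; exact: cV.1.
  have l1 : l2 (V r \_ `[a, b]) by apply: l2_patch; exact: cV.1.
  rewrite (weak_derivative_dot ab l0 l1 _ lf fp); last first.
    by apply: (chain_weak_derivative ab cV) => x axb; rewrite patchE_itv.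
  by apply: eq_INT => x axb; rewrite patchE_itv.
(* The width function of index r + j has a nonzero multiple of [phi j] as r-th derivative, so
   orthogonality of f to it is orthogonality of [F] to [phi j]. *)
have Fphi j : (j < k)%N -> INT a b (fun x => F x * phi j x) = 0.
  move=> jk; have := fF (r + j)%N; rewrite ltn_add2l => /(_ jk).
  rewrite dotC /width_fun weak; last exact: width_chainP.
  have nr : ~~ (r + j < r)%N by rewrite -leqNgt leq_addr.
  rewrite (@eq_INT _ _ _ _ (fun x => ((lam j)^-1 * (-1) ^+ r) * (F x * phi j x))); last first.
    by move=> x _; rewrite (width_top_hi HU)// addKn; ring.
  rewrite INTZ; last by apply: cont_onM => //; exact: cfs_cont cf j.
  move/eqP; rewrite mulf_eq0 mulf_eq0 invr_eq0 signr_eq0 (gt_eqF (lk j)) /=.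
  by move/eqP.
(* [S] solves the clamped problem with right-hand side [F]. Its r-th derivative has the form of [F]
   as squared norm, at most [lam k * N] by the maximum principle, and it pairs with f to [N] up to
   sign; Cauchy-Schwarz then bounds [N]. *)
pose S := green_sol a b r F; have cS := green_sol_chain ab r2 cF.
have cSr : chain a b r (fun i => S (r + i)%N).
  by apply: chain_drop; rewrite addnn -mul2n.
have l0 : l2 (S (r + 0)%N \_ `[a, b]) by apply: l2_patch; exact: cSr.1.
have form : dot (S (r + 0)%N \_ `[a, b]) (S (r + 0)%N \_ `[a, b]) <= lam k * N.
  rewrite dot_patch addn0 -INT_green_form// -/N.
  case: cf => _ _ _ _ [_ /(_ k F M M0 lipF Fphi)].
  rewrite (@eq_INT _ _ _ (fun x => F x * kop a b G F x) (fun x => F x * green_sol a b r F 0 x)) //.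
  by move=> x axb; rewrite kop_green.
have dS : dot (S (r + 0)%N \_ `[a, b]) f = (-1) ^+ r * N.
  rewrite (weak _ cSr) /N -INTZ; last exact: cont_onM.
  by apply: eq_INT => x _; rewrite addnn -mul2n /S green_sol_top// mulrA.
have f0 := dot_ge0 a b f; have w0 := dot_ge0 a b w.
have poincare : N <= lam k * dot f f.
  apply: le_of_sqr_le => //; first by rewrite mulr_ge0// ltW.
  have := cauchy_schwarz l0 lf; rewrite dS exprMn -exprM mulnC exprM sqrrN !expr1n mul1r.
  by move=> H; rewrite (le_trans H)// mulrAC ler_wpM2r.
apply: le_of_sqr_le => //; first by rewrite mulr_ge0// ltW.
have uF : dot u f = dot w (F \_ `[a, b]).
  rewrite (weak_derivative_dot ab lu lw uw lf fp).
  by apply: eq_INT => x axb; rewrite patchE_itv.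
have := cauchy_schwarz lw lF2; rewrite -uF uf dot_patch -/N => H.
by rewrite (le_trans H)// mulrAC mulrC ler_wpM2r.
Qed.

Theorem approximation_constant_eigenvalue n : (r <= n)%N ->
  approximation_constant a b r n (Num.sqrt (lam (n - r))).
Proof.
move=> rn; have [U HU] := eigenfunction_chains ab r2 cf.
pose e (i : 'I_n) := width_fun a b r U i.
have le i : l2 (e i) by exact: (width_fun_l2 HU).
have ind (c : 'I_n -> R) : dot (lincomb e c) (lincomb e c) = 0 -> forall i, c i = 0.
  exact: (width_independent ab r2 cf HU).
exists e.
  split=> [i|c]; first by apply/L2P.
  rewrite L2normE//; last exact: l2_sum.
  move=> /eqP; rewrite eqe sqrtr_eq0 => c0 i.
  by apply: ind; apply/eqP; rewrite eq_le dot_ge0 andbT.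
move=> u w [/L2P lu _] /L2P lw uw.
have [c Hc] := projection_exists lu le ind.
have lr := l2_residual c lu le.
exists c => [c'|]; rewrite !L2dist_lincomb//.
  by rewrite lee_fin ler_wsqrtr// projection_min.
rewrite L2normE// -EFinM lee_fin; apply: l2_sqrt_le => //; first exact/ltW/(cfs_pos cf).
apply: (orthogonal_width_le HU lr _ lu lw uw).
  by move=> i; rewrite subnKC// => ni; exact: (Hc (Ordinal ni)).
rewrite [RHS]dot_residual// big1 ?subr0// => i _.
by rewrite dotC Hc mulr0.
Qed.

Theorem smallest_approximation_constantE n d : (r <= n)%N ->
  smallest_approximation_constant a b r n d -> d = Num.sqrt (lam (n - r)).
Proof.
move=> rn [ad dmin]; apply/eqP; rewrite eq_le approximation_constant_ge// andbT.
by apply: dmin; exact: approximation_constant_eigenvalue.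
Qed.

End WidthBounds.

(** * The rate for the n-width *)

Section WidthRate.
Variable R : realType.

(** No sign is assumed on [y], which will be a discrete eigenvalue; [Num.sqrt] returns 0 on negative
    numbers, and this case is treated apart. *)
Lemma sqrt_dist_le (x y : R) : 0 < x ->
  `|Num.sqrt x - Num.sqrt y| <= `|y - x| / Num.sqrt x.
Proof.
move=> x0; have sx : 0 < Num.sqrt x by rewrite sqrtr_gt0.
have sy := sqrtr_ge0 y; have sxx := sqr_sqrtr (ltW x0).
rewrite ler_pdivlMr//; have [y0|y0] := leP 0 y.
  have syy := sqr_sqrtr y0.
  rewrite -[in leRHS]sxx -[in leRHS]syy subr_sqr normrM distrC ler_wpM2l//.
  by rewrite ger0_norm ?addr_ge0 ?(ltW sx)// lerDr.
rewrite (ler0_sqrtr (ltW y0)) subr0 gtr0_norm// -expr2 sxx.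
by rewrite ltr0_norm ?subr_lt0 ?(lt_trans y0)//; lra.
Qed.

Variables (a b : R) (r : nat).
Hypothesis ab : a < b.
Hypothesis r2 : (2 <= r)%N.
Variable g : R -> R -> R.
Hypothesis gG : forall x y, a <= x <= b -> a <= y <= b -> g x y = green a b r x y.

Theorem width_rate n : (r <= n)%N ->
  exists C : R, 0 < C /\
    forall d : R, smallest_approximation_constant a b r n d ->
    forall m (lamh : nat -> R), (n + 1 - r <= m)%N ->
      discrete_eigenvalues a b g m lamh ->
      `|d - Num.sqrt (lamh (n + 1 - r)%N)| <= C * mesh a b m ^+ (2 * r - 2).
Proof.
move=> rn; have [lam [phi cf]] := green_cfs ab r2.
have lk := cfs_pos cf (n - r).
have [C C0 HC] := rate_eigenvalue ab r2 cf (n - r).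
have s0 : 0 < Num.sqrt (lam (n - r)%N) by rewrite sqrtr_gt0.
exists (C / Num.sqrt (lam (n - r)%N)); split; first exact: divr_gt0.
(* Discrete eigenvalues are counted from 1 and [lam] from 0, so rank n + 1 - r corresponds to
   [lam (n - r)]. *)
move=> d sd m lamh; rewrite addn1 subSn// => km /(green_discrete_eigenvalues ab gG) dl.
rewrite (smallest_approximation_constantE ab r2 cf rn sd).
apply: (le_trans (sqrt_dist_le _ lk)).
by rewrite mulrAC ler_wpM2r ?invr_ge0 ?(ltW s0)// HC.
Qed.

End WidthRate.

(** * Conclusion for any kernel satisfying the distributional definition *)

Theorem mainTheorem2 (R : realType) (a b : R) (r : nat) (g : R -> R -> R)
    (hab : a < b) (hr : (3 <= r)%N) (hg : is_green a b r g) :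
  (forall (lam : nat -> R) (phi : nat -> R -> R),
     eigensystem a b g lam phi ->
     forall k : nat, (1 <= k)%N ->
     exists C : R, 0 < C /\
       forall (m : nat) (lamh : nat -> R) (phih : R -> R),
         (k <= m)%N -> mesh a b m < k.+1%:R^-1 ->
         discrete_eigenvalues a b g m lamh ->
         discrete_eigenfunction a b g m (lamh k) phih ->
         exists s : R, (s = 1 \/ s = -1) /\
           `|lam k - lamh k| + max_abs a b (fun x => phi k x - s * phih x) <=
           C * mesh a b m ^+ (2 * r - 2) *
           max_abs2 a b (fun x =>
             derive_itvn a b (2 * r - 2) (fun y => g x y * phi k y)))
  /\
  (forall n : nat, (r <= n)%N ->
     exists C : R, 0 < C /\
       forall d : R, smallest_approximation_constant a b r n d ->
       forall (m : nat) (lamh : nat -> R),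
         (n + 1 - r <= m)%N -> mesh a b m < (n + 2 - r)%:R^-1 ->
         discrete_eigenvalues a b g m lamh ->
         `|d - Num.sqrt (lamh (n + 1 - r)%N)| <= C * mesh a b m ^+ (2 * r - 2)).
Proof.
have r2 : (2 <= r)%N by exact: ltnW.
have gG := green_unique hab r2 hg.
split=> [lam phi es k k1|n rn].
  have [C [C0 HC]] := eigenpair_rate hab r2 gG es k1.
  by exists C; split=> // m lamh phih km _; exact: HC.
have [C [C0 HC]] := width_rate hab r2 gG rn.
by exists C; split=> // d sd m lamh km _; exact: HC.
Qed.
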